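(* Let $H$ and $K$ be semisimple Hopf algebras over $\mathbb{C}$ with Hopf pairing $\sigma:K^\ast\otimes H\to\mathbb{C}$. Then for any finite-dimensional left $H$-module $V$, $$\nu_n(K^{\ast\mathrm{cop}}\bowtie_\sigma V)=\sum_{W\in\mathsf{Irr}(K)}\nu_n^H(V\otimes W)\,\nu_n^{K^{\mathrm{cop}}}(W)\qquad(\forall n\geq1),$$ where $\mathsf{Irr}(K)$ denotes the set of isoclasses of irreducible left $K$-modules, and: (i) $K^{\ast\mathrm{cop}}\bowtie_\sigma V$ is the vector space $K^\ast\otimes V$ regarded as a left module over the quantum double $K^{\ast\mathrm{cop}}\bowtie_\sigma H$ via $$(k^\ast\bowtie h)\cdot(l^\ast\bowtie v)=\sum\sigma(l^\ast_{(3)},h_{(1)})\,(k^\ast l^\ast_{(2)}\bowtie h_{(2)}v)\,\sigma(S^{-1}(l^\ast_{(1)}),h_{(3)});$$ (ii) $V\otimes W$ is a left $H$-module via $h\cdot(v\otimes w)=\sum h_{(1)}v\otimes\sigma_r(h_{(2)})w$, and $\nu_n^{K^{\mathrm{cop}}}(W)$ is the $n$-th indicator of $W$ regarded as a left $K^{\mathrm{cop}}$-module.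
   Context: Semisimple Hopf algebras are finite-dimensional. A Hopf pairing $\sigma:K^\ast\otimes H\to\mathbb{C}$ is a bilinear form such that $\sigma_l:K^\ast\to H^\ast$, $k^\ast\mapsto\sigma(k^\ast,-)$ and $\sigma_r:H\to K$, $h\mapsto\sigma(-,h)$ (with $K=K^{\ast\ast}$) are Hopf algebra maps. Sweedler indices such as $l^\ast_{(1)}\otimes l^\ast_{(2)}\otimes l^\ast_{(3)}$ and the antipode $S$ in (i) refer to the Hopf algebra $K^\ast$. The (generalized) quantum double $K^{\ast\mathrm{cop}}\bowtie_\sigma H$ is the Hopf algebra with underlying vector space $K^\ast\otimes H$, tensor product coalgebra structure of $K^{\ast\mathrm{cop}}\otimes H$, unit $\varepsilon\bowtie1$ and product $(k^\ast\bowtie h)(l^\ast\bowtie h')=\sum\sigma(l^\ast_{(3)},h_{(1)})(k^\ast l^\ast_{(2)}\bowtie h_{(2)}h')\sigma(S^{-1}(l^\ast_{(1)}),h_{(3)})$. It is semisimple here. $K^{\mathrm{cop}}$ is $K$ with opposite comultiplication. For a finite-dimensional left module $V$ over a semisimple Hopf algebra $A$ over $\mathbb{C}$, $\nu_n(V)=\nu_n^A(V)=\langle\chi_V,\sum\Lambda_{(1)}\Lambda_{(2)}\cdots\Lambda_{(n)}\rangle$, where $\chi_V$ is the character of $V$ and $\Lambda$ is the integral of $A$ with $\varepsilon(\Lambda)=1$. *)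

(* Defs.v *)
From HB Require Import structures.
From mathcomp Require Import all_boot all_order all_algebra.
From mathcomp Require Import complex ring.
From mathcomp Require Import boolp classical_sets fsbigop reals.

Set Implicit Arguments.
Unset Strict Implicit.
Unset Printing Implicit Defensive.
Import GRing.Theory VectorInternalTheory.
Local Open Scope classical_set_scope.
Local Open Scope ring_scope.

Reserved Notation "u ⊗ v" (at level 35, right associativity).
Reserved Notation "a ∙ b" (at level 31, left associativity).

Section Tensor.
Variable F : fieldType.
Implicit Types P U V W : vectType F.

(* U ⊗ V is modelled by coordinate matrices with respect to the fixed bases
   [ebasis] of U and V; [tlift_tens] below is its universal property. *)
Definition tensor U V : vectType F := 'M[F]_(dim U, dim V).

Definition tens U V (u : U) (v : V) : tensor U V := (v2r u)^T *m v2r v.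

Local Notation "u ⊗ v" := (tens u v).

Definition ebasis U (i : 'I_(dim U)) : U := r2v (delta_mx 0 i).

Definition tlift_fun U V W (f : U -> V -> W) (t : tensor U V) : W :=
  \sum_i \sum_j (t : 'M_(_, _)) i j *: f (ebasis i) (ebasis j).

Fact tlift_fun_linear U V W (f : U -> V -> W) : linear (tlift_fun f).
Proof.
move=> a s t; rewrite /tlift_fun scaler_sumr -big_split /=.
apply: eq_bigr => i _; rewrite scaler_sumr -big_split /=.
by apply: eq_bigr => j _; rewrite !mxE scalerDl scalerA.
Qed.

HB.instance Definition _ U V W (f : U -> V -> W) :=
  GRing.isLinear.Build F (tensor U V) W _ (tlift_fun f) (tlift_fun_linear f).

(* The linear map with u ⊗ v |-> f u v, for f bilinear. *)
Definition tlift U V W (f : U -> V -> W) : 'Hom(tensor U V, W) :=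
  linfun (tlift_fun f).

Lemma ebasis_sum U (u : U) : u = \sum_i v2r u 0 i *: ebasis i.
Proof.
rewrite -[LHS]v2rK {1}[v2r u]row_sum_delta linear_sum.
by apply: eq_bigr => i _; rewrite linearZ.
Qed.

Lemma linear_ebasis U W (f : U -> W) :
  linear f -> forall u, f u = \sum_i v2r u 0 i *: f (ebasis i).
Proof.
move=> lf u; pose g : {linear U -> W} :=
  HB.pack f (GRing.isLinear.Build F U W _ f lf).
rewrite -[f u]/(g u) {1}(ebasis_sum u) linear_sum.
by apply: eq_bigr => i _; rewrite linearZ.
Qed.

Lemma tlift_tens U V W (f : U -> V -> W) :
  (forall u, linear (f u)) -> (forall v, linear (f^~ v)) ->
  forall u v, tlift f (tens u v) = f u v.
Proof.
move=> lf1 lf2 u v; rewrite lfunE /= /tlift_fun.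
rewrite (linear_ebasis (lf2 v) u); apply: eq_bigr => i _.
rewrite (linear_ebasis (lf1 _) v) scaler_sumr; apply: eq_bigr => j _.
by rewrite /tens mxE big_ord1 mxE scalerA.
Qed.

Lemma tlift_param P U V W (f : P -> U -> V -> W) :
  (forall u v, linear (fun p => f p u v)) ->
  forall t, linear (fun p => tlift (f p) t).
Proof.
move=> lf t a p q; rewrite !lfunE /= /tlift_fun scaler_sumr -big_split /=.
apply: eq_bigr => i _; rewrite scaler_sumr -big_split /=.
by apply: eq_bigr => j _; rewrite lf scalerDr !scalerA mulrC.
Qed.

Lemma tlift_apply U V W (W' : vectType F) (f : U -> V -> 'Hom(W, W')) t w :
  tlift f t w = tlift (fun u v => f u v w) t.
Proof.
rewrite !lfunE /= /tlift_fun sum_lfunE; apply: eq_bigr => i _.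
by rewrite sum_lfunE; apply: eq_bigr => j _; rewrite scale_lfunE.
Qed.

Lemma tens_linearr U V (u : U) : linear (@tens U V u).
Proof. by move=> a x y; rewrite /tens linearP /= mulmxDr scalemxAr. Qed.

Lemma tens_linearl U V (v : V) : linear ((@tens U V)^~ v).
Proof. by move=> a x y; rewrite /tens !linearP /= mulmxDl scalemxAl. Qed.

Lemma linfunE_linear U W (g : U -> W) :
  linear g -> forall u, linfun g u = g u.
Proof.
move=> lg u; pose h : {linear U -> W} :=
  HB.pack g (GRing.isLinear.Build F U W _ g lg).
by rewrite -[g]/(h : U -> W) lfunE.
Qed.

Section Quadrilinear.
Variables (U V U' V' W : vectType F) (f : U -> V -> U' -> V' -> W).
Hypothesis f1 : forall v u' v', linear (fun u => f u v u' v').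
Hypothesis f2 : forall u u' v', linear (fun v => f u v u' v').
Hypothesis f3 : forall u v v', linear (fun u' => f u v u' v').
Hypothesis f4 : forall u v u', linear (fun v' => f u v u' v').

Lemma tlift_hom_tens u v u' v' :
  tlift (fun u v => tlift (f u v)) (u ⊗ v) (u' ⊗ v') = f u v u' v'.
Proof.
rewrite tlift_tens ?tlift_tens //.
- by move=> x a y z; apply/lfunP => t; rewrite add_lfunE scale_lfunE tlift_param.
- move=> x a y z; apply/lfunP => t; rewrite add_lfunE scale_lfunE.
  exact: (tlift_param (f := f^~ x)).
Qed.

Lemma tlift_tens_tens u v u' v' :
  tlift (fun x y => tlift (fun u v => tlift (f u v) y) x)
    ((u ⊗ v) ⊗ (u' ⊗ v')) = f u v u' v'.
Proof.
have E y a b : tlift (fun u v => tlift (f u v) y) (a ⊗ b) = tlift (f a b) y.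
  rewrite tlift_tens // => x; first exact: tlift_param.
  exact: (tlift_param (f := f^~ x)).
rewrite tlift_tens ?E ?tlift_tens // => x; last by move=> c y z; rewrite linearP.
apply: (tlift_param (f := fun y u v => tlift (f u v) y)) => a b c y z.
by rewrite linearP.
Qed.

End Quadrilinear.

Section Curry.
Variables (U V W : vectType F) (f : 'Hom(tensor U V, W)).

Definition curryl_fun (u : U) : 'Hom(V, W) := linfun (fun v => f (tens u v)).
Definition curryr_fun (v : V) : 'Hom(U, W) := linfun (fun u => f (tens u v)).
Definition curryl : 'Hom(U, 'Hom(V, W)) := linfun curryl_fun.
Definition curryr : 'Hom(V, 'Hom(U, W)) := linfun curryr_fun.

Lemma currylE u v : curryl u v = f (tens u v).
Proof.
have E x y : curryl_fun x y = f (tens x y).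
  by rewrite linfunE_linear // => a b c; rewrite tens_linearr linearP.
rewrite linfunE_linear ?E // => a x y; apply/lfunP => z.
by rewrite add_lfunE scale_lfunE !E tens_linearl linearP.
Qed.

Lemma curryrE u v : curryr v u = f (tens u v).
Proof.
have E x y : curryr_fun x y = f (tens y x).
  by rewrite linfunE_linear // => a b c; rewrite tens_linearl linearP.
rewrite linfunE_linear ?E // => a x y; apply/lfunP => z.
by rewrite add_lfunE scale_lfunE !E tens_linearr linearP.
Qed.

End Curry.

Definition dual U : vectType F := 'Hom(U, F^o).

Definition dual_ebasis U (i : 'I_(dim U)) : dual U :=
  linfun (fun u => v2r u 0 i : F^o).

Definition bidual_fun U (u : U) : dual (dual U) :=
  linfun (fun f : dual U => f u : F^o).

(* The canonical isomorphism U -> U^**. *)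
Definition bidual U : 'Hom(U, dual (dual U)) := linfun (@bidual_fun U).

Lemma dual_ebasisE U (i : 'I_(dim U)) (u : U) :
  dual_ebasis i u = v2r u 0 i :> F.
Proof. by rewrite linfunE_linear // => a x y; rewrite linearP !mxE. Qed.

Lemma bidualE U (u : U) (f : dual U) : bidual U u f = f u.
Proof.
have E x (g : dual U) : bidual_fun x g = g x.
  by rewrite linfunE_linear // => a b c; rewrite add_lfunE scale_lfunE.
rewrite linfunE_linear ?E // => a x y; apply/lfunP => g.
by rewrite add_lfunE scale_lfunE !E linearP.
Qed.

Lemma bidual_ker U : lker (bidual U) == 0%VS.
Proof.
apply/lker0P => x y /lfunP exy; rewrite [x]ebasis_sum [y]ebasis_sum.
apply: eq_bigr => i _; congr (_ *: _).
by have := exy (dual_ebasis i); rewrite !bidualE !dual_ebasisE.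
Qed.

Lemma bidual_inv U (phi : dual (dual U)) (f : dual U) :
  f ((bidual U)^-1%VF phi) = phi f.
Proof.
have dimE W : \dim (fullv : {vspace dual W}) = \dim (fullv : {vspace W}).
  by rewrite !dimvf /dim /= muln1.
have im : limg (bidual U) = fullv.
  apply/eqP; rewrite eqEdim subvf /= limg_dim_eq ?dimE //.
  by rewrite (eqP (bidual_ker U)) capv0.
by rewrite -bidualE limg_lfunVK // im memvf.
Qed.

Definition lftrace V (f : 'End(V)) : F :=
  \tr (passmx.mxof (vbasis fullv) (vbasis fullv) f).

End Tensor.

Notation "u ⊗ v" := (tens u v) : ring_scope.

(* The structure maps alone.  The dual, the co-opposite and the quantum double
   are given by explicit structure maps, with S^-1 the total inverse of MathComp's
   'End; [is_hopf] states the axioms. *)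
Record hopfData (F : fieldType) := HopfData {
  hcar :> vectType F;
  hmul : 'Hom(tensor hcar hcar, hcar);
  hone : hcar;
  hcomul : 'Hom(hcar, tensor hcar hcar);
  hcounit : dual hcar;
  hantipode : 'End(hcar)
}.
Arguments hmul {F h}.
Arguments hcomul {F h}.

Definition hprod (F : fieldType) (A : hopfData F) (a b : A) : A := hmul (a ⊗ b).
Notation "a ∙ b" := (hprod a b) : ring_scope.

Section Sweedler.
Variables (F : fieldType) (A : hopfData F) (W : vectType F).

(* sweedler2 (fun a1 a2 => E) a is the sum of E over a_(1) ⊗ a_(2), and
   sweedler3 (fun a1 a2 a3 => E) a that over a_(1) ⊗ a_(2) ⊗ a_(3); E has to be
   multilinear. *)
Definition sweedler2 (f : A -> A -> W) : 'Hom(A, W) :=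
  (tlift f \o @hcomul F A)%VF.

Definition sweedler3 (f : A -> A -> A -> W) : 'Hom(A, W) :=
  (tlift (fun a a3 : A =>
     (tlift (fun a1 a2 : A => f a1 a2 a3) \o @hcomul F A)%VF a)
   \o @hcomul F A)%VF.

Lemma sweedler2_param (P : vectType F) (f : P -> A -> A -> W) :
  (forall a1 a2, linear (fun p => f p a1 a2)) ->
  forall a, linear (fun p => sweedler2 (f p) a).
Proof.
by move=> lf a c p q; rewrite !comp_lfunE; apply: tlift_param.
Qed.

Lemma sweedler3_param (P : vectType F) (f : P -> A -> A -> A -> W) :
  (forall a1 a2 a3, linear (fun p => f p a1 a2 a3)) ->
  forall a, linear (fun p => sweedler3 (f p) a).
Proof.
move=> lf a c p q; rewrite !comp_lfunE.
apply: (tlift_param (f := fun p x a3 => (tlift (fun a1 a2 : A => f p a1 a2 a3)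
  \o @hcomul F A)%VF x)) => x a3 {}c {}p {}q; rewrite !comp_lfunE.
exact: (tlift_param (f := fun p a1 a2 => f p a1 a2 a3)).
Qed.

End Sweedler.

Lemma hprod_linearr (F : fieldType) (A : hopfData F) (a : A) :
  linear (fun b : A => a ∙ b).
Proof. by move=> c x y; rewrite /hprod tens_linearr linearP. Qed.

Lemma hprod_linearl (F : fieldType) (A : hopfData F) (b : A) :
  linear (fun a : A => a ∙ b).
Proof. by move=> c x y; rewrite /hprod tens_linearl linearP. Qed.

Record is_hopf (F : fieldType) (A : hopfData F) : Prop := IsHopf {
  hprodA : forall a b c : A, a ∙ (b ∙ c) = (a ∙ b) ∙ c;
  hprod1l : forall a : A, hone A ∙ a = a;
  hprod1r : forall a : A, a ∙ hone A = a;
  hcomulA : forall a : A,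
    sweedler2 (fun x a3 : A => sweedler2 (fun a1 a2 : A => a1 ⊗ a2 ⊗ a3) x) a
    = sweedler2 (fun a1 x : A => sweedler2 (fun a2 a3 : A => a1 ⊗ a2 ⊗ a3) x) a;
  hcounitl : forall a : A,
    sweedler2 (fun a1 a2 : A => (hcounit A a1 : F) *: a2) a = a;
  hcounitr : forall a : A,
    sweedler2 (fun a1 a2 : A => (hcounit A a2 : F) *: a1) a = a;
  hcomulM : forall a b : A,
    hcomul (a ∙ b) =
    sweedler2 (fun a1 a2 : A =>
      sweedler2 (fun b1 b2 : A => (a1 ∙ b1) ⊗ (a2 ∙ b2)) b) a;
  hcomul1 : hcomul (hone A) = hone A ⊗ hone A;
  hcounitM : forall a b : A, hcounit A (a ∙ b) = hcounit A a * hcounit A b;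
  hcounit1 : hcounit A (hone A) = 1;
  hantipodel : forall a : A,
    sweedler2 (fun a1 a2 : A => hantipode A a1 ∙ a2) a
    = (hcounit A a : F) *: hone A;
  hantipoder : forall a : A,
    sweedler2 (fun a1 a2 : A => a1 ∙ hantipode A a2) a
    = (hcounit A a : F) *: hone A
}.

Record hopfAlgebra (F : fieldType) := HopfAlgebra {
  hdata :> hopfData F;
  hopfP : is_hopf hdata
}.

Record is_hopf_map (F : fieldType) (A B : hopfData F) (f : 'Hom(A, B)) : Prop :=
  IsHopfMap {
    hmap_prod : forall a b : A, f (a ∙ b) = f a ∙ f b;
    hmap_one : f (hone A) = hone B;
    hmap_comul : forall a : A,
      hcomul (f a) = sweedler2 (fun a1 a2 : A => f a1 ⊗ f a2) a;
    hmap_counit : forall a : A, hcounit B (f a) = hcounit A a;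
    hmap_antipode : forall a : A, f (hantipode A a) = hantipode B (f a)
  }.

Section DualCop.
Variables (F : fieldType) (A : hopfData F).

Definition dual_hmul : 'Hom(tensor (dual A) (dual A), dual A) :=
  tlift (fun f g : dual A => sweedler2 (fun a1 a2 : A => f a1 * g a2 : F^o)).

(* The transpose of the product, through A^* ⊗ A^* = (A ⊗ A)^*. *)
Definition dual_hcomul : 'Hom(dual A, tensor (dual A) (dual A)) :=
  linfun (fun f : dual A =>
    \sum_i \sum_j (f ((ebasis i : A) ∙ (ebasis j : A)) : F)
                    *: (dual_ebasis i ⊗ dual_ebasis j)).

Lemma dual_hcomulE (f : dual A) (a b : A) :
  tlift (fun g h : dual A => g a * h b : F^o) (dual_hcomul f) = f (a ∙ b).
Proof.
rewrite [dual_hcomul f]linfunE_linear => [|c g h]; last first.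
  rewrite scaler_sumr -big_split /=; apply: eq_bigr => i _.
  rewrite scaler_sumr -big_split /=; apply: eq_bigr => j _.
  by rewrite add_lfunE scale_lfunE scalerDl scalerA.
pose B : 'Hom(A, 'Hom(A, F^o)) := curryl (f \o hmul)%VF.
have BE x y : f (x ∙ y) = B x y by rewrite currylE comp_lfunE.
have -> : f (a ∙ b) = \sum_i \sum_j v2r a 0 i * v2r b 0 j *
    f ((ebasis i : A) ∙ (ebasis j : A)) :> F.
  rewrite BE [in LHS](ebasis_sum a) linear_sum sum_lfunE.
  apply: eq_bigr => i _; rewrite linearZ scale_lfunE {1}(ebasis_sum b).
  rewrite linear_sum scaler_sumr; apply: eq_bigr => j _.
  by rewrite linearZ BE scalerA.
rewrite linear_sum; apply: eq_bigr => i _; rewrite linear_sum.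
apply: eq_bigr => j _; rewrite linearZ /= tlift_tens.
- by rewrite !dual_ebasisE /GRing.scale /=; ring.
- by move=> g c h k; rewrite add_lfunE scale_lfunE /GRing.scale /=; ring.
- by move=> h c g k; rewrite add_lfunE scale_lfunE /GRing.scale /=; ring.
Qed.

Definition dual_hopf : hopfData F := {|
  hcar := dual A;
  hmul := dual_hmul;
  hone := hcounit A;
  hcomul := dual_hcomul;
  hcounit := linfun (fun f : dual A => f (hone A) : F^o);
  hantipode := linfun (fun f : dual A => (f \o hantipode A)%VF)
|}.

Definition cop : hopfData F := {|
  hcar := A;
  hmul := @hmul F A;
  hone := hone A;
  hcomul := sweedler2 (fun a1 a2 : A => a2 ⊗ a1);
  hcounit := hcounit A;
  hantipode := (hantipode A)^-1%VF
|}.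

End DualCop.

Section Modules.
Variables (F : fieldType) (A : hopfData F).

Definition is_rep (V : vectType F) (rho : 'Hom(A, 'End(V))) : Prop :=
  rho (hone A) = \1%VF /\
  forall a b : A, rho (a ∙ b) = (rho a \o rho b)%VF.

Record lmodule := LModule {
  mod_car :> vectType F;
  mod_rep : 'Hom(A, 'End(mod_car));
  mod_repP : is_rep mod_rep
}.

Definition mod_iso (M N : lmodule) : Prop :=
  exists f : 'Hom(M, N),
    bijective f /\ forall (a : A) (m : M), f (mod_rep M a m) = mod_rep N a (f m).

Definition stable (V : vectType F) (rho : 'Hom(A, 'End(V))) (U : {vspace V}) :=
  forall a : A, (rho a @: U <= U)%VS.

Definition irreducible (M : lmodule) : Prop :=
  (fullv : {vspace M}) <> 0%VS /\
  forall U : {vspace M}, stable (mod_rep M) U -> U = 0%VS \/ U = fullv.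

(* A set of isoclasses of all modules would be too large to be a type; every
   module is isomorphic to one carried by some F^n (lemma [mxmodule_iso]), and
   [Irr] is made of the isoclasses of the latter. *)
Record mxmodule := MxModule {
  mx_dim : nat;
  mx_rep : 'Hom(A, 'End('rV[F]_mx_dim));
  mx_repP : is_rep mx_rep
}.

Definition module_of_mx (M : mxmodule) : lmodule := LModule (mx_repP M).
Coercion module_of_mx : mxmodule >-> lmodule.

Lemma mxmodule_iso (M : lmodule) : exists N : mxmodule, mod_iso M N.
Proof.
pose p : 'Hom(M, 'rV[F]_(dim M)) := linfun v2r.
pose q : 'Hom('rV[F]_(dim M), M) := linfun r2v.
have pq x : p (q x) = x by rewrite !lfunE /= r2vK.
have qp x : q (p x) = x by rewrite !lfunE /= v2rK.
pose g (a : A) := (p \o mod_rep M a \o q)%VF.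
have lg : linear g.
  move=> c a b; apply/lfunP => x; rewrite /g add_lfunE scale_lfunE !comp_lfunE.
  by rewrite linearP add_lfunE scale_lfunE linearP.
pose h : {linear A -> 'End('rV[F]_(dim M))} :=
  HB.pack g (GRing.isLinear.Build F A 'End('rV[F]_(dim M)) _ g lg).
have hE a : linfun h a = g a by rewrite lfunE.
have hP : is_rep (linfun h).
  have [rep1 repM] := mod_repP M; split=> [|a b]; apply/lfunP => x.
    by rewrite hE !comp_lfunE rep1 !id_lfunE pq.
  by rewrite !hE !comp_lfunE repM comp_lfunE qp.
exists (MxModule hP), p; split=> [|a m]; first by exists q.
by rewrite /= hE !comp_lfunE qp.
Qed.

Definition Irr : set (set mxmodule) :=
  [set c | exists2 M : mxmodule,
             irreducible M & c = [set N : mxmodule | mod_iso M N]].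

Fact zero_module_subproof : is_rep (0 : 'Hom(A, 'End('rV[F]_0))).
Proof. by split=> [|a b]; apply/lfunP => v; apply/rowP; case. Qed.

(* A representative of an isoclass; the zero module is used only if c is empty. *)
Definition class_repr (c : set mxmodule) : mxmodule :=
  if pselect (exists M, c M) is left cM then projT1 (cid cM)
  else MxModule zero_module_subproof.

Definition regular_rep : 'Hom(A, 'End(A)) := curryl (@hmul F A).

Definition semisimple : Prop :=
  forall U : {vspace A}, stable regular_rep U ->
  exists U' : {vspace A}, [/\ stable regular_rep U',
    (U + U')%VS = fullv & (U :&: U')%VS = 0%VS].

Definition is_normalized_integral (L : A) : Prop :=
  [/\ forall a : A, a ∙ L = (hcounit A a : F) *: L,
      forall a : A, L ∙ a = (hcounit A a : F) *: L
    & hcounit A L = 1].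

(* It is unique; the default 0 is used only if there is none, that is, never for
   a semisimple Hopf algebra. *)
Definition integral : A := xget 0 [set L | is_normalized_integral L].

(* a |-> a_(1) a_(2) ... a_(n), for n >= 1. *)
Definition sweedler_prod (n : nat) : 'End(A) :=
  iter n.-1 (fun P : 'End(A) => sweedler2 (fun x b : A => P x ∙ b)) \1%VF.

Definition character (V : vectType F) (rho : 'Hom(A, 'End(V))) (a : A) : F :=
  lftrace (rho a).

Definition nu (n : nat) (V : vectType F) (rho : 'Hom(A, 'End(V))) : F :=
  character rho (sweedler_prod n integral).

End Modules.
Arguments Irr {F} A _.
Arguments nu {F} A n {V} rho.

Section Double.
Variables (F : fieldType) (H K : hopfData F).
Local Notation Kd := (dual_hopf K).
Variable sigma : 'Hom(tensor Kd H, F^o).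

Definition sigma_l : 'Hom(Kd, dual_hopf H) := curryl sigma.

(* h |-> sigma(-, h), with values in K through K = K^**. *)
Definition sigma_r : 'Hom(H, K) := ((bidual K)^-1 \o curryr sigma)%VF.

Lemma sigma_rE (k : Kd) (h : H) : k (sigma_r h) = sigma (k ⊗ h).
Proof. by rewrite comp_lfunE bidual_inv curryrE. Qed.

Definition is_hopf_pairing : Prop :=
  is_hopf_map sigma_l /\ is_hopf_map sigma_r.

Local Notation s k h := (sigma (k ⊗ h) : F).
Local Notation Sinv := (hantipode Kd)^-1%VF.

Definition double_mul : 'Hom(tensor (tensor Kd H) (tensor Kd H), tensor Kd H) :=
  tlift (fun x y : tensor Kd H =>
    tlift (fun (k : Kd) (h : H) =>
      tlift (fun (l : Kd) (h' : H) =>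
        sweedler3 (fun l1 l2 l3 : Kd =>
          sweedler3 (fun h1 h2 h3 : H =>
            (s l3 h1 * s (Sinv l1) h3) *: ((k ∙ l2) ⊗ (h2 ∙ h'))) h) l) y) x).

Lemma double_mulE (k l : Kd) (h h' : H) :
  double_mul ((k ⊗ h) ⊗ (l ⊗ h')) =
  sweedler3 (fun l1 l2 l3 : Kd =>
    sweedler3 (fun h1 h2 h3 : H =>
      (s l3 h1 * s (Sinv l1) h3) *: ((k ∙ l2) ⊗ (h2 ∙ h'))) h) l.
Proof.
apply: (tlift_tens_tens (f := fun k h l h' => sweedler3 (fun l1 l2 l3 : Kd =>
    sweedler3 (fun h1 h2 h3 : H =>
      (s l3 h1 * s (Sinv l1) h3) *: ((k ∙ l2) ⊗ (h2 ∙ h'))) h) l)).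
- move=> {}h {}l {}h'; apply: sweedler3_param => l1 l2 l3.
  apply: sweedler3_param => h1 h2 h3 c x y.
  by rewrite hprod_linearl tens_linearl scalerDr !scalerA mulrC.
- move=> {}k {}l {}h'; apply: sweedler3_param => l1 l2 l3 c x y.
  by rewrite linearP.
- by move=> {}k {}h {}h' c x y; rewrite linearP.
- move=> {}k {}h {}l; apply: sweedler3_param => l1 l2 l3.
  apply: sweedler3_param => h1 h2 h3 c x y.
  by rewrite hprod_linearr tens_linearr scalerDr !scalerA mulrC.
Qed.

Definition double_one : tensor Kd H := hone Kd ⊗ hone H.

Definition double_comul :
    'Hom(tensor Kd H, tensor (tensor Kd H) (tensor Kd H)) :=
  tlift (fun (k : Kd) (h : H) =>
    sweedler2 (fun k1 k2 : cop Kd =>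
      sweedler2 (fun h1 h2 : H =>
        ((k1 : Kd) ⊗ h1) ⊗ ((k2 : Kd) ⊗ h2)) h) k).

Definition double_counit : dual (tensor Kd H) :=
  tlift (fun (k : Kd) (h : H) => hcounit Kd k * hcounit H h : F^o).

(* K^*cop and H are Hopf subalgebras and k ⋈ h = (k ⋈ 1)(ε ⋈ h), so that
   S(k ⋈ h) = (ε ⋈ S(h)) (S^-1(k) ⋈ 1). *)
Definition double_antipode : 'End(tensor Kd H) :=
  tlift (fun (k : Kd) (h : H) =>
    double_mul ((hone Kd ⊗ hantipode H h) ⊗ (Sinv k ⊗ hone H))).

Definition quantum_double : hopfData F := {|
  hcar := tensor Kd H;
  hmul := double_mul;
  hone := double_one;
  hcomul := double_comul;
  hcounit := double_counit;
  hantipode := double_antipode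
|}.

Definition double_rep (V : lmodule H) : 'Hom(quantum_double, 'End(tensor Kd V)) :=
  tlift (fun (k : Kd) (h : H) =>
    tlift (fun (l : Kd) (v : V) =>
      sweedler3 (fun l1 l2 l3 : Kd =>
        sweedler3 (fun h1 h2 h3 : H =>
          (s l3 h1 * s (Sinv l1) h3) *: ((k ∙ l2) ⊗ mod_rep V h2 v)) h) l)).

Lemma double_repE (V : lmodule H) (k l : Kd) (h : H) (v : V) :
  double_rep V (k ⊗ h) (l ⊗ v) =
  sweedler3 (fun l1 l2 l3 : Kd =>
    sweedler3 (fun h1 h2 h3 : H =>
      (s l3 h1 * s (Sinv l1) h3) *: ((k ∙ l2) ⊗ mod_rep V h2 v)) h) l.
Proof.
apply: (tlift_hom_tens (f := fun k h l v => sweedler3 (fun l1 l2 l3 : Kd =>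
    sweedler3 (fun h1 h2 h3 : H =>
      (s l3 h1 * s (Sinv l1) h3) *: ((k ∙ l2) ⊗ mod_rep V h2 v)) h) l)).
- move=> {}h {}l {}v; apply: sweedler3_param => l1 l2 l3.
  apply: sweedler3_param => h1 h2 h3 c x y.
  by rewrite hprod_linearl tens_linearl scalerDr !scalerA mulrC.
- move=> {}k {}l {}v; apply: sweedler3_param => l1 l2 l3 c x y.
  by rewrite linearP.
- by move=> {}k {}h {}v c x y; rewrite linearP.
- move=> {}k {}h {}l; apply: sweedler3_param => l1 l2 l3.
  apply: sweedler3_param => h1 h2 h3 c x y.
  by rewrite linearP tens_linearr scalerDr !scalerA mulrC.
Qed.

Definition tensor_rep (V : lmodule H) (W : lmodule K) :
    'Hom(H, 'End(tensor V W)) :=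
  sweedler2 (fun h1 h2 : H =>
    tlift (fun (v : V) (w : W) =>
      mod_rep V h1 v ⊗ mod_rep W (sigma_r h2) w)).

Lemma tensor_repE (V : lmodule H) (W : lmodule K) (h : H) (v : V) (w : W) :
  tensor_rep V W h (v ⊗ w) =
  sweedler2 (fun h1 h2 : H =>
    mod_rep V h1 v ⊗ mod_rep W (sigma_r h2) w) h.
Proof.
rewrite /tensor_rep /sweedler2 !comp_lfunE tlift_apply.
congr (fun_of_lfun (tlift _) _); apply/funext => h1; apply/funext => h2.
by rewrite tlift_tens // => x c y z; rewrite linearP ?tens_linearr ?tens_linearl.
Qed.

End Double.

Definition cop_rep (F : fieldType) (K : hopfData F) (W : lmodule K) :
  'Hom(cop K, 'End(W)) := mod_rep W.

(* Main.v *)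
(* Integrals make a semisimple Hopf algebra A Frobenius, with the integral lam of
   A^* as form.  Schur's lemma gives matrix units in A, hence
   tr(x |-> a x b) = Σ_W χ_W(a) χ_W(b) over the irreducible W, and
   tr(S^2) = Σ_W dim W tr(ρ_W(z)^-1), where z intertwines W with its twist by S^2;
   each summand is positive because S^4 is conjugation by a grouplike element of
   finite order.  Thus lam(1) = tr(S^2) > 0, which forces S^2 = 1 (Larson and
   Radford).

   With S^2 = 1, an element of K^* ⊗ V is treated as a function K -> V.  The double
   D has the integral ell ⊗ L with ell = lam / lam(1), and the n-th Sweedler power of
   an integral is central, so that ν_n(K^* ⋈ V) is the trace of a convolution
   operator on K and equals Σ χ_V(b) lam(r(c) q), where b ⊗ c is the coproduct of
   the n-th Sweedler power of L, r = sigma_r and q is the n-th Sweedler power in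
   K^cop of the integral of K.  As q is central, lam(r(c) q) is the trace of
   x |-> r(c) x q on K, that is, Σ_W χ_W(r(c)) χ_W(q). *)
Require Import Defs.
From HB Require Import structures.
From mathcomp Require Import all_boot all_order all_algebra.
From mathcomp Require Import complex ring zify.
From mathcomp Require Import boolp classical_sets fsbigop reals.

Set Implicit Arguments.
Unset Strict Implicit.
Unset Printing Implicit Defensive.
Import Order.TTheory GRing.Theory Num.Theory VectorInternalTheory.
Local Open Scope classical_set_scope.
Local Open Scope ring_scope.

(** The theory of a single semisimple Hopf algebra comes first because S^2 = 1 enters the double
    everywhere. It turns S^-1 into S, it makes lam the regular character, hence a trace invariant
    under S, it makes lam a left as well as a right integral of the dual, and it makes L
    cocommutative. The final computation uses each of these facts.

    The obstacle in the double is the threefold Sweedler sum on K^* in its product. Passing to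
    functions K -> V transposes coproducts of K^* into products of K, and the sum over l becomes the
    single value l(S(r(h_(3))) x r(h_(1))). Multiplicativity of the coproduct and the power formula
    then come down to cancelling factors r(q) S(r(p)) with p and q adjacent legs of one element.
    Associativity needs no separate argument: the double is K^* ⊗ V for V the regular H-module, so
    it is an instance of the module axiom. The integral of the double is exhibited and verified
    directly. *)

Notation "'\sw_' ( x , y <- a ) E" := (sweedler2 (fun x y => E) a)
  (at level 34, E at level 41, x name, y name, a at level 35,
   format "'[' \sw_ ( x ,  y  <-  a )  '/  '  E ']'") : ring_scope.

(** * Linearity and Sweedler sums *)

Section Linearity.
Variable F : fieldType.
Implicit Types (P U V W : vectType F) (A : hopfData F).

Lemma lin_id U : linear (fun x : U => x). Proof. by []. Qed.

Lemma lin_app U V W (g : V -> W) (f : U -> V) :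
  linear g -> linear f -> linear (fun x => g (f x)).
Proof. by move=> lg lf c x y; rewrite lf lg. Qed.

Lemma lin_lfun U V W (g : 'Hom(V, W)) (f : U -> V) :
  linear f -> linear (fun x => g (f x)).
Proof. by move=> lf c x y; rewrite lf linearP. Qed.

Lemma lin_lfun_app U V W (G : U -> 'Hom(V, W)) (v : V) :
  linear G -> linear (fun x => G x v).
Proof. by move=> lf c x y; rewrite lf add_lfunE scale_lfunE. Qed.

Lemma lin_add U W (f g : U -> W) :
  linear f -> linear g -> linear (fun x => f x + g x).
Proof. by move=> lf lg c x y; rewrite lf lg scalerDr addrACA. Qed.

Lemma lin_opp U W (f : U -> W) : linear f -> linear (fun x => - f x).
Proof. by move=> lf c x y; rewrite lf opprD scalerN. Qed.

Lemma lin_sum U W (I : Type) (r : seq I) (p : pred I) (f : I -> U -> W) :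
  (forall i, linear (f i)) -> linear (fun x => \sum_(i <- r | p i) f i x).
Proof.
move=> lf c x y; rewrite scaler_sumr -big_split /=.
by apply: eq_bigr => i _; rewrite lf.
Qed.

Lemma lin_scaler U W (c : F) (f : U -> W) :
  linear f -> linear (fun x => c *: f x).
Proof. by move=> lf d x y; rewrite lf scalerDr !scalerA mulrC. Qed.

Lemma lin_scalel U W (f : U -> F^o) (w : W) :
  linear f -> linear (fun x => (f x : F) *: w).
Proof. by move=> lf d x y; rewrite lf scalerDl scalerA. Qed.

Lemma lin_mulr U (c : F) (f : U -> F^o) :
  linear f -> linear (fun x => c * f x : F^o).
Proof. exact: lin_scaler. Qed.

Lemma lin_mull U (c : F) (f : U -> F^o) :
  linear f -> linear (fun x => f x * c : F^o).
Proof. exact: (@lin_scalel _ F^o). Qed.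

Lemma lin_tensr U V W (u : U) (f : W -> V) :
  linear f -> linear (fun x => u ⊗ f x).
Proof. exact/lin_app/tens_linearr. Qed.

Lemma lin_tensl U V W (v : V) (f : W -> U) :
  linear f -> linear (fun x => f x ⊗ v).
Proof. exact/(lin_app (g := @tens F U V ^~ v))/tens_linearl. Qed.

Lemma lin_hprodr U A (a : A) (f : U -> A) :
  linear f -> linear (fun x => a ∙ f x).
Proof. exact/lin_app/hprod_linearr. Qed.

Lemma lin_hprodl U A (b : A) (f : U -> A) :
  linear f -> linear (fun x => f x ∙ b).
Proof. exact/(lin_app (g := @hprod F A ^~ b))/hprod_linearl. Qed.

Lemma lin_comp_lfunl P U V W (g : 'Hom(U, V)) (G : P -> 'Hom(V, W)) :
  linear G -> linear (fun x => (G x \o g)%VF).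
Proof. by move=> lf c x y; rewrite lf comp_lfunDl comp_lfunZl. Qed.

Lemma lin_comp_lfunr P U V W (g : 'Hom(V, W)) (G : P -> 'Hom(U, V)) :
  linear G -> linear (fun x => (g \o G x)%VF).
Proof. by move=> lf c x y; rewrite lf comp_lfunDr comp_lfunZr. Qed.

Lemma lin_tlift P U V W (f : P -> U -> V -> W) t :
  (forall u v, linear (fun p => f p u v)) ->
  linear (fun p => tlift (f p) t).
Proof. by move=> lf; apply: tlift_param. Qed.

Lemma lin_tlift_hom P U V W (f : P -> U -> V -> W) :
  (forall u v, linear (fun p => f p u v)) ->
  linear (fun p => tlift (f p)).
Proof.
move=> lf c x y; apply/lfunP => t; rewrite add_lfunE scale_lfunE.
exact: lin_tlift.
Qed.

Lemma lin_lfun_eta U V (g : 'Hom(U, V)) : linear g.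
Proof. exact: linearP. Qed.

Lemma lin_sw P W A (f : P -> A -> A -> W) a :
  (forall x y, linear (fun p => f p x y)) ->
  linear (fun p => sweedler2 (f p) a).
Proof. by move=> lf; apply: sweedler2_param. Qed.

Lemma linear0P U W (f : U -> W) : linear f -> f 0 = 0.
Proof. by move=> lf; have := lf (-1) 0 0; rewrite scaler0 addr0 scaleN1r addNr. Qed.

Lemma linearZP U W (f : U -> W) :
  linear f -> forall c x, f (c *: x) = c *: f x.
Proof. by move=> lf c x; have := lf c x 0; rewrite !addr0 linear0P ?addr0. Qed.

Lemma linearDP U W (f : U -> W) : linear f -> {morph f : x y / x + y}.
Proof. by move=> lf x y; have := lf 1 x y; rewrite !scale1r. Qed.

Lemma linear_sumP U W (f : U -> W) (J : finType) (c : J -> F) (e : J -> U) :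
  linear f -> f (\sum_j c j *: e j) = \sum_j c j *: f (e j).
Proof.
move=> lf; pose g : {linear U -> W} :=
  HB.pack f (GRing.isLinear.Build F U W _ f lf).
rewrite -[f]/(g : U -> W) linear_sum; apply: eq_bigr => j _.
by rewrite linearZ.
Qed.

End Linearity.

(** A hook, redefined once [ev] is available, so that [lin] also handles linearity in the point of
    evaluation. *)
Ltac lin_ext := fail.
Ltac lin_step := first
  [ assumption
  | exact: lin_id
  | refine (lin_hprodr _ _) | refine (lin_hprodl _ _)
  | refine (lin_tensr _ _) | refine (lin_tensl _ _)
  | refine (lin_scaler _ _) | refine (lin_scalel _ _)
  | refine (lin_mulr _ _) | refine (lin_mull _ _)
  | lin_ext
  | refine (lin_lfun _ _)
  | refine (lin_sw _ _)
  | refine (lin_lfun_app _ _)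
  | refine (lin_comp_lfunl _ _) | refine (lin_comp_lfunr _ _)
  | refine (lin_lfun_eta _) | refine (lin_tlift_hom _) | refine (lin_tlift _ _)
  | refine (lin_add _ _) | refine (lin_opp _)
  | refine (lin_sum _ _ _)
  | match goal with
    | H : ?T |- _ =>
      lazymatch type of T with Prop => first
      [ refine (H _) | refine (H _ _) | refine (H _ _ _) | refine (H _ _ _ _)
      | refine (lin_app H _) | refine (lin_app (H _) _)
      | refine (lin_app (H _ _) _) | refine (lin_app (H _ _ _) _)
      | refine (lin_app (H _ _ _ _) _) ] end
    end ].
(* Proves [linear f]; a hypothesis stating linearity is used for the whole of f as
   well as for its outermost function. *)
Ltac lin := repeat (intros; lin_step).

Lemma sweedler2E (F : fieldType) (A : hopfData F) (W : vectType F)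
    (f : A -> A -> W) (a : A) :
  sweedler2 f a = tlift f (hcomul a).
Proof. exact: comp_lfunE. Qed.

Lemma sw_sumE (F : fieldType) (A : hopfData F) (W : vectType F)
    (f : A -> A -> W) (a : A) :
  \sw_(x, y <- a) f x y =
  \sum_(p : 'I_(dim A) * 'I_(dim A))
     (hcomul a : 'M_(_, _)) p.1 p.2 *: f (ebasis p.1) (ebasis p.2).
Proof. by rewrite sweedler2E lfunE /= /tlift_fun pair_bigA. Qed.

Section SweedlerSums.
Variables (F : fieldType) (A : hopfData F).
Implicit Types (W : vectType F).

Lemma eq_sw W (f g : A -> A -> W) (a : A) :
  (forall x y, f x y = g x y) -> sweedler2 f a = sweedler2 g a.
Proof.
by move=> e; congr (sweedler2 _ a); apply/funext => x; apply/funext => y.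
Qed.

(** For every [f], bilinear or not, [tlift f] is a sum over the fixed bases. Moving a linear [g]
    inside or exchanging two sums is thus a rule about finite sums; multilinearity enters when the
    coproduct itself is rewritten. *)
Lemma sw_push W W' (g : W -> W') (f : A -> A -> W) (a : A) :
  linear g -> g (\sw_(x, y <- a) f x y) = \sw_(x, y <- a) g (f x y).
Proof.
move=> lg; rewrite !sweedler2E !lfunE /= /tlift_fun.
pose h : {linear W -> W'} := HB.pack g (GRing.isLinear.Build F W W' _ g lg).
rewrite -[g]/(h : W -> W') linear_sum; apply: eq_bigr => i _.
by rewrite linear_sum; apply: eq_bigr => j _; rewrite linearZ.
Qed.

Lemma sw_exch (B : hopfData F) W (f : A -> A -> B -> B -> W) (a : A) (b : B) :
  \sw_(x, y <- a) \sw_(u, v <- b) f x y u v =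
  \sw_(u, v <- b) \sw_(x, y <- a) f x y u v.
Proof.
rewrite !sw_sumE.
under eq_bigr do rewrite sw_sumE scaler_sumr.
under [RHS]eq_bigr do rewrite sw_sumE scaler_sumr.
rewrite exchange_big /=; apply: eq_bigr => i _; apply: eq_bigr => j _.
by rewrite !scalerA mulrC.
Qed.

Lemma sw_tens (a : A) : \sw_(x, y <- a) (x ⊗ y) = hcomul a.
Proof.
rewrite sweedler2E lfunE /= /tlift_fun [RHS]matrix_sum_delta.
apply: eq_bigr => i _; apply: eq_bigr => j _; congr (_ *: _).
by rewrite /tens /ebasis !r2vK trmx_delta mul_delta_mx.
Qed.

Lemma swZr W (c : F) (f : A -> A -> W) (a : A) :
  c *: \sw_(x, y <- a) f x y = \sw_(x, y <- a) (c *: f x y).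
Proof. by apply: (sw_push (g := fun w => c *: w)); lin. Qed.

Lemma swZl W (w : W) (f : A -> A -> F^o) (a : A) :
  (\sw_(x, y <- a) f x y : F) *: w = \sw_(x, y <- a) ((f x y : F) *: w).
Proof. by apply: (sw_push (g := fun c : F^o => (c : F) *: w)); lin. Qed.

Lemma sw_lfun W W' (g : 'Hom(W, W')) (f : A -> A -> W) (a : A) :
  g (\sw_(x, y <- a) f x y) = \sw_(x, y <- a) g (f x y).
Proof. by apply: (sw_push (g := fun w => g w)); lin. Qed.

Lemma sw_lfun_app W W' (f : A -> A -> 'Hom(W, W')) (a : A) (w : W) :
  (\sw_(x, y <- a) f x y) w = \sw_(x, y <- a) (f x y w).
Proof. by apply: (sw_push (g := fun h : 'Hom(W, W') => h w)); lin. Qed.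

Lemma sw_prodr (B : hopfData F) (b : B) (f : A -> A -> B) (a : A) :
  b ∙ (\sw_(x, y <- a) f x y) = \sw_(x, y <- a) (b ∙ f x y).
Proof. by apply: (sw_push (g := fun c => b ∙ c)); lin. Qed.

Lemma sw_prodl (B : hopfData F) (b : B) (f : A -> A -> B) (a : A) :
  (\sw_(x, y <- a) f x y) ∙ b = \sw_(x, y <- a) (f x y ∙ b).
Proof. by apply: (sw_push (g := fun c => c ∙ b)); lin. Qed.

Lemma hprodZl (c : F) (a b : A) : (c *: a) ∙ b = c *: (a ∙ b).
Proof. exact: (linearZP (hprod_linearl b)). Qed.

Lemma hprodZr (c : F) (a b : A) : a ∙ (c *: b) = c *: (a ∙ b).
Proof. exact: (linearZP (hprod_linearr a)). Qed.

Lemma sw_argZ W (f : A -> A -> W) c a :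
  \sw_(x, y <- c *: a) f x y = c *: \sw_(x, y <- a) f x y.
Proof. by rewrite linearZ. Qed.

End SweedlerSums.

(** * Coassociativity, counit and antipode as rules for Sweedler sums *)

Section HopfRules.
Variables (F : fieldType) (A : hopfData F).
Hypothesis hA : is_hopf A.
Implicit Types (W : vectType F) (a b : A).

Section Trilinear.
Variables (W : vectType F) (f : A -> A -> A -> W).
Hypothesis f1 : forall y z, linear (fun x => f x y z).
Hypothesis f2 : forall x z, linear (fun y => f x y z).
Hypothesis f3 : forall x y, linear (fun z => f x y z).

(** The axiom speaks only of a1 ⊗ a2 ⊗ a3; a trilinear [f] factors through this tensor by the linear
    map [g]. *)
Lemma sw_assoc a :
  \sw_(u, z <- a) \sw_(x, y <- u) f x y z =
  \sw_(x, u <- a) \sw_(y, z <- u) f x y z.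
Proof.
pose g := tlift (fun x => tlift (f x)).
have gE x y z : g (x ⊗ y ⊗ z) = f x y z.
  rewrite /g tlift_tens ?tlift_tens // => *; by lin.
have := congr1 g (hcomulA hA a); rewrite !sw_lfun.
under eq_sw do rewrite sw_lfun.
under [X in _ = X -> _]eq_sw do rewrite sw_lfun.
under eq_sw do under eq_sw do rewrite gE.
by under [X in _ = X -> _]eq_sw do under eq_sw do rewrite gE.
Qed.

End Trilinear.

Section Bilinear.
Variables (W : vectType F) (f : A -> A -> W).
Hypothesis f1 : forall y, linear (fun x => f x y).
Hypothesis f2 : forall x, linear (fun y => f x y).

Lemma tlift_sw (B : hopfData F) (g h : B -> B -> A) (b : B) :
  tlift f (\sw_(x, y <- b) (g x y ⊗ h x y)) = \sw_(x, y <- b) f (g x y) (h x y).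
Proof. by rewrite sw_lfun; apply: eq_sw => x y; rewrite tlift_tens. Qed.

Lemma sw_prod a b :
  \sw_(x, y <- a ∙ b) f x y = \sw_(p, q <- a) \sw_(r, s <- b) f (p ∙ r) (q ∙ s).
Proof.
rewrite sweedler2E hcomulM // sw_lfun; apply: eq_sw => p q.
by rewrite tlift_sw.
Qed.

Lemma sw_one : \sw_(x, y <- hone A) f x y = f (hone A) (hone A).
Proof. by rewrite sweedler2E hcomul1 // tlift_tens. Qed.

End Bilinear.

Section Linear.
Variables (W : vectType F) (f : A -> W).
Hypothesis lf : linear f.

Lemma sw_counitl a : \sw_(x, y <- a) (hcounit A x : F) *: f y = f a.
Proof.
rewrite -[in RHS](hcounitl hA a) (sw_push _ _ lf).
by apply: eq_sw => x y; rewrite linearZP.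
Qed.

Lemma sw_counitr a : \sw_(x, y <- a) (hcounit A y : F) *: f x = f a.
Proof.
rewrite -[in RHS](hcounitr hA a) (sw_push _ _ lf).
by apply: eq_sw => x y; rewrite linearZP.
Qed.

Lemma sw_antipl a :
  \sw_(x, y <- a) f (hantipode A x ∙ y) = (hcounit A a : F) *: f (hone A).
Proof. by rewrite -(sw_push _ _ lf) hantipodel // linearZP. Qed.

Lemma sw_antipr a :
  \sw_(x, y <- a) f (x ∙ hantipode A y) = (hcounit A a : F) *: f (hone A).
Proof. by rewrite -(sw_push _ _ lf) hantipoder // linearZP. Qed.

End Linear.

Section Collapse.
Variables (W : vectType F) (f : A -> A -> W).
Hypothesis f1 : forall y, linear (fun x => f x y).
Hypothesis f2 : forall x, linear (fun y => f x y).
Local Notation S := (hantipode A).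

(** The four collapses are the antipode axioms in working form: two adjacent legs merge into a
    counit, which the remaining leg absorbs. *)
Lemma sw_Sr_cancel a :
  \sw_(x, u <- a) \sw_(y, z <- u) f x (S y ∙ z) = f a (hone A).
Proof.
under eq_sw do rewrite sw_antipl //.
by rewrite (sw_counitr (f := fun x => f x _)).
Qed.

Lemma sw_rS_cancel a :
  \sw_(x, u <- a) \sw_(y, z <- u) f x (y ∙ S z) = f a (hone A).
Proof.
under eq_sw do rewrite sw_antipr //.
by rewrite (sw_counitr (f := fun x => f x _)).
Qed.

Lemma sw_Sl_cancel a :
  \sw_(x, u <- a) \sw_(y, z <- u) f (S x ∙ y) z = f (hone A) a.
Proof.
rewrite -(sw_assoc (f := fun x y z => f (S x ∙ y) z)); try by lin.
under eq_sw => x y do rewrite (sw_antipl (f := f ^~ y)) //.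
by rewrite (sw_counitl (f := fun x => f _ x)).
Qed.

Lemma sw_lS_cancel a :
  \sw_(x, u <- a) \sw_(y, z <- u) f (x ∙ S y) z = f (hone A) a.
Proof.
rewrite -(sw_assoc (f := fun x y z => f (x ∙ S y) z)); try by lin.
under eq_sw => x y do rewrite (sw_antipr (f := f ^~ y)) //.
by rewrite (sw_counitl (f := fun x => f _ x)).
Qed.

End Collapse.

End HopfRules.

(** * The antipode reverses products and coproducts *)

Section Antipode.
Variables (F : fieldType) (A : hopfData F).
Hypothesis hA : is_hopf A.
Implicit Types (W : vectType F) (a b c : A).
Local Notation S := (hantipode A).
Local Notation eps := (hcounit A).

Lemma antipode1 : S (hone A) = hone A.
Proof.
have := hantipoder hA (hone A); rewrite sw_one //; try by lin.
by rewrite hprod1l // hcounit1 // scale1r.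
Qed.

Lemma counit_antipode a : eps (S a) = eps a.
Proof.
have := congr1 eps (hantipodel hA a).
rewrite linearZ /= hcounit1 // sw_lfun.
under eq_sw => x y do rewrite hcounitM // mulrC.
rewrite (sw_counitr hA (f := fun x => eps (S x))); last by lin.
by move=> ->; rewrite /GRing.scale /= mulr1.
Qed.

(** S(ab) and S(b) S(a) are a left and a right convolution inverse of the product on A ⊗ A. The sum
    below is the triple convolution, and its two bracketings collapse to the two sides. *)
Lemma antipodeM a b : S (a ∙ b) = S b ∙ S a.
Proof.
transitivity (\sw_(a1, u <- a) \sw_(a2, a3 <- u) \sw_(b1, v <- b) \sw_(b2, b3 <- v)
    (S (a1 ∙ b1) ∙ ((a2 ∙ b2) ∙ (S b3 ∙ S a3)))).
  under [RHS]eq_sw => a1 u. under eq_sw => a2 a3.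
    under eq_sw => b1 v. under eq_sw => b2 b3.
      rewrite (_ : _ ∙ _ = S (a1 ∙ b1) ∙ (a2 ∙ (b2 ∙ S b3) ∙ S a3)); last first.
        by rewrite !hprodA.
    over. over.
    rewrite (sw_rS_cancel hA (f := fun x y => S (a1 ∙ x) ∙ (a2 ∙ y ∙ S a3))); try by lin.
    rewrite hprod1r //.
  over. over.
  rewrite (sw_rS_cancel hA (f := fun x y => S (x ∙ b) ∙ y)); try by lin.
  by rewrite hprod1r.
rewrite -(sw_assoc hA (f := fun a1 a2 a3 => \sw_(b1, v <- b) \sw_(b2, b3 <- v)
    (S (a1 ∙ b1) ∙ ((a2 ∙ b2) ∙ (S b3 ∙ S a3))))); try by lin.
under eq_sw => u a3. under eq_sw => a1 a2.
  rewrite -(sw_assoc hA (f := fun b1 b2 b3 =>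
    (S (a1 ∙ b1) ∙ ((a2 ∙ b2) ∙ (S b3 ∙ S a3))))); try by lin.
  over.
  rewrite sw_exch.
  under eq_sw => v b3.
    rewrite -(sw_prod hA (f := fun x y => S x ∙ (y ∙ (S b3 ∙ S a3)))); try by lin.
    under eq_sw do rewrite hprodA //.
    rewrite (sw_antipl hA (f := fun x => x ∙ (S b3 ∙ S a3))); last by lin.
    rewrite hcounitM // hprod1l // -scalerA.
  over.
  rewrite -swZr.
  rewrite (sw_counitl hA (f := fun x => S x ∙ S a3)); last by lin.
over.
by rewrite (sw_counitl hA (f := fun x => S b ∙ S x)) //; by lin.
Qed.

(** The same uniqueness of convolution inverses, now for the coproduct as a map from A to A ⊗ A. *)
Lemma sw_antipode W (f : A -> A -> W) a :
  (forall y, linear (fun x => f x y)) -> (forall x, linear (fun y => f x y)) ->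
  \sw_(x, y <- S a) f x y = \sw_(x, y <- a) f (S y) (S x).
Proof.
move=> f1 f2.
(* This is Δ(S(a1)) (a2 ⊗ a3) (S(w_(2)) ⊗ S(w_(1))), seen through [f]. *)
pose X a1 a2 a3 w := \sw_(a4, a5 <- w) \sw_(s, t <- S a1)
  f (s ∙ (a2 ∙ S a5)) (t ∙ (a3 ∙ S a4)).
transitivity (\sw_(a1, u <- a) \sw_(a2, v <- u) \sw_(a3, w <- v) X a1 a2 a3 w).
  under [RHS]eq_sw => a1 u.
    under eq_sw => a2 v.
      rewrite (sw_lS_cancel hA (f := fun y z => \sw_(s, t <- S a1)
        f (s ∙ (a2 ∙ S z)) (t ∙ y))); try by lin.
    over.
  over.
  rewrite (sw_rS_cancel hA (f := fun x y => \sw_(s, t <- S x)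
     f (s ∙ y) (t ∙ hone A))); try by lin.
  by apply: eq_sw => x y; rewrite !hprod1r.
under eq_sw => a1 u.
  rewrite -(sw_assoc hA (f := X a1)); rewrite /X; try by lin.
over.
rewrite -(sw_assoc hA (f := fun a1 b w => \sw_(a2, a3 <- b) X a1 a2 a3 w));
  rewrite /X; try by lin.
under eq_sw => c w.
  under eq_sw => a1 b.
    rewrite sw_exch; under eq_sw => a4 a5.
      rewrite sw_exch.
      under eq_sw do under eq_sw do rewrite !hprodA //.
      rewrite -(sw_prod hA (f := fun x y => f (x ∙ S a5) (y ∙ S a4))); try by lin.
    over.
  over.
  rewrite (sw_antipl hA (f := fun x => \sw_(a4, a5 <- w) \sw_(p, q <- x)
    f (p ∙ S a5) (q ∙ S a4))); last by lin.
over.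
rewrite (sw_counitl hA (f := fun w => \sw_(a4, a5 <- w) \sw_(p, q <- hone A)
    f (p ∙ S a5) (q ∙ S a4))); last by lin.
apply: eq_sw => x y; rewrite sw_one ?hprod1l //; by lin.
Qed.

End Antipode.

(** * Traces *)

Section Trace.
Variable F : fieldType.
Implicit Types (U V W : vectType F).

Lemma vbasis_sum V (v : V) :
  v = \sum_i coord (vbasis fullv) i v *: (vbasis (fullv : {vspace V}))`_i.
Proof. by rewrite -(coord_vbasis (memvf v)). Qed.

Lemma lftrace_vbasis V (f : 'End(V)) :
  lftrace f = \sum_i coord (vbasis fullv) i (f (vbasis (fullv : {vspace V}))`_i).
Proof.
rewrite /lftrace /mxtrace; apply: eq_bigr => i _.
rewrite /passmx.mxof !mxE /=; congr (coord _ _ (f _)).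
rewrite /passmx.vecof (bigD1 i) //= mxE !eqxx scale1r big1 ?addr0 // => j ji.
by rewrite mxE eqxx (negPf ji) scale0r.
Qed.

(** Any resolution of the identity computes the trace, even over a linearly dependent family. The
    coproduct of an integral gives such a family, see [lftrace_sw]. *)
Lemma lftrace_family V (J : finType) (phi : J -> V -> F^o) (e : J -> V) :
  (forall j, linear (phi j)) ->
  (forall x, x = \sum_j (phi j x : F) *: e j) ->
  forall f : 'End(V), lftrace f = \sum_j phi j (f (e j)) :> F.
Proof.
move=> lphi phiE f; rewrite lftrace_vbasis; under eq_bigr => i _.
  rewrite [in X in coord _ _ (f X)](phiE _`_i).
  rewrite (linear_sumP _ _ (f := fun x => coord _ _ (f x) : F^o)); last first.
    by move=> c x y; rewrite !linearP.
  over.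
rewrite exchange_big /=; apply: eq_bigr => j _.
rewrite [in RHS](vbasis_sum (f (e j))) linear_sumP //.
by apply: eq_bigr => i _; rewrite /GRing.scale /= mulrC.
Qed.

Lemma lftraceE V (f : 'End(V)) :
  lftrace f = \sum_i dual_ebasis i (f (ebasis i)) :> F.
Proof.
apply: (lftrace_family (phi := fun i => dual_ebasis i)) => [i|x]; first by lin.
by rewrite [LHS]ebasis_sum; apply: eq_bigr => i _; rewrite dual_ebasisE.
Qed.

Lemma dual_sum V (phi : V -> F^o) (v : V) : linear phi ->
  phi v = \sum_i (dual_ebasis i v : F) *: phi (ebasis i).
Proof.
move=> lphi; rewrite (linear_ebasis lphi v).
by apply: eq_bigr => i _; rewrite dual_ebasisE.
Qed.

Lemma lftrace_rank1 V (phi : V -> F^o) (v : V) (f : 'End(V)) :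
  linear phi -> (forall x, f x = (phi x : F) *: v) -> lftrace f = phi v :> F.
Proof.
move=> lphi fE; rewrite lftraceE (dual_sum _ lphi).
by apply: eq_bigr => i _; rewrite fE linearZ /GRing.scale /= mulrC.
Qed.

Lemma lftrace_lin V : linear (fun f : 'End(V) => lftrace f : F^o).
Proof.
move=> c f g; rewrite !lftraceE scaler_sumr -big_split /=.
by apply: eq_bigr => i _; rewrite add_lfunE scale_lfunE linearP.
Qed.

Lemma lftrace_comp V W (f : 'Hom(V, W)) (g : 'Hom(W, V)) :
  lftrace (f \o g)%VF = lftrace (g \o f)%VF.
Proof.
have bV := vbasisP (fullv : {vspace V}); have bW := vbasisP (fullv : {vspace W}).
by rewrite /lftrace (passmx.mxof_comp _ _ bV) (passmx.mxof_comp _ _ bW) mxtrace_mulC.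
Qed.

Lemma lftrace1 V : lftrace (\1%VF : 'End(V)) = (dim V)%:R.
Proof.
by rewrite /lftrace passmx.mxof1 ?(basis_free (vbasisP _)) // mxtrace1 dimvf.
Qed.

(** In the rank factorization P = c r, idempotence forces r c = 1, and tr(c r) = tr(r c). *)
Lemma mxtrace_idem n (P : 'M[F]_n) : P *m P = P -> \tr P = (\rank P)%:R.
Proof.
move=> PP; have /row_freeP [B rB] := row_base_free P.
have /row_fullP [C Cc] : row_full (col_base P) by exact: col_base_full.
move: (mulmx_base P) rB Cc; move: (row_base P) (col_base P) => r c e rB Cc.
have cr : r *m c = 1%:M.
  have : (c *m r) *m (c *m r) = c *m r by rewrite e PP.
  move=> /(congr1 (fun X => C *m X *m B)).
  by rewrite !mulmxA Cc !mul1mx -mulmxA rB mulmx1.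
by rewrite -[in LHS]e mxtrace_mulC cr mxtrace1.
Qed.

Lemma lftrace_idem V (f : 'End(V)) :
  (f \o f)%VF = f -> exists2 r : nat, lftrace f = r%:R & (f == 0) = (r == 0%N).
Proof.
move=> ff; have bV := vbasisP (fullv : {vspace V}).
set M := passmx.mxof (vbasis fullv) (vbasis fullv) f.
have MM : M *m M = M by rewrite /M -(passmx.mxof_comp _ _ bV) ff.
exists (\rank M); first by rewrite -mxtrace_idem.
by rewrite mxrank_eq0 passmx.mxof_eq0.
Qed.

Lemma lftrace_sw (A : hopfData F) (L : A) V (phi : V -> A -> F^o) (e : A -> V) :
  (forall x, linear (fun z => phi z x)) -> (forall z, linear (phi z)) ->
  linear e ->
  (forall z, z = \sw_(x, y <- L) (phi z x : F) *: e y) ->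
  forall f : 'End(V), lftrace f = \sw_(x, y <- L) phi (f (e y)) x :> F.
Proof.
move=> phi1 phi2 le phiE f.
pose c p := (hcomul L : 'M_(_, _)) p.1 p.2.
rewrite sw_sumE (lftrace_family
  (phi := fun (p : 'I_(dim A) * 'I_(dim A)) z => c p *: phi z (ebasis p.1))
  (e := fun p => e (ebasis p.2))) //.
  by move=> p; lin.
by move=> x; rewrite [LHS]phiE sw_sumE; apply: eq_bigr => p _; rewrite scalerA.
Qed.

Lemma tensor_sum V W (t : tensor V W) :
  t = \sum_(p : 'I_(dim V) * 'I_(dim W))
        (t : 'M_(_, _)) p.1 p.2 *: (ebasis p.1 ⊗ ebasis p.2).
Proof.
rewrite [LHS]matrix_sum_delta pair_bigA; apply: eq_bigr => p _.
by rewrite /tens /ebasis !r2vK trmx_delta mul_delta_mx.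
Qed.

Lemma tensor_ind V W U (f g : 'Hom(tensor V W, U)) :
  (forall v w, f (v ⊗ w) = g (v ⊗ w)) -> f = g.
Proof.
move=> e; apply/lfunP => t; rewrite (tensor_sum t) !linear_sum.
by apply: eq_bigr => p _; rewrite !linearZ /= e.
Qed.

Lemma lftrace_tensor V W (h : 'End(tensor V W)) (f : 'End(V)) (g : 'End(W)) :
  (forall v w, h (v ⊗ w) = f v ⊗ g w) -> lftrace h = lftrace f * lftrace g.
Proof.
move=> hE; rewrite (lftrace_family
  (phi := fun (p : 'I_(dim V) * 'I_(dim W)) t => (t : 'M_(_, _)) p.1 p.2)
  (e := fun p => ebasis p.1 ⊗ ebasis p.2)); last exact: tensor_sum.
  rewrite !lftraceE big_distrlr /= pair_bigA; apply: eq_bigr => p _ /=.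
  by rewrite hE /tens !mxE big_ord1 !mxE !dual_ebasisE.
by move=> p c t u; rewrite !mxE.
Qed.

End Trace.

(** * Integrals and the Frobenius form *)

Section Integral.
Variables (F : fieldType) (A : hopfData F).
Hypothesis hA : is_hopf A.
Implicit Types (U V W : vectType F) (a b c : A).
Local Notation S := (hantipode A).
Local Notation eps := (hcounit A).

Variable L : A.

Section Casimir.
Variables (W : vectType F) (f : A -> A -> W).
Hypothesis f1 : forall y, linear (fun x => f x y).
Hypothesis f2 : forall x, linear (fun y => f x y).

(** Evaluate S(a_(1)) a_(2) L_(1) ⊗ a_(3) L_(2) twice: the antipode removes the first two legs of a,
    while Δ(uL) = ε(u) Δ(L) removes the last two. *)
Lemma casimir_l : (forall a, a ∙ L = (eps a : F) *: L) ->
  forall a, \sw_(x, y <- L) f x (a ∙ y) = \sw_(x, y <- L) f (S a ∙ x) y.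
Proof.
move=> hL a.
transitivity (\sw_(a1, u <- a) \sw_(p, q <- u ∙ L) f (S a1 ∙ p) q).
  under [RHS]eq_sw => a1 u.
    rewrite (sw_prod hA (f := fun p q => f (S a1 ∙ p) q)); try by lin.
    under eq_sw do under eq_sw do rewrite hprodA //.
  over.
  rewrite (sw_Sl_cancel hA (f := fun b c => \sw_(x, y <- L) f (b ∙ x) (c ∙ y)));
    try by lin.
  by apply: eq_sw => x y; rewrite hprod1l.
under eq_sw => a1 u do rewrite hL sw_argZ.
by rewrite (sw_counitr hA (f := fun a => \sw_(x, y <- L) f (S a ∙ x) y)); lin.
Qed.

Lemma casimir_r : (forall a, L ∙ a = (eps a : F) *: L) ->
  forall a, \sw_(x, y <- L) f (x ∙ a) y = \sw_(x, y <- L) f x (y ∙ S a).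
Proof.
move=> hL a.
transitivity (\sw_(u, a3 <- a) \sw_(p, q <- L ∙ u) f p (q ∙ S a3)).
  under [RHS]eq_sw => u a3.
    rewrite (sw_prod hA (f := fun p q => f p (q ∙ S a3))); try by lin.
    under eq_sw do under eq_sw do rewrite -hprodA //.
    rewrite sw_exch.
  over.
  rewrite (sw_assoc hA (f := fun a1 a2 a3 => \sw_(x, y <- L) f (x ∙ a1) (y ∙ (a2 ∙ S a3))));
    try by lin.
  rewrite (sw_rS_cancel hA (f := fun b c => \sw_(x, y <- L) f (x ∙ b) (y ∙ c)));
    try by lin.
  by apply: eq_sw => x y; rewrite hprod1r.
under eq_sw => u a3 do rewrite hL sw_argZ.
by rewrite (sw_counitl hA (f := fun a => \sw_(x, y <- L) f x (y ∙ S a))); lin.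
Qed.

End Casimir.

Definition frob_fun (f : dual A) : A := \sw_(x, y <- L) (f x : F) *: y.
Definition frob : 'Hom(dual A, A) := linfun frob_fun.

Lemma frobE (f : dual A) : frob f = \sw_(x, y <- L) (f x : F) *: y.
Proof. by rewrite linfunE_linear // /frob_fun; lin. Qed.

Definition lmul (a : A) : 'End(A) := linfun (fun b : A => a ∙ b).
Definition rmul (b : A) : 'End(A) := linfun (fun a : A => a ∙ b).

Lemma lmulE a b : lmul a b = a ∙ b.
Proof. by rewrite linfunE_linear //; lin. Qed.

Lemma rmulE a b : rmul b a = a ∙ b.
Proof. by rewrite linfunE_linear //; lin. Qed.

Hypothesis hLl : forall a, a ∙ L = (eps a : F) *: L.
Hypothesis hL1 : eps L = 1.

Lemma mul_frob a (f : dual A) : a ∙ frob f = frob (f \o lmul (S a))%VF.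
Proof.
rewrite !frobE sw_prodr.
under eq_sw do rewrite hprodZr.
rewrite (casimir_l (f := fun x y => (f x : F) *: y)) //; try by lin.
by apply: eq_sw => x y; rewrite comp_lfunE lmulE.
Qed.

Lemma frob_surj a : exists f, frob f = a.
Proof.
exists (\sum_i (dual_ebasis i \o lmul (S (a ∙ S (ebasis i))))%VF).
rewrite linear_sum /=.
under eq_bigr => i _ do rewrite -mul_frob frobE sw_prodr.
have E : \sw_(x, y <- L) ((a ∙ S x) ∙ y) = a.
  under eq_sw do rewrite -hprodA //.
  by rewrite -sw_prodr hantipodel // hL1 scale1r hprod1r.
rewrite -[RHS]E; under eq_bigr => i _.
  under eq_sw => x y.
    rewrite hprodZr dual_ebasisE; over.
  rewrite sw_sumE; over.
rewrite exchange_big sw_sumE /=; apply: eq_bigr => p _.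
rewrite -scaler_sumr; congr (_ *: _).
by rewrite [RHS](linear_ebasis (f := fun x => (a ∙ S x) ∙ ebasis p.2)); lin.
Qed.

Lemma dimv_dual V : \dim (fullv : {vspace dual V}) = \dim (fullv : {vspace V}).
Proof. by rewrite !dimvf /dim /= muln1. Qed.

Lemma frob_ker : lker frob == 0%VS.
Proof.
have lf : limg frob = fullv.
  apply/eqP; rewrite eqEsubv subvf; apply/subvP => a _.
  by have [f <-] := frob_surj a; rewrite memv_img ?memvf.
have := limg_ker_dim frob fullv; rewrite lf dimv_dual capfv.
by move/eqP; rewrite -[X in _ == X]add0n eqn_add2r dimv_eq0.
Qed.

Lemma frob_inj : injective frob.
Proof. exact/lker0P/frob_ker. Qed.

(** By [mul_frob], left multiplication by z on the image of [frob] depends on S(z) only. As 1 lies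
    in this image, S(z) = 0 forces z = 0. *)
Lemma antipode_ker : lker S == 0%VS.
Proof.
apply/lker0P => x y exy; apply/eqP; rewrite -subr_eq0; apply/eqP.
set z := x - y; have Sz : S z = 0 by rewrite linearB /= exy subrr.
have [f f1] := frob_surj (hone A).
rewrite -[z](hprod1r hA) -f1 mul_frob Sz.
rewrite (_ : (_ \o _)%VF = 0) ?linear0 //.
apply/lfunP => b; rewrite comp_lfunE lmulE.
by rewrite [_ ∙ _](linear0P (hprod_linearl b)) !lfunE /= linear0.
Qed.

Lemma antipodeK : cancel S (S^-1)%VF.
Proof. exact/lker0_lfunK/antipode_ker. Qed.

Lemma antipodeVK : cancel (S^-1)%VF S.
Proof. exact/lker0_lfunVK/antipode_ker. Qed.

Lemma antipode_inj : injective S. Proof. exact: can_inj antipodeK. Qed.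

(** S turns the left integral L into a right integral, so S(L) L equals both S(L) and L. *)
Lemma antipode_integral : S L = L.
Proof.
have SLr a : S L ∙ a = (eps a : F) *: S L.
  rewrite -[a in LHS]antipodeVK -antipodeM // hLl linearZ /=.
  by rewrite -[a in RHS]antipodeVK counit_antipode.
by have := SLr L; rewrite hLl counit_antipode // hL1 !scale1r.
Qed.

Lemma integral_right a : L ∙ a = (eps a : F) *: L.
Proof.
rewrite -[a in LHS]antipodeVK -{1}antipode_integral -antipodeM // hLl.
by rewrite linearZ /= antipode_integral -[a in RHS]antipodeVK counit_antipode.
Qed.

(* The integral of A^* normalized by fint(L) = 1; A is a Frobenius algebra for it. *)
Definition fint : dual A := (frob^-1)%VF (hone A).

Lemma frob_fint : frob fint = hone A.
Proof.
rewrite /fint limg_lfunVK //.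
by have [f <-] := frob_surj (hone A); rewrite memv_img ?memvf.
Qed.

End Integral.

Lemma dual_sep (F : fieldType) (V : vectType F) (x y : V) :
  (forall f : dual V, f x = f y) -> x = y.
Proof.
move=> e; rewrite (ebasis_sum x) (ebasis_sum y); apply: eq_bigr => i _.
by rewrite -!dual_ebasisE e.
Qed.

Section Frobenius.
Variables (F : fieldType) (A : hopfData F).
Hypothesis hA : is_hopf A.
Implicit Types (a b c : A).
Local Notation S := (hantipode A).
Local Notation eps := (hcounit A).
Variable L : A.
Hypothesis hLl : forall a, a ∙ L = (eps a : F) *: L.
Hypothesis hL1 : eps L = 1.
Local Notation lam := (fint L).

Lemma fint_frob : \sw_(x, y <- L) (lam x : F) *: y = hone A.
Proof. by rewrite -frobE frob_fint. Qed.

Lemma fint_integral : lam L = 1.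
Proof.
have := congr1 eps fint_frob; rewrite hcounit1 // sw_lfun => <-.
rewrite -[in LHS](sw_counitr hA (f := fun x => lam x)) //; last by lin.
by apply: eq_sw => x y; rewrite linearZ /GRing.scale /= mulrC.
Qed.

(** lam is a right integral of the dual: [frob] sends the convolution lam g to (g ⊗ id) Δ(frob lam)
    = (g ⊗ id) Δ(1) = g(1) 1, and [frob] is injective. *)
Lemma fint_conv_r (g : dual A) a :
  \sw_(x, y <- a) (lam x * g y : F^o) = g (hone A) * lam a.
Proof.
pose h : dual A := linfun (fun a => \sw_(x, y <- a) (lam x * g y : F^o)).
have hE b : h b = \sw_(x, y <- b) (lam x * g y : F^o).
  by rewrite linfunE_linear //; lin.
suff -> : \sw_(x, y <- a) (lam x * g y : F^o) = (g (hone A) *: lam) a.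
  by rewrite scale_lfunE.
rewrite -hE; congr (fun_of_lfun _ a); apply: (frob_inj hA hLl hL1).
rewrite linearZ /= frob_fint // frobE.
under eq_sw => u y do rewrite hE swZl.
rewrite (sw_assoc hA (f := fun x y z => (lam x * g y : F) *: z)); try by lin.
under eq_sw => x v.
  under eq_sw do rewrite -scalerA.
  rewrite -swZr -(sw_argZ (fun y z => (g y : F) *: z)).
over.
rewrite -(sw_push (g := fun b => \sw_(y, z <- b) (g y : F) *: z)); last by lin.
rewrite fint_frob sw_one //; by lin.
Qed.

Lemma fint_right a : \sw_(x, y <- a) (lam x : F) *: y = (lam a : F) *: hone A.
Proof.
apply: dual_sep => g; rewrite sw_lfun linearZ /=.
under eq_sw do rewrite linearZ /=.
by rewrite [LHS]fint_conv_r mulrC.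
Qed.

Lemma frob_fint_l z : \sw_(x, y <- L) (lam (S z ∙ x) : F) *: y = z.
Proof.
rewrite -[RHS](hprod1r hA) -(frob_fint hA hLl hL1) mul_frob // frobE.
by apply: eq_sw => x y; rewrite comp_lfunE lmulE.
Qed.

Lemma frob_fint_r z : \sw_(x, y <- L) (lam (x ∙ z) : F) *: y = S z.
Proof.
rewrite (casimir_r hA (f := fun x y => (lam x : F) *: y)); try by lin.
  under eq_sw do rewrite -hprodZl.
  by rewrite -sw_prodl fint_frob hprod1l.
exact: integral_right.
Qed.

(** As functionals of a, both sides are sent to S(b) by [frob]. Thus S^2 is the Nakayama
    automorphism of the Frobenius form. *)
Lemma nakayama a b : lam (a ∙ b) = lam (S (S b) ∙ a).
Proof.
suff : (lam \o rmul b = lam \o lmul (S (S b)))%VF.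
  by move/(congr1 (fun f : dual A => f a)); rewrite !comp_lfunE rmulE lmulE.
apply: (frob_inj hA hLl hL1); rewrite !frobE.
under eq_sw do rewrite comp_lfunE rmulE.
under [RHS]eq_sw do rewrite comp_lfunE lmulE.
by rewrite frob_fint_l frob_fint_r.
Qed.

Lemma fint_nondeg a b : (forall c, lam (c ∙ a) = lam (c ∙ b)) -> a = b.
Proof.
move=> e; apply: (antipode_inj hA hLl hL1).
by rewrite -!frob_fint_r; apply: eq_sw => x y; rewrite e.
Qed.

Lemma fint_repr (f : dual A) : exists a, forall b, f b = lam (b ∙ a).
Proof.
exists ((S^-1)%VF (frob L f)) => b.
suff e : f = (lam \o rmul ((S^-1)%VF (frob L f)))%VF.
  by rewrite [in LHS]e comp_lfunE rmulE.
apply: (frob_inj hA hLl hL1); rewrite [RHS]frobE.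
under [RHS]eq_sw do rewrite comp_lfunE rmulE.
by rewrite frob_fint_r (antipodeVK hA hLl hL1).
Qed.

Lemma lftrace_fint (T : 'End(A)) :
  lftrace T = \sw_(x, y <- L) lam (S (T y) ∙ x) :> F.
Proof.
apply: (lftrace_sw (phi := fun z x => lam (S z ∙ x)) (e := id)); try by lin.
by move=> z; rewrite frob_fint_l.
Qed.

(** With f = ε this computes tr(S^2); a general f adds a convolution. In the trace formula of the
    Frobenius form [nakayama] cancels two of the three antipodes, and L_(1) S(L_(2)) collapses. *)
Lemma lftrace_S2 (f : dual A) (T : 'End(A)) :
  (forall x, T x = \sw_(p, q <- x) (f (S (S q)) : F) *: S (S p)) ->
  lftrace T = lam (hone A) * f L :> F.
Proof.
move=> TE; rewrite lftrace_fint.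
under eq_sw => x y.
  rewrite TE sw_lfun (sw_push (g := fun b => lam (b ∙ x))); last by lin.
  under eq_sw => p q do
    rewrite linearZ hprodZl linearZ /= -nakayama.
over.
rewrite -(sw_assoc hA (f := fun x p q => (f (S (S q)) : F) *: lam (x ∙ S p)));
  try by lin.
under eq_sw => u q.
  rewrite -swZr (sw_antipr hA (f := fun b => lam b)); last by lin.
  rewrite scalerA mulrC -scalerA; over.
rewrite (sw_counitl hA (f := fun q => (f (S (S q)) : F) *: lam (hone A)));
  last by lin.
by rewrite !(antipode_integral hA hLl hL1) /GRing.scale /= mulrC.
Qed.

End Frobenius.

(** * Grouplike elements, the modular element and Radford's formula *)

Section Grouplike.
Variables (F : fieldType) (A : hopfData F).
Hypothesis hA : is_hopf A.
Implicit Types (W : vectType F) (a b c g : A).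
Local Notation S := (hantipode A).
Local Notation eps := (hcounit A).

Definition grouplike g := hcomul g = g ⊗ g /\ eps g = 1.

Lemma sw_grouplike g W (f : A -> A -> W) :
  (forall y, linear (fun x => f x y)) -> (forall x, linear (fun y => f x y)) ->
  grouplike g -> \sw_(x, y <- g) f x y = f g g.
Proof. by move=> f1 f2 [e _]; rewrite sweedler2E e tlift_tens. Qed.

Definition hexp a n : A := iter n (hprod a) (hone A).

Lemma hexpD a m n : hexp a (m + n) = hexp a m ∙ hexp a n.
Proof.
elim: m => [|m IH]; first by rewrite hprod1l.
by rewrite addSn /hexp iterS -/(hexp a _) IH hprodA.
Qed.

Lemma grouplike_exp g n : grouplike g -> grouplike (hexp g n).
Proof.
move=> gg; elim: n => [|n IH].
  by split; [exact: hcomul1 | exact: hcounit1].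
rewrite /hexp iterS -/(hexp g n); split; last first.
  by rewrite hcounitM // gg.2 IH.2 mulr1.
rewrite hcomulM // (sw_grouplike (g := g)) //; try by lin.
by rewrite sw_grouplike //; lin.
Qed.

(** If x is the sum of the c_i y_i, comparing x ⊗ x with the sum of the c_i y_i ⊗ y_i gives c_i c_j
    = δ_ij c_i. So at most one c_i is nonzero, it is 1, and x is that y_i. *)
Lemma grouplike_free (X : seq A) :
  uniq X -> (forall g, g \in X -> grouplike g) -> free X.
Proof.
elim: X => [|x X IH] /=; first by rewrite nil_free.
move=> /andP[xX uX] gX; have fX : free X by apply: IH => // g gg; apply: gX; rewrite inE gg orbT.
have gx : grouplike x by apply: gX; rewrite inE eqxx.
rewrite free_cons fX andbT; apply: contra xX => xX.
pose Y := in_tuple X; pose c i := coord Y i x.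
have xE : x = \sum_i c i *: Y`_i by rewrite /c -coord_span.
have cc i j : c i * c j = c i *+ (i == j).
  pose phi k : dual A := linfun (coord Y k : A -> F^o).
  have phiE k y : phi k y = coord Y k y by rewrite lfunE.
  have /= := sw_grouplike (f := fun y z => (phi i y * phi j z : F^o)) _ _ gx.
  rewrite !phiE => <-; try by lin.
  rewrite [X in sweedler2 _ X]xE linear_sum /=.
  under eq_bigr => k _.
    rewrite linearZ /= sw_grouplike; try by lin.
      rewrite !phiE !coord_free //; over.
    by apply: gX; rewrite inE mem_nth ?orbT.
  rewrite (bigD1 i) //= eqxx mul1r big1 ?addr0 => [|k ki].
    by rewrite /GRing.scale /= eq_sym mulr_natr.
  by rewrite (negPf ki) mul0r scaler0.
have [i ci|c0] := pickP (fun i => c i != 0); last first.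
  have x0 : x = 0.
    by rewrite xE big1 // => i _; have /negbFE/eqP -> := c0 i; rewrite scale0r.
  by have := gx.2; rewrite x0 linear0 => /eqP; rewrite eq_sym oner_eq0.
have ci1 : c i = 1.
  by apply: (mulfI ci); rewrite cc eqxx mulr1.
rewrite xE (bigD1 i) //= big1 ?addr0 => [|j ji].
  by rewrite ci1 scale1r mem_nth.
have := cc i j; rewrite eq_sym (negPf ji) ci1 mul1r => ->.
by rewrite scale0r.
Qed.

Lemma grouplike_invl g : grouplike g -> S g ∙ g = hone A.
Proof.
move=> gg; have := hantipodel hA g.
by rewrite sw_grouplike //; try lin; rewrite gg.2 scale1r.
Qed.

Lemma grouplike_invr g : grouplike g -> g ∙ S g = hone A.
Proof.
move=> gg; have := hantipoder hA g.
by rewrite sw_grouplike //; try lin; rewrite gg.2 scale1r.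
Qed.

Lemma grouplike_S2 g : grouplike g -> S (S g) = g.
Proof.
move=> gg; rewrite -[LHS](hprod1r hA) -(grouplike_invl gg) hprodA // -antipodeM //.
by rewrite grouplike_invr // antipode1 // hprod1l.
Qed.

Lemma grouplike_order g : grouplike g -> exists2 n, (0 < n)%N & hexp g n = hone A.
Proof.
(* More powers than dim A cannot be free, so two of them coincide. *)
move=> gg; pose X := [seq hexp g n | n <- iota 0 (dim A).+1].
have nfX : ~~ free X.
  rewrite /free; apply/eqP => e; have := dimvS (subvf <<X>>%VS).
  by rewrite e size_map size_iota dimvf ltnn.
have : ~~ uniq X.
  apply: contra nfX => uX; apply: grouplike_free => // _ /mapP[n _ ->].
  exact: grouplike_exp.
move=> /(uniqPn (hone A)) [i [j [ij jX]]]; move: (jX).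
rewrite size_map size_iota => jd; have id := ltn_trans ij jd.
rewrite !(nth_map 0%N) ?size_iota // !nth_iota // !add0n => e.
exists (j - i)%N; first by rewrite subn_gt0.
have gi := grouplike_exp i gg.
rewrite -[LHS](hprod1l hA) -(grouplike_invl gi) -hprodA //.
by rewrite -hexpD subnKC 1?ltnW // -e.
Qed.

Variable L : A.
Hypothesis hLl : forall a, a ∙ L = (eps a : F) *: L.
Hypothesis hL1 : eps L = 1.
Local Notation lam := (fint L).

Lemma fint_unique (mu : dual A) :
  \sw_(x, y <- L) (mu x : F) *: y = (mu L : F) *: hone A ->
  forall b, mu b = mu L * lam b.
Proof.
move=> e b; suff E : mu = (mu L : F) *: lam.
  by rewrite [LHS](congr1 (fun f : dual A => f b) E) scale_lfunE.
by apply: (frob_inj hA hLl hL1); rewrite frobE e linearZ /= frob_fint.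
Qed.

(** The distinguished grouplike element: it measures by how much the right integral lam of the dual
    fails to be a left one, see [fint_left]. *)
Definition modular : A := \sw_(x, y <- L) (lam y : F) *: x.

(** For each functional f, the convolution f lam is again a right integral of the dual, hence a
    multiple of lam; its value at L is f(modular). *)
Lemma fint_left b : \sw_(x, y <- b) (lam y : F) *: x = (lam b : F) *: modular.
Proof.
apply: dual_sep => f; rewrite linearZ /=.
pose mu : dual A := linfun (fun b => \sw_(x, y <- b) (f x * lam y : F^o)).
have muE c : mu c = \sw_(x, y <- c) (f x * lam y : F^o).
  by rewrite linfunE_linear //; lin.
rewrite sw_lfun; under eq_sw do rewrite linearZ /= /GRing.scale /= mulrC.
rewrite -muE (fint_unique (mu := mu)).
  rewrite muE /GRing.scale /= mulrC; congr (_ * _).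
  rewrite /modular sw_lfun; apply: eq_sw => x y.
  by rewrite linearZ /= /GRing.scale /= mulrC.
under eq_sw do rewrite muE swZl.
rewrite (sw_assoc hA (f := fun x y z => (f x * lam y : F) *: z)); try by lin.
under eq_sw => x v.
  under eq_sw do rewrite -scalerA.
  rewrite -swZr (fint_right hA hLl hL1) scalerA; over.
by rewrite -swZl -muE.
Qed.

Lemma modular_grouplike : grouplike modular.
Proof.
split.
  rewrite {1}/modular sw_lfun.
  under eq_sw => x y do rewrite linearZ /= -sw_tens swZr.
  rewrite (sw_assoc hA (f := fun p q y => (lam y : F) *: (p ⊗ q))); try by lin.
  under eq_sw => p v.
    have -> : \sw_(q, y <- v) (lam y : F) *: (p ⊗ q) = ((lam v : F) *: p) ⊗ modular.
      rewrite (linearZP (f := fun b => b ⊗ modular)); last by lin.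
      rewrite -(linearZP (f := fun b => p ⊗ b)); last by lin.
      rewrite -fint_left (sw_push (g := fun b => p ⊗ b)); last by lin.
      apply: eq_sw => q y; rewrite (linearZP (f := fun b => p ⊗ b)) //; lin.
  over.
  by rewrite -(sw_push (g := fun b => b ⊗ modular)); lin.
rewrite /modular sw_lfun.
under eq_sw do rewrite linearZ /= /GRing.scale /= mulrC.
rewrite (sw_counitl hA (f := fun y => lam y)); last by lin.
exact: fint_integral.
Qed.
Local Notation g := modular.
Local Notation gg := modular_grouplike.

Lemma fint_modular_left b :
  \sw_(x, y <- b) (lam (y ∙ g) : F) *: x = (lam (b ∙ g) : F) *: hone A.
Proof.
rewrite -(grouplike_invr gg) -hprodZl -fint_left sw_prod; try by lin.
rewrite sw_prodl; apply: eq_sw => x y; rewrite sw_grouplike; try by [exact: gg|lin].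
by rewrite hprodZl -hprodA // grouplike_invr ?hprod1r //; exact: gg.
Qed.

(** b |-> lam(b g) is a left integral of the dual by [fint_modular_left]. Composed with S it is a
    right one, with value 1 at L like lam. *)
Lemma fint_antipode b : lam (S b ∙ g) = lam b.
Proof.
pose mu : dual A := linfun (fun b => lam (S b ∙ g)).
have muE c : mu c = lam (S c ∙ g) by rewrite linfunE_linear //; lin.
have SL := antipode_integral hA hLl hL1.
rewrite -muE (fint_unique (mu := mu)).
  rewrite muE SL (integral_right hA hLl hL1) gg.2 scale1r.
  by rewrite fint_integral // mul1r.
apply: (antipode_inj hA hLl hL1).
rewrite sw_lfun linearZ /= antipode1 // muE -fint_modular_left sw_antipode //; try by lin.
by apply: eq_sw => x y; rewrite linearZ /= muE.
Qed.

Lemma fint_nondegl a b : (forall c, lam (a ∙ c) = lam (b ∙ c)) -> a = b.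
Proof.
move=> e; apply: (fint_nondeg hA hLl hL1) => c.
rewrite -[c](antipodeVK hA hLl hL1) -[(_^-1)%VF c](antipodeVK hA hLl hL1).
by rewrite -!nakayama.
Qed.

(* Radford's formula for S^4, for a unimodular A. *)
Lemma antipode4 a : g ∙ a = S (S (S (S a))) ∙ g.
Proof.
have nak := nakayama hA hLl hL1.
rewrite -[a](antipodeVK hA hLl hL1); set y := (_^-1)%VF a.
apply: fint_nondegl => c; rewrite -[c](antipodeVK hA hLl hL1); set x := (_^-1)%VF c.
have E p q : lam (p ∙ q) = lam (S q ∙ (S p ∙ g)).
  by rewrite hprodA // -antipodeM // fint_antipode.
have SSg z : S (S (z ∙ g)) = S (S z) ∙ g.
  by rewrite antipodeM // antipodeM // (grouplike_S2 gg).
have E1 p q : lam (p ∙ q) = lam ((g ∙ S q) ∙ S p).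
  by rewrite E nak SSg [RHS]nak hprodA.
(* [E1] reads lam(x y) in one way, the chain [nakayama], [E], [nakayama] in another; the two
   rotations of that chain account for S^4. *)
by rewrite -E1 nak E nak SSg.
Qed.

End Grouplike.

(** * Irreducible modules and matrix units *)

Section Eigen.
Variable F : closedFieldType.

Lemma lfun_eigenvector (V : vectType F) (f : 'End(V)) :
  (fullv : {vspace V}) <> 0%VS -> exists c v, v != 0 /\ f v = c *: v.
Proof.
move=> nz; set b := vbasis (fullv : {vspace V}); have bV := vbasisP (fullv : {vspace V}).
set M := passmx.mxof b b f.
have [c] : exists c, root (char_poly M) c.
  apply/closed_rootP; rewrite size_char_poly eqSS dimv_eq0; exact/eqP.
rewrite -eigenvalue_root_char => /eigenvalueP [v vM v0].
exists c, (passmx.vecof b v); split.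
  by rewrite -(passmx.rVof_eq0 bV) passmx.vecofK.
apply: (can_inj (passmx.rVofK bV)).
rewrite (passmx.rVof_app _ bV) passmx.vecofK // vM.
by rewrite (linearZP (@passmx.rVof_linear _ _ b)) passmx.vecofK.
Qed.

End Eigen.

Section Action.
Variables (F : fieldType) (A : hopfData F) (M : lmodule A).

Lemma rep1 (m : M) : mod_rep M (hone A) m = m.
Proof. by rewrite (mod_repP M).1 id_lfunE. Qed.

Lemma repM a b (m : M) : mod_rep M (a ∙ b) m = mod_rep M a (mod_rep M b m).
Proof. by rewrite (mod_repP M).2 comp_lfunE. Qed.

End Action.

Section Schur.
Variables (F : fieldType) (A : hopfData F).
Implicit Types M N : lmodule A.

(* Only the stability of kernel or image is assumed, so that the two lemmas also
   apply to maps that are A-linear up to a twist by S^2. *)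
Lemma irreducible_inj M (W : vectType F) (T : 'Hom(M, W)) :
  irreducible M ->
  (forall a m, T m = 0 -> T (mod_rep M a m) = 0) ->
  T = 0 \/ lker T = 0%VS.
Proof.
move=> [_ irr] st; have [|e|e] := irr (lker T); last first.
- left; apply/lfunP => m; rewrite zero_lfunE; apply/eqP.
  by rewrite -memv_ker e memvf.
- by right.
move=> a; apply/subvP => _ /memv_imgP [m km ->].
by move: km; rewrite !memv_ker => /eqP km; rewrite st.
Qed.

Lemma irreducible_surj (V : vectType F) N (T : 'Hom(V, N)) :
  irreducible N ->
  (forall a v, exists v', mod_rep N a (T v) = T v') ->
  T = 0 \/ limg T = fullv.
Proof.
move=> [_ irr] st; have [|e|e] := irr (limg T); last by right.
  move=> a; apply/subvP => _ /memv_imgP [_ /memv_imgP [v _ ->] ->].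
  by have [v' ->] := st a v; rewrite memv_img ?memvf.
left; apply/lfunP => m; rewrite zero_lfunE; apply/eqP.
by rewrite -memv0 -e memv_img ?memvf.
Qed.

Definition intertwiner M N (T : 'Hom(M, N)) :=
  forall a m, T (mod_rep M a m) = mod_rep N a (T m).

Lemma lfun_bijective (V W : vectType F) (T : 'Hom(V, W)) :
  lker T = 0%VS -> limg T = fullv -> bijective T.
Proof.
move=> /eqP k0 im; exists (T^-1)%VF; first exact: lker0_lfunK.
by move=> w; rewrite limg_lfunVK // im memvf.
Qed.

Lemma schur_iso M N (T : 'Hom(M, N)) :
  irreducible M -> irreducible N -> intertwiner T -> ~ mod_iso M N -> T = 0.
Proof.
move=> iM iN hT niso.
have [//|k0] : T = 0 \/ lker T = 0%VS.
  by apply: irreducible_inj => // a m Tm; rewrite hT Tm linear0.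
have [//|im] : T = 0 \/ limg T = fullv.
  by apply: irreducible_surj => // a v; exists (mod_rep M a v); rewrite hT.
by case: niso; exists T; split; [exact: lfun_bijective|].
Qed.

End Schur.

Lemma schur_scalar (F : closedFieldType) (A : hopfData F) (M : lmodule A)
    (T : 'End(M)) :
  irreducible M -> intertwiner T -> exists c : F, T = c *: \1%VF.
Proof.
move=> iM hT; have [c [v [v0 Tv]]] := lfun_eigenvector T iM.1.
exists c; apply/eqP; rewrite -subr_eq0; apply/eqP.
have [//|k0] : T - c *: \1%VF = 0 \/ lker (T - c *: \1%VF) = 0%VS.
  apply: irreducible_inj => // a m.
  rewrite !add_lfunE !opp_lfunE !scale_lfunE !id_lfunE hT => /eqP.
  by rewrite subr_eq0 => /eqP ->; rewrite linearZ subrr.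
suff : v \in lker (T - c *: \1%VF) by rewrite k0 memv0 (negPf v0).
by rewrite memv_ker add_lfunE opp_lfunE scale_lfunE id_lfunE Tv subrr.
Qed.

Section Isomorphism.
Variables (F : fieldType) (A : hopfData F).
Implicit Types M N P : lmodule A.

Lemma mod_iso_refl M : mod_iso M M.
Proof.
exists \1%VF; split; last by move=> a m; rewrite !id_lfunE.
by exists id => x; rewrite id_lfunE.
Qed.

Lemma mod_iso_sym M N : mod_iso M N -> mod_iso N M.
Proof.
move=> [f [bf hf]].
have k0 : lker f == 0%VS by apply/lker0P/bij_inj.
have fVK : cancel (f^-1)%VF f.
  case: bf => g fK gK w; rewrite -{1}(gK w) lker0_lfunK //.
exists (f^-1)%VF; split; first by exists f => // ?; rewrite lker0_lfunK.
move=> a m; apply: (can_inj (lker0_lfunK k0)).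
by rewrite fVK hf fVK.
Qed.

Lemma mod_iso_trans M N P : mod_iso M N -> mod_iso N P -> mod_iso M P.
Proof.
move=> [f [bf hf]] [g [bg hg]]; exists (g \o f)%VF; split.
  have [f' fK f'K] := bf; have [g' gK g'K] := bg.
  by exists (f' \o g') => x; rewrite comp_lfunE /= ?gK ?fK ?f'K ?g'K.
by move=> a m; rewrite !comp_lfunE hf hg.
Qed.

Lemma mod_iso_irr M N : mod_iso M N -> irreducible M -> irreducible N.
Proof.
move=> /mod_iso_sym [f [bf hf]] [nz irr].
have k0 : lker f == 0%VS by apply/lker0P/bij_inj.
have im : limg f = fullv.
  apply/eqP; rewrite eqEsubv subvf; apply/subvP => x _.
  by have [g _ gK] := bf; rewrite -[x]gK memv_img ?memvf.
split=> [e|U stU].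
  by apply: nz; rewrite -im e limg0.
have [|e|e] := irr (f @: U)%VS.
- move=> a; apply/subvP => _ /memv_imgP [_ /memv_imgP [u uU ->] ->].
  by rewrite -hf memv_img // (subvP (stU a)) ?memv_img.
- left; apply/eqP; rewrite -subv0; apply/subvP => u uU.
  have := memv_img f uU; rewrite e !memv0 => /eqP fu.
  by rewrite -(inj_eq (lker0P k0)) fu linear0.
- right; apply/eqP; rewrite eqEsubv subvf; apply/subvP => x _.
  have := memvf (f x); rewrite -e => /memv_imgP [u uU].
  by move/(lker0P k0) => ->.
Qed.

Lemma mod_iso_rep0 M N a : mod_iso M N -> mod_rep M a = 0 -> mod_rep N a = 0.
Proof.
move=> /mod_iso_sym [f [bf hf]] a0; apply/lfunP => m.
by apply: (bij_inj bf); rewrite hf a0 !zero_lfunE linear0.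
Qed.

End Isomorphism.

(** * Irreducible modules separate the elements of a semisimple algebra *)

Section Semisimple.
Variables (F : fieldType) (A : hopfData F).
Hypothesis hA : is_hopf A.

Lemma regular_repE (a b : A) : regular_rep A a b = a ∙ b.
Proof. exact: currylE. Qed.

Lemma regular_is_rep : is_rep (regular_rep A).
Proof.
split=> [|a b]; apply/lfunP => c; rewrite ?id_lfunE ?comp_lfunE !regular_repE.
  exact: hprod1l.
by rewrite hprodA.
Qed.

Section Restriction.
Variables (U : {vspace A}) (stU : stable (regular_rep A) U).

Definition res_fun (a : A) : 'End(subvs_of U) :=
  linfun (fun u => vsproj U (a ∙ vsval u)).
Definition res_rep : 'Hom(A, 'End(subvs_of U)) := linfun res_fun.

Lemma res_repE a u : vsval (res_rep a u) = a ∙ vsval u.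
Proof.
have E b v : res_fun b v = vsproj U (b ∙ vsval v).
  rewrite linfunE_linear // => c x y.
  by rewrite linearP hprod_linearr linearP.
rewrite linfunE_linear => [|c x y]; last first.
  apply/lfunP => v; rewrite add_lfunE scale_lfunE !E.
  by rewrite hprod_linearl linearP.
rewrite E vsprojK // -regular_repE (subvP (stU a)) //.
by rewrite memv_img ?subvsP.
Qed.

Lemma res_is_rep : is_rep res_rep.
Proof.
split=> [|a b]; apply/lfunP => u; apply: val_inj.
  by rewrite id_lfunE; apply: etrans (res_repE _ _) _; rewrite hprod1l.
apply: etrans (res_repE _ _) _; rewrite comp_lfunE; apply/esym.
by apply: etrans (res_repE _ _) _; rewrite res_repE hprodA.
Qed.

Definition res_module := LModule res_is_rep.

Lemma res_irreducible : U <> 0%VS ->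
  (forall U' : {vspace A}, stable (regular_rep A) U' -> (U' <= U)%VS ->
     U' = 0%VS \/ U' = U) ->
  irreducible res_module.
Proof.
move=> U0 minU; split=> [e|X stX].
  apply: U0; apply/eqP; rewrite -subv0; apply/subvP => u uU.
  have := memvf (vsproj U u : res_module); rewrite e memv0 => /eqP e0.
  by rewrite -(vsprojK uU) e0 linear0 mem0v.
pose v : 'Hom(subvs_of U, A) := linfun (@vsval F A U).
have vE u : v u = vsval u by rewrite lfunE.
have [||e|e] := minU (v @: X)%VS.
- move=> a; apply/subvP => _ /memv_imgP [_ /memv_imgP [u uX ->] ->].
  rewrite regular_repE vE -res_repE -vE memv_img //.
  by rewrite (subvP (stX a)) // memv_img.
- by apply/subvP => _ /memv_imgP [u uX ->]; rewrite vE subvsP.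
- left; apply/eqP; rewrite -subv0; apply/subvP => u uX.
  have := memv_img v uX; rewrite e !memv0 vE => /eqP u0.
  by apply/eqP/val_inj.
- right; apply/eqP; rewrite eqEsubv subvf; apply/subvP => u _.
  have : vsval u \in (v @: X)%VS by rewrite e subvsP.
  by move=> /memv_imgP [u' u'X]; rewrite vE => /val_inj ->.
Qed.

End Restriction.

Hypothesis ssA : semisimple A.

(** By induction on the dimension, x kills every left ideal U, hence x 1 = 0. A minimal U is an
    irreducible module; otherwise U contains some proper U1 and, by the modular law, is the sum of
    U1 and U ∩ U2 for a complement U2 of U1. *)
Lemma irr_faithful (x : A) :
  (forall M : mxmodule A, irreducible M -> mod_rep M x = 0) -> x = 0.
Proof.
move=> x0; suff xU n (U : {vspace A}) : (\dim U <= n)%N -> stable (regular_rep A) U ->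
    forall u, u \in U -> x ∙ u = 0.
  rewrite -[LHS](hprod1r hA); apply: (xU _ fullv); rewrite ?memvf // => a.
  exact: subvf.
elim: n U => [|n IH] U dU stU u uU.
  move: dU uU; rewrite leqn0 dimv_eq0 => /eqP ->; rewrite memv0 => /eqP ->.
  by rewrite (linear0P (hprod_linearr x)).
have [U0|/eqP U0] := eqVneq U 0%VS.
  by move: uU; rewrite U0 memv0 => /eqP ->; rewrite (linear0P (hprod_linearr x)).
have [minU|] := pselect (forall U' : {vspace A}, stable (regular_rep A) U' ->
    (U' <= U)%VS -> U' = 0%VS \/ U' = U).
  have [N isoN] := mxmodule_iso (res_module stU).
  have irrN := mod_iso_irr isoN (res_irreducible stU U0 minU).
  have := mod_iso_rep0 (mod_iso_sym isoN) (x0 N irrN) => /= r0.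
  by have := res_repE stU x (vsproj U u); rewrite r0 zero_lfunE vsprojK // linear0.
move=> nmin; have [U1 [stU1 U1U U1n0 U1nU]] : exists U1 : {vspace A},
    [/\ stable (regular_rep A) U1, (U1 <= U)%VS, U1 <> 0%VS & U1 <> U].
  apply: contrapT => h; apply: nmin => U' stU' U'U.
  by apply: contrapT => /not_orP[U'0 U'n]; apply: h; exists U'.
have [U2 [stU2 sumU capU]] := ssA stU1.
have st3 : stable (regular_rep A) (U :&: U2)%VS.
  move=> a; apply/subvP => _ /memv_imgP [v + ->].
  rewrite memv_cap => /andP[v1 v2]; rewrite memv_cap.
  by rewrite (subvP (stU a)) ?(subvP (stU2 a)) ?memv_img.
have dU1 : (\dim U1 < \dim U)%N.
  rewrite ltn_neqAle dimvS // andbT; apply: contra_notN U1nU => /eqP e.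
  by apply/eqP; rewrite eqEdim U1U e leqnn.
have sub3 : (U1 + (U :&: U2))%VS = U.
  by rewrite [(U :&: U2)%VS]capvC vspace_modl // sumU capfv.
have cap3 : (U1 :&: (U :&: U2))%VS = 0%VS.
  by apply/eqP; rewrite -subv0 -capU capvS ?subvv // capvSr.
have dU3 : (\dim (U :&: U2) < \dim U)%N.
  have := dimv_disjoint_sum cap3; rewrite sub3 => ->.
  by rewrite -[X in (X < _)%N]add0n ltn_add2r lt0n dimv_eq0; apply/eqP.
move: uU; rewrite -sub3 => /memv_addP [u1 u1U [u2 u2U ->]].
rewrite (linearDP (hprod_linearr x)) (IH U1) ?(IH (U :&: U2)%VS) ?addr0 //.
  by rewrite -ltnS (leq_trans dU3).
by rewrite -ltnS (leq_trans dU1).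
Qed.

Lemma class_reprP (c : set (mxmodule A)) : Irr A c ->
  irreducible (class_repr c) /\
  forall N : mxmodule A, c N <-> mod_iso (class_repr c) N.
Proof.
move=> [M irrM cE]; have cR : c (class_repr c).
  rewrite /class_repr; case: pselect => [h|[]]; first by case: (cid h).
  by exists M; rewrite cE; apply: mod_iso_refl.
move: (cR); rewrite {1}cE => /= isoR; split; first exact: mod_iso_irr irrM.
move=> N; rewrite {1}cE; split=> [h|h]; first exact: mod_iso_trans (mod_iso_sym isoR) h.
exact: mod_iso_trans isoR h.
Qed.

Lemma Irr_eq (c c' : set (mxmodule A)) : Irr A c -> Irr A c' ->
  mod_iso (class_repr c) (class_repr c') -> c = c'.
Proof.
move=> ic ic' iso; have [_ cE] := class_reprP ic; have [_ c'E] := class_reprP ic'.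
rewrite eqEsubset; split=> N.
  by rewrite cE c'E => h; exact: mod_iso_trans (mod_iso_sym iso) h.
by rewrite cE c'E => h; exact: mod_iso_trans iso h.
Qed.

Lemma Irr_ex (M : mxmodule A) : irreducible M ->
  exists2 c, Irr A c & mod_iso (class_repr c) M.
Proof.
move=> iM; have ic : Irr A [set N : mxmodule A | mod_iso M N] by exists M.
exists [set N : mxmodule A | mod_iso M N] => //.
by have [_ <-] := class_reprP ic; apply: mod_iso_refl.
Qed.

End Semisimple.

Section TraceSums.
Variables (F : fieldType) (V : vectType F).

Lemma lftrace_ranks (J : finType) (phi : J -> V -> F^o) (v : J -> V) (f : 'End(V)) :
  (forall p, linear (phi p)) ->
  (forall x, f x = \sum_p (phi p x : F) *: v p) -> lftrace f = \sum_p phi p (v p) :> F.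
Proof.
move=> lphi fE; rewrite lftraceE; under eq_bigr => i _.
  rewrite fE (linear_sumP _ _ (lin_lfun_eta (dual_ebasis i))); over.
rewrite exchange_big /=; apply: eq_bigr => p _; rewrite (dual_sum _ (lphi p)).
by apply: eq_bigr => i _; rewrite /GRing.scale /= mulrC.
Qed.

Lemma lftrace_sum (I : Type) (s : seq I) (g : I -> 'End(V)) :
  lftrace (\sum_(c <- s) g c) = \sum_(c <- s) lftrace (g c).
Proof.
elim: s => [|c s IH]; first by rewrite !big_nil (linear0P (@lftrace_lin F V)).
by rewrite !big_cons (linearDP (@lftrace_lin F V)) /= IH.
Qed.

End TraceSums.

(** * Averaging over an integral, matrix units, traces on A *)

Section MatrixCoefficients.
Variables (F : numClosedFieldType) (A : hopfData F).
Hypothesis hA : is_hopf A.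
Local Notation S := (hantipode A).
Local Notation eps := (hcounit A).
Variable L : A.
Hypothesis hLl : forall a, a ∙ L = (eps a : F) *: L.
Hypothesis hL1 : eps L = 1.
Implicit Types M N : lmodule A.

(* Every irreducible M is isomorphic to its twist by S^2 through z. *)
Definition twist : A := \sw_(x, y <- L) (S y ∙ x).
Local Notation z := twist.

Lemma twistP a : S (S a) ∙ z = z ∙ a.
Proof.
rewrite /twist sw_prodr sw_prodl.
under [RHS]eq_sw do rewrite -hprodA //.
rewrite (casimir_r hA (f := fun x y => S y ∙ x)); try by lin.
  by apply: eq_sw => x y; rewrite antipodeM // hprodA.
exact: integral_right.
Qed.

Definition average M N (T : 'Hom(M, N)) : 'Hom(M, N) :=
  \sw_(x, y <- L) (mod_rep N x \o T \o mod_rep M (S y))%VF.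

Lemma averageE M N (T : 'Hom(M, N)) m :
  average T m = \sw_(x, y <- L) mod_rep N x (T (mod_rep M (S y) m)).
Proof.
by rewrite /average sw_lfun_app; apply: eq_sw => x y; rewrite !comp_lfunE.
Qed.

Lemma average_intertwiner M N (T : 'Hom(M, N)) : intertwiner (average T).
Proof.
move=> a m; rewrite !averageE sw_lfun.
have aE := antipodeVK hA hLl hL1 a; set b := (_^-1)%VF a in aE.
rewrite -aE; under eq_sw do rewrite -repM -antipodeM //.
rewrite (casimir_l hA (f := fun x y => mod_rep N x (T (mod_rep M (S y) m)))) //;
  try by lin.
by apply: eq_sw => x y; rewrite repM.
Qed.

(** Cyclicity of the trace brings out S(L_(2)) L_(1), which is 1 once S^2 = 1. Until then the twist
    has to be carried along. *)
Lemma lftrace_average M (T : 'End(M)) :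
  lftrace (average T) = lftrace (T \o mod_rep M z)%VF.
Proof.
rewrite /average /twist (sw_push _ _ (@lftrace_lin F M)) sw_lfun.
rewrite (sw_push (g := fun f : 'End(M) => lftrace (T \o f)%VF : F^o)); last first.
  by apply: (lin_app (@lftrace_lin F M)); lin.
apply: (@eq_sw _ _ F^o) => x y.
by rewrite -comp_lfunA (lftrace_comp (mod_rep M x)) -comp_lfunA (mod_repP M).2.
Qed.

Lemma dim_neq0 M : irreducible M -> (dim M)%:R != 0 :> F.
Proof.
by move=> [nz _]; rewrite pnatr_eq0 -dimvf dimv_eq0; apply/eqP.
Qed.

Lemma average_scalar M (T : 'End(M)) m : irreducible M ->
  average T m = (lftrace (T \o mod_rep M z)%VF / (dim M)%:R) *: m.
Proof.
move=> iM; have [c cE] := schur_scalar iM (average_intertwiner T).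
rewrite -lftrace_average cE (linearZP (@lftrace_lin F M)) lftrace1.
by rewrite /GRing.scale /= mulfK ?dim_neq0 // scale_lfunE id_lfunE.
Qed.

(** The average of the identity is the action of L_(1) S(L_(2)) = 1. *)
Lemma lftrace_twist M : irreducible M -> lftrace (mod_rep M z) = (dim M)%:R.
Proof.
move=> iM; rewrite -[mod_rep M z]comp_lfun1l -lftrace_average -lftrace1.
congr lftrace; apply/lfunP => m; rewrite averageE id_lfunE.
under eq_sw do rewrite id_lfunE -repM.
rewrite -(sw_push (g := fun a => mod_rep M a m)); last by lin.
by rewrite hantipoder // hL1 scale1r rep1.
Qed.

(** The kernel is a submodule since S^2(a) z = z a. It is not all of M, because the trace dim M of z
    is nonzero in characteristic 0. *)
Lemma twist_ker M : irreducible M -> lker (mod_rep M z) == 0%VS.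
Proof.
move=> iM; have st a m : mod_rep M z m = 0 -> mod_rep M z (mod_rep M a m) = 0.
  by move=> zm; rewrite -repM -twistP repM zm linear0.
have [z0|-> //] := irreducible_inj iM st.
have := lftrace_twist iM; rewrite z0 (linear0P (@lftrace_lin F M)) => /esym/eqP.
by rewrite (negPf (dim_neq0 iM)).
Qed.

Definition coef_elt M (phi : dual M) (v : M) : A :=
  \sw_(x, y <- L) (phi (mod_rep M (S y) v) : F) *: x.

(** The action on any N becomes the average of an operator of rank one from M to N, to which Schur's
    lemma applies. *)
Lemma coef_elt_rep M N (phi : dual M) (v : M) (w : N) :
  mod_rep N (coef_elt phi v) w =
  average (linfun (fun m => (phi m : F) *: w)) v.
Proof.
rewrite averageE /coef_elt (sw_push (g := fun a => mod_rep N a w)); last by lin.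
apply: eq_sw => x y; rewrite linfunE_linear; last by lin.
by rewrite !linearZ scale_lfunE.
Qed.

(* The element acting on M as v ⊗ phi and as 0 on the other irreducible modules. *)
Definition unit_elt M (phi : dual M) (v : M) : A :=
  coef_elt ((dim M)%:R *: (phi \o (mod_rep M z)^-1)%VF) v.

(** On M the average is the scalar tr(T z) / dim M, where T has rank one. This is the origin of the
    factor dim M and of the inverse of z in [unit_elt]. *)
Lemma unit_elt_rep M (phi : dual M) (v w : M) : irreducible M ->
  mod_rep M (unit_elt phi v) w = (phi w : F) *: v.
Proof.
move=> iM; rewrite /unit_elt coef_elt_rep average_scalar //; congr (_ *: _).
rewrite (lftrace_rank1 (phi := fun m => (dim M)%:R *: phi m) (v := w)); first last.
- move=> m; rewrite comp_lfunE linfunE_linear; last by lin.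
  by rewrite scale_lfunE comp_lfunE lker0_lfunK // twist_ker.
- by lin.
by rewrite /GRing.scale /= mulrC mulKf ?dim_neq0.
Qed.

Lemma unit_elt_rep0 M N (phi : dual M) (v : M) : irreducible M -> irreducible N ->
  ~ mod_iso M N -> mod_rep N (unit_elt phi v) = 0.
Proof.
move=> iM iN niso; apply/lfunP => w; rewrite coef_elt_rep.
by rewrite (schur_iso iM iN (average_intertwiner _) niso) !zero_lfunE.
Qed.

(** The projection of A onto the block of M: matrix entries of x times the corresponding matrix
    units. *)
Definition coord_proj_fun M (x : A) : A :=
  \sum_(p : 'I_(dim M) * 'I_(dim M))
    (dual_ebasis p.1 (mod_rep M x (ebasis p.2)) : F)
      *: unit_elt (dual_ebasis p.2) (ebasis p.1).
Definition coord_proj M : 'End(A) := linfun (coord_proj_fun M).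

Lemma coord_projE M x : coord_proj M x = coord_proj_fun M x.
Proof. by rewrite linfunE_linear // /coord_proj_fun; lin. Qed.

Lemma coord_proj_rep M x : irreducible M ->
  mod_rep M (coord_proj M x) = mod_rep M x.
Proof.
move=> iM; apply/lfunP => w; rewrite coord_projE linear_sum sum_lfunE.
under eq_bigr => p _ do rewrite linearZ scale_lfunE unit_elt_rep // scalerA mulrC -scalerA.
rewrite -(pair_bigA _ (fun k l => (dual_ebasis l w : F) *:
  ((dual_ebasis k (mod_rep M x (ebasis l)) : F) *: ebasis k))) /= exchange_big /=.
rewrite [in RHS](ebasis_sum w) (linear_sumP _ _ (lin_lfun_eta _)).
apply: eq_bigr => l _; rewrite -scaler_sumr dual_ebasisE; congr (_ *: _).
rewrite [RHS]ebasis_sum.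
by apply: eq_bigr => k _; rewrite dual_ebasisE.
Qed.

Lemma coord_proj_rep0 M N x : irreducible M -> irreducible N ->
  ~ mod_iso M N -> mod_rep N (coord_proj M x) = 0.
Proof.
move=> iM iN niso; rewrite coord_projE linear_sum big1 // => p _.
by rewrite linearZ /= unit_elt_rep0 // scaler0.
Qed.

Lemma lftrace_coord_proj M (T : 'End(A)) :
  lftrace (T \o coord_proj M)%VF = \sum_k \sum_l
    dual_ebasis k (mod_rep M (T (unit_elt (dual_ebasis l) (ebasis k))) (ebasis l)) :> F.
Proof.
rewrite (lftrace_ranks (J := ('I_(dim M) * 'I_(dim M))%type)
  (phi := fun p x => dual_ebasis p.1 (mod_rep M x (ebasis p.2)))
  (v := fun p => T (unit_elt (dual_ebasis p.2) (ebasis p.1)))); last 2 first.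
- by move=> p; lin.
- move=> x; rewrite comp_lfunE coord_projE.
  by rewrite (linear_sumP _ _ (lin_lfun_eta T)).
by rewrite pair_bigA.
Qed.

Hypothesis ssA : semisimple A.

(** The element [e c] acts as 1 on the class c and as 0 on the others. Hence distinct classes give
    linearly independent elements, and there are at most dim A of them. *)
Lemma Irr_list : exists2 s : seq (set (mxmodule A)), uniq s & Irr A = [set` s].
Proof.
pose good s := uniq s /\ forall c, c \in s -> Irr A c.
suff [s [us sI] full] : exists2 s, good s & forall c, Irr A c -> c \in s.
  by exists s => //; rewrite eqEsubset; split=> c /=; [exact: full|exact: sI].
apply: contrapT => nex.
have ex n : exists2 s, good s & size s = n.
  elim: n => [|n [s [us sI] sn]]; first by exists [::].
  have [c cI cs] : exists2 c, Irr A c & c \notin s.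
    apply: contrapT => h; apply: nex; exists s => // c cI.
    by apply: contrapT => /negP cs; apply: h; exists c.
  exists (c :: s); last by rewrite /= sn.
  split; first by rewrite /= cs.
  by move=> c'; rewrite inE => /orP[/eqP -> //|]; exact: sI.
have [s [us sI] sn] := ex (dim A).+1.
pose e c : A := \sum_k unit_elt (dual_ebasis k) (ebasis k : class_repr c).
have e1 c (w : class_repr c) : Irr A c -> mod_rep (class_repr c) (e c) w = w.
  move=> /class_reprP [ic _]; rewrite linear_sum sum_lfunE [RHS]ebasis_sum.
  by apply: eq_bigr => k _; rewrite unit_elt_rep // dual_ebasisE.
have e0 c c' : Irr A c -> Irr A c' -> c <> c' -> mod_rep (class_repr c') (e c) = 0.
  move=> ic ic' ne; rewrite linear_sum big1 // => k _; apply: unit_elt_rep0.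
  - exact: (class_reprP ic).1.
  - exact: (class_reprP ic').1.
  - by move=> h; apply: ne; apply: Irr_eq.
have fs (r : seq _) : good r -> free (map e r).
  elim: r => [|c r IH] [/= ]; first by rewrite nil_free.
  move=> /andP[cr ur] rI; rewrite free_cons IH ?andbT; last first.
    by split=> // c' c'r; apply: rI; rewrite inE c'r orbT.
  have cI : Irr A c by apply: rI; rewrite mem_head.
  apply/negP => ec; have : e c \in lker (mod_rep (class_repr c)).
    apply: (subvP _ _ ec); apply/span_subvP => _ /mapP [c' c'r ->].
    rewrite memv_ker e0 //; first by apply: rI; rewrite inE c'r orbT.
    by move=> cc; rewrite -cc c'r in cr.
  rewrite memv_ker => /eqP ec0; apply: (class_reprP cI).1.1.
  apply/eqP; rewrite -subv0; apply/subvP => w _.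
  by rewrite -[w](e1 c) // ec0 zero_lfunE mem0v.
have := fs s (conj us sI); rewrite /free => /eqP e2.
have := dimvS (subvf <<map e s>>%VS).
by rewrite e2 size_map sn dimvf ltnn.
Qed.

Lemma Irr_decomp (s : seq (set (mxmodule A))) : uniq s -> Irr A = [set` s] ->
  forall x : A, x = \sum_(c <- s) coord_proj (class_repr c) x.
Proof.
move=> us sE x; have sI c : c \in s -> Irr A c by rewrite sE.
apply/eqP; rewrite -subr_eq0; apply/eqP; apply: (irr_faithful hA ssA) => N iN.
have [c cI isoN] := Irr_ex iN; apply: mod_iso_rep0 isoN _.
have cs : c \in s by move: cI; rewrite sE.
rewrite linearB linear_sum (bigD1_seq c) //= big1_seq => [|c' /andP[c'c c's]].
  by rewrite addr0; have /= -> := coord_proj_rep x (class_reprP cI).1; rewrite subrr.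
apply: (@coord_proj_rep0 (class_repr c') (class_repr c)).
- exact: (class_reprP (sI _ c's)).1.
- exact: (class_reprP cI).1.
- by move=> h; move/eqP: c'c; apply; apply: Irr_eq => //; exact: sI.
Qed.

Lemma lftrace_Irr (s : seq (set (mxmodule A))) : uniq s -> Irr A = [set` s] ->
  forall T : 'End(A), lftrace T = \sum_(c <- s) lftrace (T \o coord_proj (class_repr c))%VF.
Proof.
move=> us sE T; rewrite -lftrace_sum; congr lftrace; apply/lfunP => x.
rewrite [in LHS](Irr_decomp us sE x) linear_sum sum_lfunE.
by apply: eq_bigr => c _; rewrite comp_lfunE.
Qed.

Lemma lftrace_mulmul M (a b : A) (T : 'End(A)) : irreducible M ->
  (forall x, T x = a ∙ x ∙ b) ->
  lftrace (T \o coord_proj M)%VF = lftrace (mod_rep M a) * lftrace (mod_rep M b).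
Proof.
move=> iM TE; rewrite lftrace_coord_proj !lftraceE big_distrlr /=.
apply: eq_bigr => k _; apply: eq_bigr => l _.
by rewrite TE !repM unit_elt_rep // !linearZ /GRing.scale /= mulrC.
Qed.

Lemma lftrace_regular (a b : A) (T : 'End(A)) : (forall x, T x = a ∙ x ∙ b) ->
  lftrace T = \sum_(c \in Irr A)
    lftrace (mod_rep (class_repr c) a) * lftrace (mod_rep (class_repr c) b).
Proof.
move=> TE; have [s us sE] := Irr_list; rewrite (lftrace_Irr us sE) sE -fsbig_seq //.
apply: eq_big_seq => c cs; apply: lftrace_mulmul => //.
by apply: (class_reprP _).1; rewrite sE.
Qed.

Lemma lftrace_S2_coord_proj M (T : 'End(A)) : irreducible M ->
  (forall x, T x = S (S x)) ->
  lftrace (T \o coord_proj M)%VF = (dim M)%:R * lftrace (mod_rep M z)^-1%VF.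
Proof.
move=> iM TE; have zK := lker0_lfunVK (twist_ker iM).
rewrite lftrace_coord_proj -(lftrace_twist iM) !lftraceE big_distrlr /=.
apply: eq_bigr => k _; apply: eq_bigr => l _.
(* Writing e_l as z applied to z^-1 e_l lets S^2(E) z = z E remove S^2 from the matrix unit E; the
   double sum is then tr(z) tr(z^-1). *)
rewrite TE -[ebasis l in LHS]zK -repM twistP repM unit_elt_rep //.
by rewrite !linearZ /GRing.scale /= mulrC.
Qed.

End MatrixCoefficients.

(** * The antipode is an involution *)

Section FiniteOrder.
Variable F : numClosedFieldType.

Definition mxpow n (U : 'M[F]_n) k : 'M[F]_n := iter k (mulmx U) 1%:M.

Lemma mxpowSr n (U : 'M[F]_n) k : mxpow U k.+1 = mxpow U k *m U.
Proof.
elim: k => [|k IH]; first by rewrite /mxpow /= mulmx1 mul1mx.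
by rewrite /mxpow iterS -/(mxpow U _) {1}IH mulmxA.
Qed.

Lemma mxpow_double n (U : 'M[F]_n) k : mxpow U k.*2 = mxpow (U *m U) k.
Proof.
by elim: k => [|k IH] //; rewrite doubleS /mxpow !iterS -!/(mxpow _ _) IH mulmxA.
Qed.

Local Notation "A ^+*" := (map_mx Num.conj A^T) (at level 8, format "A ^+*").

(* U is unitary for the Hermitian form averaged over its powers. *)
Lemma mxtrace_inv_finite_order n (U V : 'M[F]_n) N : (0 < N)%N ->
  mxpow U N = 1%:M -> V *m U = 1%:M -> \tr V = (\tr U)^*.
Proof.
move=> N0 UN VU; pose P := \sum_(k < N) ((mxpow U k)^+* *m mxpow U k).
have PU : U^+* *m P *m U = P.
  rewrite /P mulmx_sumr mulmx_suml.
  under eq_bigr => k _.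
    rewrite mulmxA -map_mxM -trmx_mul -mxpowSr -mulmxA -mxpowSr; over.
  case: N N0 UN {P} => // N _ UN.
  (* Conjugation by U shifts the exponents by one, and U^N = 1 closes the cycle. *)
  rewrite big_ord_recr [RHS]big_ord_recl addrC; congr (_ + _).
  by rewrite (UN : mxpow U (ord_max : 'I_N.+1).+1 = _).
have Pu : P \in unitmx.
  rewrite -row_free_unit -kermx_eq0; apply/rowV0P => v /sub_kermxP vP.
  have : (v *m P *m v^+*) 0 0 = 0 by rewrite vP mul0mx mxE.
  have vvE (w : 'rV[F]_n) : (w *m w^+*) 0 0 = \sum_j `|w 0 j| ^+ 2.
    by rewrite mxE; apply: eq_bigr => j _; rewrite !mxE normCK.
  have -> : (v *m P *m v^+*) 0 0 = \sum_(k < N) \sum_j `|(v *m (mxpow U k)^+*) 0 j| ^+ 2.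
    rewrite /P mulmx_sumr mulmx_suml summxE; apply: eq_bigr => k _.
    rewrite -vvE trmx_mul map_mxM !mulmxA; congr ((_ *m _ *m _) 0 0).
    by apply/matrixP => i j; rewrite !mxE; exact/esym/conjCK.
  move/eqP; rewrite psumr_eq0 => [|k _]; last by apply: sumr_ge0 => j _; exact: exprn_ge0.
  (* All summands are nonnegative, so each of them vanishes; the one for k = 0 is the squared norm
     of v. *)
  move/allP => /(_ (Ordinal N0)); rewrite mem_index_enum => /(_ isT) /=.
  rewrite psumr_eq0 => [|j _]; last exact: exprn_ge0.
  move/allP => v0; apply/rowP => j; rewrite mxE.
  have := v0 j; rewrite mem_index_enum => /(_ isT) /=.
  rewrite /mxpow /= trmx1 map_mx1 mulmx1 expf_eq0 normr_eq0 => /eqP.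
  by [].
have -> : V = invmx P *m U^+* *m P.
  transitivity (invmx P *m (U^+* *m P *m U) *m V).
    by rewrite PU mulVmx // mul1mx.
  by rewrite -!mulmxA (mulmx1C VU) mulmx1.
by rewrite mxtrace_mulC mulmxA mulmxV // mul1mx trace_map_mx mxtrace_tr.
Qed.

End FiniteOrder.

(** * Positivity of the trace of S^2 *)

Section LarsonRadford.
Variables (F : numClosedFieldType) (A : hopfData F).
Hypothesis hA : is_hopf A.
Implicit Types (a b c : A).
Local Notation S := (hantipode A).
Local Notation eps := (hcounit A).
Variable L : A.
Hypothesis hLl : forall a, a ∙ L = (eps a : F) *: L.
Hypothesis hL1 : eps L = 1.
Local Notation lam := (fint L).
Local Notation g := (modular L).
Local Notation z := (twist L).

Lemma hexpSr a n : hexp a n.+1 = hexp a n ∙ a.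
Proof. by rewrite -addn1 hexpD // /hexp /= hprod1r. Qed.

(** As tr(z) = dim M, the quantity is tr(z) tr(z^-1), unchanged when z is rescaled. Rescaled to an
    operator U of finite order, it is |tr U|^2, and tr U is nonzero. *)
Lemma lftrace_twist_inv (M : lmodule A) : irreducible M ->
  0 < (dim M)%:R * lftrace (mod_rep M z)^-1%VF.
Proof.
move=> iM; have gg := modular_grouplike hA hLl hL1.
have [N N0 gN] := grouplike_order hA gg.
have zk := twist_ker hA hLl hL1 iM.
set T := mod_rep M z in zk *.
pose b := vbasis (fullv : {vspace M}); have bV := vbasisP (fullv : {vspace M}).
pose mx (f : 'End(M)) := passmx.mxof b b f.
have mxM (f h : 'End(M)) : mx (f \o h)%VF = mx h *m mx f by exact: passmx.mxof_comp.
have mx1 : mx \1%VF = 1%:M by rewrite /mx passmx.mxof1 // (basis_free bV).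
have mxZ k (f : 'End(M)) : mx (k *: f) = k *: mx f.
  exact: (linearZP (W := 'M[F]_(_, _)) (@passmx.mxof_linear _ _ _ b b)).
(* Both z z and g implement S^4, so S(g) z z commutes with A and acts on M by a scalar. *)
have [c cE] : exists c : F, mod_rep M (S g ∙ (z ∙ z)) = c *: \1%VF.
  apply: schur_scalar iM _ => a m; rewrite -!repM; congr (mod_rep M _ m).
  have zz : (z ∙ z) ∙ a = S (S (S (S a))) ∙ (z ∙ z).
    rewrite -hprodA // -(twistP hA hLl hL1 a) hprodA //.
    by rewrite -(twistP hA hLl hL1 (S (S a))) -hprodA.
  rewrite -hprodA // zz !hprodA //; congr (_ ∙ z ∙ z).
  rewrite -[S g ∙ _](hprod1r hA) -(grouplike_invr hA gg) hprodA //.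
  rewrite -[_ ∙ g]hprodA // -(antipode4 hA hLl hL1) hprodA //.
  by rewrite (grouplike_invl hA gg) // hprod1l.
have TT : (T \o T)%VF = c *: mod_rep M g.
  rewrite /T -(mod_repP M).2 -[z ∙ z](hprod1l hA) -(grouplike_invr hA gg) -hprodA //.
  by rewrite (mod_repP M).2 cE -comp_lfunZr comp_lfun1r.
have c0 : c != 0.
  apply/eqP => c0; have [v _ v0] : exists2 v : M, v \in fullv & v != 0.
    have : (fullv : {vspace M}) != 0%VS by apply/eqP; case: iM.
    by move=> nz; exists (vpick (fullv : {vspace M})); rewrite ?memv_pick ?vpick0.
  have := congr1 (fun f : 'End(M) => f v) TT.
  rewrite c0 scale0r zero_lfunE comp_lfunE => /eqP.
  rewrite -{1}(linear0 T) (inj_eq (lker0P zk)) -(linear0 T) (inj_eq (lker0P zk)).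
  by rewrite (negPf v0).
pose s := sqrtC c; have ss : s * s = c by rewrite -expr2 sqrtCK.
have s0 : s != 0 by rewrite sqrtC_eq0.
clearbody s.
(* After division by a square root of c, the square of U is the action of g, so that U^(2N) = 1. *)
pose U := s^-1 *: mx T; pose V := s *: mx T^-1%VF.
have UN : mxpow U N.*2 = 1%:M.
  have UU : U *m U = mx (mod_rep M g).
    rewrite /U -scalemxAl -scalemxAr scalerA -mxM TT mxZ scalerA.
    by rewrite -ss -mulrA mulKf // mulVf // scale1r.
  rewrite mxpow_double UU.
  have gk k : mxpow (mx (mod_rep M g)) k = mx (mod_rep M (hexp g k)).
    elim: k => [|k IH]; first by rewrite /mxpow /= (mod_repP M).1 mx1.
    by rewrite hexpSr (mod_repP M).2 mxM -IH.
  by rewrite gk gN (mod_repP M).1.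
have VU : V *m U = 1%:M.
  rewrite /U /V -scalemxAl -scalemxAr scalerA divff // scale1r -mxM.
  by rewrite lker0_compfV.
have trV : \tr V = (\tr U)^*.
  by apply: (mxtrace_inv_finite_order _ UN VU); rewrite double_gt0.
have trT : \tr (mx T) = (dim M)%:R by exact: lftrace_twist.
have -> : (dim M)%:R * lftrace T^-1%VF = `|\tr U| ^+ 2.
  rewrite normCK -trV /U /V !linearZ /= trT /lftrace -/b -/(mx _).
  by rewrite mulrACA mulVf // mul1r.
rewrite exprn_gt0 // normr_gt0 /U linearZ /= trT mulf_neq0 ?invr_eq0 //.
exact: dim_neq0.
Qed.

Lemma fint1_gt0 : semisimple A -> 0 < lam (hone A).
Proof.
move=> ssA; pose T : 'End(A) := (S \o S)%VF.
have -> : lam (hone A) = lftrace T.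
  rewrite (lftrace_S2 hA hLl hL1 (f := eps)) ?hL1 ?mulr1 // => x.
  rewrite comp_lfunE -[in LHS](hcounitr hA x) !sw_lfun.
  by apply: eq_sw => p q; rewrite !linearZ !counit_antipode.
have [s us sE] := Irr_list hA hLl hL1.
rewrite (lftrace_Irr hA hLl hL1 ssA us sE).
have pos (c : set (mxmodule A)) : c \in s -> 0 < lftrace (T \o coord_proj L (class_repr c))%VF.
  move=> cs; have cI : Irr A c by rewrite sE.
  have [iM _] := class_reprP cI.
  rewrite (lftrace_S2_coord_proj hA hLl hL1) ?lftrace_twist_inv // => x.
  by rewrite comp_lfunE.
case: s us sE pos => [|c s] us sE pos.
  have := Irr_decomp hA hLl hL1 ssA us sE (hone A); rewrite big_nil => e.
  by have := hcounit1 hA; rewrite e linear0 => /esym/eqP; rewrite oner_eq0.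
rewrite big_cons ltr_pwDl ?pos ?mem_head // big_seq sumr_ge0 // => c' c's.
by rewrite ltW // pos // inE c's orbT.
Qed.

End LarsonRadford.

(** A left ideal U complementary to the kernel of ε contains L, the component of 1 in U: a L - ε(a)
    L lies both in U and in the kernel. *)
Lemma semisimple_integral (F : fieldType) (A : hopfData F) :
  is_hopf A -> semisimple A ->
  exists L : A, (forall a, a ∙ L = (hcounit A a : F) *: L) /\ hcounit A L = 1.
Proof.
move=> hA ssA; pose eps := hcounit A.
have stK : stable (regular_rep A) (lker eps).
  move=> a; apply/subvP => _ /memv_imgP [x + ->]; rewrite !memv_ker regular_repE.
  by rewrite /eps hcounitM // => /eqP ->; rewrite mulr0.
have [U [stU sumU capU]] := ssA _ stK.
have := memvf (hone A); rewrite -sumU => /memv_addP [u uK [v vU uv]].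
exists v; split=> [a|]; last first.
  have := congr1 eps uv; rewrite /eps hcounit1 // linearD /=.
  by move: uK; rewrite memv_ker => /eqP ->; rewrite add0r.
apply/eqP; rewrite -subr_eq0 -memv0 -capU memv_cap; apply/andP; split; last first.
  by rewrite memvB ?memvZ // -regular_repE (subvP (stU a)) // memv_img.
rewrite memv_ker linearB linearZ /= /eps hcounitM //.
by rewrite /GRing.scale /= subrr.
Qed.

(** * From positivity to S^2 = 1, and what follows *)

Section Involution.
Variables (F : numClosedFieldType) (A : hopfData F).
Hypothesis hA : is_hopf A.
Implicit Types (a b c : A).
Local Notation S := (hantipode A).
Local Notation eps := (hcounit A).
Variable L : A.
Hypothesis hLl : forall a, a ∙ L = (eps a : F) *: L.
Hypothesis hL1 : eps L = 1.
Hypothesis ssA : semisimple A.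
Local Notation lam := (fint L).
Local Notation n := (dim A).

(** At 1, [fint_left] reads lam(1) 1 = lam(1) g, and positivity allows cancelling lam(1). *)
Lemma modular1 : modular L = hone A.
Proof.
have l0 : lam (hone A) != 0 by rewrite gt_eqF // (fint1_gt0 hA hLl hL1).
have := fint_left hA hLl hL1 (hone A); rewrite sw_one //; try by lin.
by move/(scalerI l0) => ->.
Qed.

Lemma fint_left1 b : \sw_(x, y <- b) (lam y : F) *: x = (lam b : F) *: hone A.
Proof. by rewrite (fint_left hA hLl hL1) modular1. Qed.

Lemma fintS b : lam (S b) = lam b.
Proof. by rewrite -(fint_antipode hA hLl hL1 b) modular1 hprod1r. Qed.

Lemma antipode4_id a : S (S (S (S a))) = a.
Proof. by have := antipode4 hA hLl hL1 a; rewrite modular1 hprod1l ?hprod1r. Qed.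

Definition regular_char : dual A := linfun (fun a => lftrace (lmul a) : F^o).

Lemma regular_charE a : regular_char a = lftrace (lmul a).
Proof.
rewrite linfunE_linear //; apply: (lin_app (@lftrace_lin F A)) => c x y.
by apply/lfunP => b; rewrite add_lfunE scale_lfunE !lmulE hprod_linearl.
Qed.

Lemma regular_charS2 a : regular_char (S (S a)) = regular_char a.
Proof.
have k0 : lker S == 0%VS by exact: antipode_ker.
rewrite !regular_charE; have -> : lmul (S (S a)) = ((S \o S) \o lmul a \o (S^-1 \o S^-1))%VF.
  apply/lfunP => b; rewrite !comp_lfunE !lmulE !(antipodeM hA).
  by rewrite !(lker0_lfunVK k0).
rewrite lftrace_comp; congr lftrace; apply/lfunP => b.
by rewrite !comp_lfunE !(lker0_lfunK k0).
Qed.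

Lemma regular_char_integral : regular_char L = 1.
Proof.
rewrite regular_charE (lftrace_rank1 (phi := eps) (v := L)) //; first by lin.
by move=> x; rewrite lmulE (integral_right hA hLl hL1).
Qed.

(* A ⊗ A is free over A, by [u ⊗ v |-> u_(1) ⊗ u_(2) v]. *)
Lemma regular_char_conv a :
  \sw_(x, y <- a) (regular_char x * regular_char y : F^o) = n%:R * regular_char a.
Proof.
pose tm (f h : 'End(A)) : 'End(tensor A A) := tlift (fun u v => f u ⊗ h v).
have tmE f h u v : tm f h (u ⊗ v) = f u ⊗ h v by rewrite tlift_tens; lin.
pose D : 'End(tensor A A) := \sw_(x, y <- a) tm (lmul x) (lmul y).
have DE u v : D (u ⊗ v) = \sw_(x, y <- a) ((x ∙ u) ⊗ (y ∙ v)).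
  by rewrite sw_lfun_app; apply: eq_sw => x y; rewrite tmE !lmulE.
pose phi : 'End(tensor A A) := tlift (fun u v => \sw_(x, y <- u) (x ⊗ (y ∙ v))).
have phiE u v : phi (u ⊗ v) = \sw_(x, y <- u) (x ⊗ (y ∙ v)).
  by rewrite tlift_tens; lin.
pose psi : 'End(tensor A A) := tlift (fun u v => \sw_(x, y <- u) (x ⊗ (S y ∙ v))).
have psiE u v : psi (u ⊗ v) = \sw_(x, y <- u) (x ⊗ (S y ∙ v)).
  by rewrite tlift_tens; lin.
have psiphi : (psi \o phi)%VF = \1%VF.
  apply: tensor_ind => u v; rewrite comp_lfunE id_lfunE phiE sw_lfun.
  under eq_sw do rewrite psiE.
  rewrite (sw_assoc hA (f := fun x y w => x ⊗ (S y ∙ (w ∙ v)))); try by lin.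
  under eq_sw do under eq_sw do rewrite hprodA //.
  by rewrite (sw_Sr_cancel hA (f := fun x y => x ⊗ (y ∙ v))) ?hprod1l //; lin.
have phipsi : (phi \o psi)%VF = \1%VF.
  apply: tensor_ind => u v; rewrite comp_lfunE id_lfunE psiE sw_lfun.
  under eq_sw do rewrite phiE.
  rewrite (sw_assoc hA (f := fun x y w => x ⊗ (y ∙ (S w ∙ v)))); try by lin.
  under eq_sw do under eq_sw do rewrite hprodA //.
  by rewrite (sw_rS_cancel hA (f := fun x y => x ⊗ (y ∙ v))) ?hprod1l //; lin.
have Dphi : (D \o phi)%VF = (phi \o tm (lmul a) \1%VF)%VF.
  apply: tensor_ind => u v; rewrite !comp_lfunE phiE tmE id_lfunE lmulE phiE.
  rewrite sw_lfun (sw_prod hA (f := fun x y => x ⊗ (y ∙ v))); try by lin.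
  under eq_sw do rewrite DE.
  rewrite sw_exch; apply: eq_sw => x y; apply: eq_sw => p q.
  by rewrite hprodA.
have <- : lftrace D = \sw_(x, y <- a) (regular_char x * regular_char y : F^o).
  rewrite /D (sw_push _ _ (@lftrace_lin F _)); apply: (@eq_sw _ _ F^o) => x y.
  by rewrite (lftrace_tensor (f := lmul x) (g := lmul y)) ?regular_charE.
rewrite -[D]comp_lfun1r -phipsi comp_lfunA Dphi -comp_lfunA lftrace_comp.
rewrite -comp_lfunA psiphi comp_lfun1r.
by rewrite (lftrace_tensor (f := lmul a) (g := \1%VF)) // lftrace1 regular_charE mulrC.
Qed.

(* Larson and Radford: with Q the convolution by the regular character and
   n = dim A, the idempotent q = Q/n commutes with the projection p onto the
   (-1)-eigenspace of S^2.  As tr(S^2 Q) = tr(S^2),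
   n - 2 rk p is a multiple of n, and it is positive. *)
Lemma antipode_invol a : S (S a) = a.
Proof.
pose T : 'End(A) := (S \o S)%VF.
have TE b : T b = S (S b) by rewrite comp_lfunE.
have TT : (T \o T)%VF = \1%VF.
  by apply/lfunP => b; rewrite comp_lfunE !TE antipode4_id id_lfunE.
pose Q : 'End(A) := linfun (fun b => \sw_(x, y <- b) (regular_char y : F) *: x).
have QE b : Q b = \sw_(x, y <- b) (regular_char y : F) *: x.
  by rewrite linfunE_linear //; lin.
have QQ : (Q \o Q)%VF = n%:R *: Q.
  apply/lfunP => b; rewrite comp_lfunE scale_lfunE [in LHS](QE b) sw_lfun.
  under eq_sw => x y do rewrite linearZ /= QE swZr.
  under eq_sw do under eq_sw do rewrite scalerA mulrC.
  rewrite (sw_assoc hA (f := fun x y w => (regular_char y * regular_char w : F) *: x)); try by lin.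
  under eq_sw => x v do rewrite -swZl regular_char_conv -scalerA.
  by rewrite -swZr QE.
have QT : (Q \o T)%VF = (T \o Q)%VF.
  apply/lfunP => b; rewrite !comp_lfunE !QE !sw_antipode //; try by lin.
  by rewrite !sw_lfun; apply: eq_sw => x y; rewrite !linearZ regular_charS2.
have n0 : n%:R != 0 :> F.
  rewrite pnatr_eq0 -dimvf dimv_eq0; apply/eqP => e.
  have := memvf (hone A); rewrite e memv0 => /eqP h.
  by have := hcounit1 hA; rewrite h linear0 => /esym/eqP; rewrite oner_eq0.
pose q := n%:R^-1 *: Q.
have qq : (q \o q)%VF = q.
  by rewrite /q -comp_lfunZl -comp_lfunZr QQ scalerK.
have qT : (q \o T)%VF = (T \o q)%VF by rewrite /q -comp_lfunZl QT comp_lfunZr.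
pose p := 2^-1 *: (\1%VF - T).
have two0 : 2 != 0 :> F by rewrite pnatr_eq0.
have TpE : T = \1%VF - 2 *: p.
  by rewrite /p scalerA mulfV // scale1r opprB addrC subrK.
have pE x : p x = 2^-1 *: (x - T x).
  by rewrite scale_lfunE add_lfunE opp_lfunE id_lfunE.
have pp : (p \o p)%VF = p.
  apply/lfunP => x; rewrite comp_lfunE [in LHS](pE x) linearZ /= [RHS]pE; congr (_ *: _).
  rewrite pE !TE !linearB /= antipode4_id opprK [- _ + _]addrC addrACA -opprD.
  by rewrite -!mulr2n -!scaler_nat !scalerA mulfV // !scale1r.
have pq : (p \o q)%VF = (q \o p)%VF.
  apply/lfunP => x; have := congr1 (fun f : 'End(A) => f x) qT.
  rewrite (comp_lfunE q T) (comp_lfunE T q) (comp_lfunE p q) (comp_lfunE q p) !pE => <-.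
  by rewrite (linearZP (lin_lfun_eta q)) (linearB q).
have pqpq : ((p \o q) \o (p \o q))%VF = (p \o q)%VF.
  by rewrite comp_lfunA -[((p \o q) \o p)%VF]comp_lfunA -pq comp_lfunA pp -comp_lfunA qq.
have [r rE r0] := lftrace_idem pp.
have [m1 m1E _] := lftrace_idem qq.
have [m2 m2E _] := lftrace_idem pqpq.
have trlin := @lftrace_lin F A.
have trB (f h : 'End(A)) : lftrace (f - 2 *: h) = lftrace f - 2 * lftrace h.
  by rewrite (linearDP trlin) -scaleNr (linearZP trlin) /GRing.scale /= mulNr.
have trT : lftrace T = lam (hone A).
  rewrite (lftrace_S2 hA hLl hL1 (f := eps)) ?hL1 ?mulr1 // => x.
  rewrite TE -[in LHS](hcounitr hA x) !sw_lfun.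
  by apply: eq_sw => u v; rewrite !linearZ !counit_antipode.
have trTQ : lftrace (T \o Q)%VF = lam (hone A).
  rewrite (lftrace_S2 hA hLl hL1 (f := regular_char)) ?regular_char_integral ?mulr1 // => x.
  rewrite comp_lfunE TE QE !sw_lfun.
  by apply: eq_sw => u v; rewrite !linearZ regular_charS2.
have e1 : lam (hone A) = n%:R - 2 * r%:R.
  by rewrite -trT TpE trB rE lftrace1.
(* n tr(S^2 q) = tr(S^2 Q), where S^2 = 1 - 2p, and the idempotents q and p q have the traces m1 and
   m2. *)
have e2 : lam (hone A) = n%:R * (m1%:R - 2 * m2%:R).
  rewrite -m1E -m2E -trB comp_lfunZl -{1}[q]comp_lfun1l -comp_lfunNl -comp_lfunDl.
  rewrite -TpE /q -comp_lfunZr (linearZP trlin) trTQ.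
  by rewrite /GRing.scale /= mulVKf.
have lgt := fint1_gt0 hA hLl hL1 ssA.
have r00 : r = 0%N.
  have : (2 * r < n)%N.
    by move: lgt; rewrite e1 subr_gt0 -natrM ltr_nat.
  move: e1; rewrite e2 => /eqP; rewrite mulrBr subr_eq addrAC eq_sym subr_eq eq_sym.
  rewrite -!natrM -!natrD eqr_nat => /eqP.
  (* Since 0 < n - 2r <= n and n - 2r = n (m1 - 2 m2), the only possibility is n - 2r = n. The case
     split supplies the comparison of n m1 with 2 n m2, which is not linear. *)
  have [h|h] := leqP m1 (2 * m2); have := leq_mul (leqnn n) h; rewrite ?mulnS; lia.
have p0 : p = 0 by apply/eqP; rewrite r0 r00.
by rewrite -TE TpE p0 scaler0 subr0 id_lfunE.
Qed.

Lemma fintC a b : lam (a ∙ b) = lam (b ∙ a).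
Proof. by rewrite (nakayama hA hLl hL1) antipode_invol. Qed.

(** The Frobenius form is thus the regular character, which is what allows [lftrace_regular] to
    expand its values over the irreducible modules. *)
Lemma lftrace_lmul a : lftrace (lmul a) = lam a.
Proof.
rewrite (lftrace_fint hA hLl hL1) -fintS -[S a](hprod1r hA).
have -> : hone A = \sw_(x, y <- L) (x ∙ S y).
  by rewrite hantipoder // hL1 scale1r.
rewrite sw_prodr sw_lfun; apply: (@eq_sw _ _ F^o) => x y.
by rewrite lmulE antipodeM // -hprodA // fintC -hprodA.
Qed.

(** Pair both sides with h ⊗ k and write h = lam(- a). Since lam is a left and a right integral and
    S^2 = 1, both become k(S(a)). *)
Lemma integral_cocomm (W : vectType F) (f : A -> A -> W) :
  (forall y, linear (fun x => f x y)) -> (forall x, linear (fun y => f x y)) ->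
  \sw_(x, y <- L) f x y = \sw_(x, y <- L) f y x.
Proof.
move=> f1 f2; have ev (h k : dual A) :
    \sw_(x, y <- L) (h x * k y : F^o) = \sw_(x, y <- L) (h y * k x : F^o).
  have [a aE] := fint_repr hA hLl hL1 h.
  transitivity (k (S a)).
    rewrite -(frob_fint_r hA hLl hL1) sw_lfun; apply: eq_sw => x y.
    by rewrite linearZ /= aE.
  have <- : \sw_(x, y <- L) (lam (y ∙ S (S a)) : F) *: x = S a.
    rewrite -(casimir_r hA (f := fun x y => (lam y : F) *: x)); try by lin.
      under eq_sw do rewrite -hprodZl.
      rewrite -sw_prodl fint_left1 (fint_integral hA hLl hL1) scale1r.
      by rewrite hprod1l.
    exact: integral_right.
  by rewrite sw_lfun; apply: eq_sw => x y; rewrite linearZ /= aE antipode_invol.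
have fE x y : f x y = \sum_(p : 'I_n * 'I_n)
    (dual_ebasis p.1 x * dual_ebasis p.2 y) *: f (ebasis p.1) (ebasis p.2).
  rewrite (linear_ebasis (f1 y) x).
  rewrite -(pair_bigA _ (fun i j => (dual_ebasis i x * dual_ebasis j y)
    *: f (ebasis i) (ebasis j))); apply: eq_bigr => i _.
  rewrite (linear_ebasis (f2 _) y) scaler_sumr; apply: eq_bigr => j _.
  by rewrite scalerA !dual_ebasisE.
have swE (h : A -> A -> 'I_n * 'I_n -> F) : 
    \sw_(x, y <- L) (\sum_p h x y p *: f (ebasis p.1) (ebasis p.2)) =
    \sum_p (\sw_(x, y <- L) (h x y p : F^o) : F) *: f (ebasis p.1) (ebasis p.2).
  rewrite sw_sumE; under eq_bigr do rewrite scaler_sumr.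
  rewrite exchange_big; apply: eq_bigr => p _.
  by rewrite sw_sumE scaler_suml; apply: eq_bigr => q _; rewrite scalerA.
under eq_sw do rewrite fE; under [RHS]eq_sw do rewrite fE.
by rewrite !swE; apply: eq_bigr => p _; rewrite ev.
Qed.

Lemma lftrace_conv (k : dual A) (T : 'End(A)) :
  (forall x, T x = \sw_(p, q <- x) (k q : F) *: p) ->
  lftrace T = lam (hone A) * k L :> F.
Proof.
move=> TE; apply: (lftrace_S2 hA hLl hL1) => x; rewrite TE; apply: eq_sw => p q.
by rewrite !antipode_invol.
Qed.

End Involution.

(** * Sweedler powers *)

Section SweedlerPower.
Variables (F : fieldType) (A : hopfData F).
Hypothesis hA : is_hopf A.
Implicit Types (a b c h : A).
Local Notation S := (hantipode A).
Local Notation eps := (hcounit A).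
(** The index is shifted: [P n] has n + 1 factors, so inductions start from the identity. *)
Local Notation P := (fun n => sweedler_prod A n.+1).

Lemma sweedler_prodS n a : P n.+1 a = \sw_(x, y <- a) (P n x ∙ y).
Proof. by []. Qed.

Lemma sweedler_prod1 a : P 0%N a = a.
Proof. exact: id_lfunE. Qed.

Lemma sweedler_prodSl n a : P n.+1 a = \sw_(x, y <- a) (x ∙ P n y).
Proof.
elim: n a => [|n IH] a.
  by rewrite sweedler_prodS; apply: eq_sw => x y; rewrite !sweedler_prod1.
rewrite sweedler_prodS; under eq_sw => x y do rewrite IH sw_prodl.
rewrite (sw_assoc hA (f := fun x y z => x ∙ P n y ∙ z)); try by lin.
apply: eq_sw => x y; rewrite sweedler_prodS sw_prodr.
by apply: eq_sw => p q; rewrite hprodA.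
Qed.

(** Both sides are h_(1) b_(1) h_(2) b_(2) ... b_(n+1) h_(n+2), bracketed differently. *)
Lemma sweedler_prod_conj n b h :
  \sw_(x, y <- h) (P n (x ∙ b) ∙ y) = \sw_(x, y <- h) (x ∙ P n (b ∙ y)).
Proof.
elim: n b h => [|n IH] b h.
  by apply: eq_sw => x y; rewrite !sweedler_prod1 hprodA.
under eq_sw => x y.
  rewrite sweedler_prodSl sw_prod //; try by lin.
  rewrite sw_exch sw_prodl; under eq_sw do rewrite sw_prodl.
  over.
under [RHS]eq_sw => x y.
  rewrite sweedler_prodSl sw_prod //; try by lin.
  rewrite sw_prodr; under eq_sw do rewrite sw_prodr.
  over.
rewrite sw_exch [RHS]sw_exch; apply: eq_sw => b1 b2.
rewrite (sw_assoc hA (f := fun x y z => (x ∙ b1) ∙ P n (y ∙ b2) ∙ z)); try by lin.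
apply: eq_sw => x u.
under eq_sw => y z do rewrite -hprodA //.
rewrite -sw_prodr IH sw_prodr; apply: eq_sw => y z.
by rewrite !hprodA.
Qed.

(** S reverses both the order of the legs and the order of the factors. *)
Lemma sweedler_prod_antipode n a : S (P n a) = P n (S a).
Proof.
elim: n a => [|n IH] a; first by rewrite !sweedler_prod1.
rewrite sweedler_prodS sweedler_prodSl sw_lfun sw_antipode //; try by lin.
by apply: eq_sw => x y; rewrite antipodeM // IH.
Qed.

Variable L : A.
Hypothesis hLl : forall a, a ∙ L = (eps a : F) *: L.
Hypothesis hL1 : eps L = 1.

(** For a = S(b) the Casimir identities carry a to the inside of a power: a L_(1) P(L_(2)) = L_(1)
    P(b L_(2)) = P(L_(1) b) L_(2) = P(L_(1)) L_(2) a, with [sweedler_prod_conj] in the middle. *)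
Lemma sweedler_prod_central n a : a ∙ P n L = P n L ∙ a.
Proof.
case: n => [|n]; first by rewrite sweedler_prod1 hLl (integral_right hA hLl hL1).
rewrite -[a](antipodeVK hA hLl hL1); set b := (_^-1)%VF a.
rewrite {1}sweedler_prodSl sweedler_prodS sw_prodr sw_prodl.
under eq_sw do rewrite hprodA //.
rewrite -(casimir_l hA (f := fun x y => x ∙ P n y)) //; try by lin.
under [RHS]eq_sw do rewrite -hprodA //.
rewrite -(casimir_r hA (f := fun x y => P n x ∙ y)) ?sweedler_prod_conj //; try by lin.
exact: integral_right.
Qed.

End SweedlerPower.

Section Cop.
Variables (F : fieldType) (A : hopfData F).
Hypothesis hA : is_hopf A.
Implicit Types (a b c : A).
Local Notation S := (hantipode A).

Lemma sw_cop (W : vectType F) (f : A -> A -> W) a :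
  (forall y, linear (fun x => f x y)) -> (forall x, linear (fun y => f x y)) ->
  sweedler2 (A := cop A) f a = \sw_(x, y <- a) f y x.
Proof.
move=> f1 f2; rewrite sweedler2E.
by apply: (@tlift_sw _ _ _ f f1 f2 A (fun x y => y) (fun x y => x)).
Qed.

Hypothesis SK : forall a, S (S a) = a.

Lemma antipode_invE a : (S^-1)%VF a = S a.
Proof.
have k0 : lker S == 0%VS by apply/lker0P => x y /(congr1 S); rewrite !SK.
by rewrite -[a in LHS]SK lker0_lfunK.
Qed.

(** The antipode of [cop A] is S^-1, here equal to S; its axioms are the images under S of those of
    A. *)
Lemma cop_hopf : is_hopf (cop A).
Proof.
split.
- exact: (hprodA hA).
- exact: (hprod1l hA).
- exact: (hprod1r hA).
- move=> a; rewrite !sw_cop; try by lin.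
  under eq_sw => x y do [rewrite sw_cop; try by lin].
  under [RHS]eq_sw => x y do [rewrite sw_cop; try by lin].
  by rewrite (sw_assoc hA (f := fun x y z => z ⊗ y ⊗ x)); try by lin.
- by move=> a; rewrite sw_cop ?hcounitr //; lin.
- by move=> a; rewrite sw_cop ?hcounitl //; lin.
- move=> a b; rewrite sw_cop; try by lin.
  under eq_sw => x y do [rewrite sw_cop; try by lin].
  by rewrite -(sw_prod hA (f := fun x y => y ⊗ x)); lin.
- by rewrite [LHS](sw_one hA (f := fun x y => y ⊗ x)); lin.
- exact: (hcounitM hA).
- exact: (hcounit1 hA).
- move=> a; rewrite sw_cop; try by lin.
  transitivity (\sw_(x, y <- a) S (S x ∙ y)).
    by apply: eq_sw => x y; rewrite antipodeM // SK antipode_invE.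
  by rewrite -sw_lfun hantipodel // linearZ /= antipode1.
- move=> a; rewrite sw_cop; try by lin.
  transitivity (\sw_(x, y <- a) S (x ∙ S y)).
    by apply: eq_sw => x y; rewrite antipodeM // SK antipode_invE.
  by rewrite -sw_lfun hantipoder // linearZ /= antipode1.
Qed.

End Cop.

(** * The dual Hopf algebra *)

Lemma lin_sw_hom (F : fieldType) (P W : vectType F) (A : hopfData F)
    (f : P -> A -> A -> W) :
  (forall x y, linear (fun p => f p x y)) -> linear (fun p => sweedler2 (f p)).
Proof.
move=> lf c x y; apply/lfunP => a; rewrite add_lfunE scale_lfunE.
exact: (@lin_sw _ _ _ _ f a lf c x y).
Qed.

Lemma sw_mulr (F : fieldType) (A : hopfData F) (c : F^o) (f : A -> A -> F^o) (a : A) :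
  c * (\sw_(x, y <- a) f x y) = \sw_(x, y <- a) (c * f x y).
Proof. by apply: (sw_push (g := fun d : F^o => c * d)); lin. Qed.

Lemma sw_mull (F : fieldType) (A : hopfData F) (c : F^o) (f : A -> A -> F^o) (a : A) :
  (\sw_(x, y <- a) f x y) * c = \sw_(x, y <- a) (f x y * c).
Proof. by apply: (sw_push (g := fun d : F^o => d * c)); lin. Qed.

Notation "'\swd_' ( x , y <- k ) E" :=
  (sweedler2 (A := dual_hopf _) (fun x y : dual _ => E) k)
  (at level 34, E at level 41, x name, y name, k at level 35,
   format "'[' \swd_ ( x ,  y  <-  k )  '/  '  E ']'") : ring_scope.

Section Separation.
Variables (F : fieldType).
Implicit Types (U V : vectType F).

Lemma dual_ev U (phi : dual (dual U)) : exists a : U, forall f : dual U, phi f = f a.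
Proof. by exists ((bidual U)^-1%VF phi) => f; rewrite bidual_inv. Qed.

Definition contract U V (phi : dual U) : 'Hom(tensor U V, V) :=
  tlift (fun u v => (phi u : F) *: v).

Lemma contract_tens U V (phi : dual U) (u : U) (v : V) :
  contract V phi (u ⊗ v) = (phi u : F) *: v.
Proof. by rewrite /contract tlift_tens; lin. Qed.

Lemma contract_sep U V (t t' : tensor U V) :
  (forall phi : dual U, contract V phi t = contract V phi t') -> t = t'.
Proof.
move=> e; apply/matrixP => i j; have := e (dual_ebasis i).
have cE (s : tensor U V) : dual_ebasis j (contract V (dual_ebasis i) s) = (s : 'M_(_, _)) i j.
  rewrite [in LHS](tensor_sum s) !linear_sum (bigD1 (i, j)) //= big1 ?addr0 => [|p pij].
    rewrite !linearZ /= contract_tens linearZ /= !dual_ebasisE /ebasis !r2vK !mxE !eqxx.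
    by rewrite /GRing.scale /= !mulr1.
  rewrite !linearZ /= contract_tens linearZ /= !dual_ebasisE /ebasis !r2vK !mxE !eqxx /=.
  case: p pij => k l; rewrite xpair_eqE negb_and /= ![_ == k]eq_sym ![_ == l]eq_sym.
  by case/orP => /negPf ->; rewrite /GRing.scale /= ?mulr0 ?mul0r ?mulr0.
by move/(congr1 (dual_ebasis j)); rewrite !cE.
Qed.

End Separation.

Section DualHopf.
Variables (F : fieldType) (A : hopfData F).
Hypothesis hA : is_hopf A.
Local Notation Ad := (dual_hopf A).
Implicit Types (k l : Ad) (a b c : A).
Local Notation S := (hantipode A).

Lemma dual_prodE k l a : (k ∙ l : dual A) a = \sw_(x, y <- a) (k x * l y : F^o).
Proof.
rewrite /hprod /= /dual_hmul tlift_tens // => u; apply: lin_sw_hom; lin.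
Qed.

Lemma dual_counitE k : hcounit Ad k = k (hone A).
Proof. by rewrite linfunE_linear //; lin. Qed.

Lemma dual_antipodeE k : hantipode Ad k = (k \o S)%VF.
Proof. by rewrite linfunE_linear //; lin. Qed.

Lemma sw_dual k a b : \swd_(k1, k2 <- k) (k1 a * k2 b : F^o) = k (a ∙ b).
Proof. by rewrite sweedler2E dual_hcomulE. Qed.

(** Each axiom is tested on elements of A. Functionals on the dual are evaluations ([dual_ev]), so
    contracting turns tensors into values, and [sw_dual] turns a coproduct into a product of A. *)
Lemma dual_hopfP : is_hopf Ad.
Proof.
split.
- move=> j k l; apply/lfunP => a; rewrite !dual_prodE.
  under eq_sw => x y do rewrite dual_prodE sw_mulr.
  under [RHS]eq_sw => x y do rewrite dual_prodE sw_mull.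
  rewrite (sw_assoc hA (f := fun x y z => j x * k y * l z : F^o)); try by lin.
  by apply: eq_sw => x u; apply: eq_sw => y z; rewrite mulrA.
- move=> k; apply/lfunP => a; rewrite dual_prodE.
  by rewrite (sw_counitl hA (f := fun x => k x)); lin.
- move=> k; apply/lfunP => a; rewrite dual_prodE; under eq_sw do rewrite mulrC.
  by rewrite (sw_counitr hA (f := fun x => k x)); lin.
- move=> k; apply: contract_sep => phi; have [a aE] := dual_ev phi.
  rewrite !sw_lfun; under eq_sw => x k3.
    rewrite sw_lfun; under eq_sw do rewrite contract_tens aE.
  over.
  under [RHS]eq_sw => k1 x.
    rewrite sw_lfun; under eq_sw do rewrite contract_tens aE.
  over.
  apply: contract_sep => psi; have [b bE] := dual_ev psi.
  rewrite !sw_lfun; under eq_sw => x k3.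
    rewrite sw_lfun; under eq_sw do rewrite linearZ /= contract_tens bE scalerA.
    rewrite -swZl sw_dual.
  over.
  under [RHS]eq_sw => k1 x.
    rewrite sw_lfun; under eq_sw do rewrite linearZ /= contract_tens bE.
  over.
  apply/lfunP => c; rewrite !sw_lfun_app; under eq_sw do rewrite scale_lfunE.
  under [RHS]eq_sw => k1 x.
    rewrite sw_lfun_app; under eq_sw do rewrite !scale_lfunE.
    rewrite -swZr sw_dual; over.
  by rewrite [LHS]sw_dual [RHS]sw_dual hprodA.
- move=> k; apply/lfunP => a; rewrite sw_lfun_app.
  under eq_sw do rewrite scale_lfunE dual_counitE.
  by rewrite [LHS]sw_dual hprod1l.
- move=> k; apply/lfunP => a; rewrite sw_lfun_app.
  under eq_sw do rewrite scale_lfunE dual_counitE /GRing.scale /= mulrC.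
  by rewrite [LHS]sw_dual hprod1r.
- move=> k l; apply: contract_sep => phi; have [a aE] := dual_ev phi.
  apply/lfunP => b; rewrite -[in LHS]sw_tens !sw_lfun !sw_lfun_app.
  under eq_sw do rewrite contract_tens aE scale_lfunE.
  rewrite [LHS]sw_dual dual_prodE sw_prod //; try by lin.
  transitivity (\swd_(k1, k2 <- k) \swd_(l1, l2 <- l) \sw_(p, q <- a) \sw_(r, s <- b)
     ((k1 p * k2 r) * (l1 q * l2 s) : F^o)).
    under [RHS]eq_sw => k1 k2.
      rewrite sw_exch; under eq_sw => p q.
        rewrite sw_exch; under eq_sw do rewrite -sw_mulr sw_dual.
      over.
    over.
    rewrite [RHS]sw_exch; apply: eq_sw => p q; rewrite [RHS]sw_exch; apply: eq_sw => r s.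
    by rewrite -sw_mull sw_dual.
  apply: eq_sw => k1 k2; rewrite sw_lfun sw_lfun_app; apply: eq_sw => l1 l2.
  rewrite contract_tens aE scale_lfunE !dual_prodE /GRing.scale /= sw_mull.
  apply: eq_sw => p q; rewrite sw_mulr; apply: eq_sw => r s.
  by rewrite mulrACA.
- apply: contract_sep => phi; have [a aE] := dual_ev phi.
  apply/lfunP => b; rewrite -[in LHS]sw_tens !sw_lfun sw_lfun_app.
  under eq_sw do rewrite contract_tens aE scale_lfunE.
  by rewrite [LHS]sw_dual contract_tens aE scale_lfunE /= hcounitM.
- move=> k l; rewrite !dual_counitE dual_prodE sw_one //; by lin.
- by rewrite dual_counitE /= hcounit1.
- move=> k; apply/lfunP => a; rewrite sw_lfun_app.
  under eq_sw do rewrite dual_prodE dual_antipodeE.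
  under eq_sw do under eq_sw do rewrite comp_lfunE.
  rewrite sw_exch; under eq_sw do rewrite sw_dual.
  rewrite sw_antipl //; last by lin.
  by rewrite scale_lfunE dual_counitE /GRing.scale /= mulrC.
- move=> k; apply/lfunP => a; rewrite sw_lfun_app.
  under eq_sw do rewrite dual_prodE dual_antipodeE.
  under eq_sw do under eq_sw do rewrite comp_lfunE.
  rewrite sw_exch; under eq_sw do rewrite sw_dual.
  rewrite sw_antipr //; last by lin.
  by rewrite scale_lfunE dual_counitE /GRing.scale /= mulrC.
Qed.

End DualHopf.

(** * The quantum double *)

Section Evaluation.
Variables (F : fieldType) (K : vectType F).
Implicit Types (V : vectType F).

Definition ev V (x : K) : 'Hom(tensor (dual K) V, V) :=
  tlift (fun (k : dual K) v => (k x : F) *: v).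

Lemma ev_tens V (x : K) (k : dual K) (v : V) : ev V x (k ⊗ v) = (k x : F) *: v.
Proof. by rewrite /ev tlift_tens; lin. Qed.

Lemma lin_ev V (t : tensor (dual K) V) : linear (fun x => ev V x t).
Proof. by rewrite /ev; lin. Qed.

Lemma lin_evf (U : vectType F) V (f : U -> K) (t : tensor (dual K) V) :
  linear f -> linear (fun x => ev V (f x) t).
Proof. by move=> lf; apply: (lin_app (g := fun x => ev V x t)) => //; exact: lin_ev. Qed.

Lemma ev_sep V (t t' : tensor (dual K) V) : (forall x, ev V x t = ev V x t') -> t = t'.
Proof.
move=> e; apply: contract_sep => phi; have [x xE] := dual_ev phi.
suff c (s : tensor (dual K) V) : contract V phi s = ev V x s by rewrite !c e.
congr (fun_of_lfun _ s); apply: tensor_ind => k v.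
by rewrite contract_tens ev_tens xE.
Qed.

End Evaluation.

Lemma sweedler3E (F : fieldType) (A : hopfData F) (W : vectType F)
    (f : A -> A -> A -> W) a :
  sweedler3 f a = \sw_(y, a3 <- a) \sw_(a1, a2 <- y) f a1 a2 a3.
Proof. by []. Qed.

Ltac lin_ext ::= refine (lin_evf _ _).

Lemma tensor_ind_lin (F : fieldType) (U V W : vectType F) (f g : tensor U V -> W) :
  linear f -> linear g -> (forall u v, f (u ⊗ v) = g (u ⊗ v)) -> f =1 g.
Proof.
move=> lf lg e t; rewrite (tensor_sum t) !linear_sumP //.
by apply: eq_bigr => p _; rewrite e.
Qed.

Section Double.
Variables (F : fieldType) (H K : hopfData F).
Hypothesis hH : is_hopf H.
Hypothesis hK : is_hopf K.
Local Notation Kd := (dual_hopf K).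
Variable sigma : 'Hom(tensor Kd H, F^o).
Local Notation r := (sigma_r sigma).
Hypothesis hr : is_hopf_map r.
Local Notation S := (hantipode K).
Hypothesis SK : forall x : K, S (S x) = x.
Implicit Types (h g : H) (x y z : K) (k l : dual K).

Lemma dual_invol k : hantipode Kd (hantipode Kd k) = k.
Proof.
by apply/lfunP => x; rewrite !(@dual_antipodeE F K) !comp_lfunE SK.
Qed.

Lemma dual_antipode_inv k : (hantipode Kd)^-1%VF k = (k \o S)%VF.
Proof. by rewrite antipode_invE ?dual_antipodeE //; exact: dual_invol. Qed.

Lemma sw3_dual (l : Kd) x y z :
  \swd_(u, l3 <- l) \swd_(l1, l2 <- u) (l1 x * l2 y * l3 z : F^o) = l (x ∙ y ∙ z).
Proof. by under eq_sw => u l3 do rewrite -sw_mull sw_dual; rewrite sw_dual. Qed.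

(* Through [ev], an element of K^* ⊗ V is a function K -> V; [coadj] is the action
   of ε ⋈ h on such functions. *)
Definition coadj (V : lmodule H) (G : K -> V) h x : V :=
  \sw_(h1, u <- h) \sw_(h2, h3 <- u) mod_rep V h2 (G (S (r h3) ∙ x ∙ r h1)).

Section Coadj.
Variables (V : lmodule H) (G : K -> V).
Hypothesis lG : linear G.

Lemma lin_coadj1 x : linear (fun h => coadj G h x).
Proof. by rewrite /coadj; lin. Qed.

Lemma lin_coadj2 h : linear (coadj G h).
Proof. by rewrite /coadj; lin. Qed.

Lemma coadj1 x : coadj G (hone H) x = G x.
Proof.
rewrite /coadj !sw_one //; try by lin.
by rewrite rep1 (hmap_one hr) antipode1 // hprod1l // hprod1r.
Qed.
End Coadj.

Lemma coadjM (V : lmodule H) (G : K -> V) h g x : linear G ->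
  coadj G (h ∙ g) x = coadj (coadj G g) h x.
Proof.
move=> lG; rewrite /coadj sw_prod //; try by lin.
apply: eq_sw => h1 u.
under eq_sw => g1 v.
  rewrite sw_prod //; try by lin.
over.
rewrite sw_exch; apply: eq_sw => h2 h3.
rewrite sw_lfun; apply: eq_sw => g1 v; rewrite sw_lfun; apply: eq_sw => g2 g3.
rewrite repM !(hmap_prod hr) antipodeM //; congr (mod_rep V h2 (mod_rep V g2 (G _))).
by rewrite !hprodA.
Qed.

(** In function form the action is a convolution: the value of t at x_(1) acts by [coadj] on m,
    evaluated at x_(2). By [sw3_dual] the three legs of l merge into one value at S(r(h_(3))) x_(2)
    r(h_(1)). *)
Lemma double_rep_ev (V : lmodule H) (t : tensor Kd H) (m : tensor Kd V) x :
  ev V x (double_rep sigma V t m) =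
  \sw_(x1, x2 <- x) coadj (fun y => ev V y m) (ev H x1 t) x2.
Proof.
move: t; apply: tensor_ind_lin; rewrite /coadj; try by lin.
move=> k h; move: m; apply: tensor_ind_lin; try by lin.
move=> l v; rewrite double_repE sweedler3E.
under eq_sw do under eq_sw do rewrite sweedler3E.
rewrite (sw_lfun (ev V x)).
transitivity (\swd_(u, l3 <- l) \swd_(l1, l2 <- u) \sw_(x1, x2 <- x)
   \sw_(w, h3 <- h) \sw_(h1, h2 <- w)
     ((l1 (S (r h3)) * l2 x2 * l3 (r h1) : F^o) : F) *: ((k x1 : F) *: mod_rep V h2 v)).
  apply: eq_sw => u l3; rewrite (sw_lfun (ev V x)); apply: eq_sw => l1 l2.
  rewrite (sw_lfun (ev V x)) sw_exch; apply: eq_sw => w h3.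
  rewrite (sw_lfun (ev V x)) sw_exch; apply: eq_sw => h1 h2.
  rewrite linearZ /= ev_tens dual_prodE -!sigma_rE dual_antipode_inv (comp_lfunE l1).
  rewrite swZl swZr; apply: eq_sw => x1 x2.
  rewrite !scalerA; congr (_ *: _); rewrite /GRing.scale /=; ring.
under eq_sw => u l3 do rewrite sw_exch.
rewrite sw_exch; apply: eq_sw => x1 x2.
rewrite ev_tens sw_argZ.
under eq_sw => u l3 do rewrite sw_exch.
rewrite sw_exch.
under eq_sw => w h3.
  under eq_sw => u l3 do rewrite sw_exch.
  rewrite sw_exch; under eq_sw => h1 h2.
    under eq_sw => u l3 do rewrite -swZl.
    rewrite -swZl sw3_dual scalerA mulrC -scalerA.
  over.
  rewrite -swZr; over.
rewrite -swZr; congr (_ *: _).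
rewrite (sw_assoc hH (f := fun h1 h2 h3 => (l (S (r h3) ∙ x2 ∙ r h1) : F) *: mod_rep V h2 v));
  try by lin.
by apply: eq_sw => h1 y; apply: eq_sw => h2 h3; rewrite ev_tens linearZ.
Qed.

End Double.

Lemma eq_sweedler3 (F : fieldType) (A : hopfData F) (W : vectType F)
    (f g : A -> A -> A -> W) a :
  (forall x y z, f x y z = g x y z) -> sweedler3 f a = sweedler3 g a.
Proof.
move=> e; have -> : f = g; last by [].
by apply/funext => x; apply/funext => y; apply/funext => z.
Qed.

Section Nested.
Variables (F : fieldType) (H : hopfData F) (W : vectType F).
Hypothesis hH : is_hopf H.
Variable X : H -> H -> H -> H -> H -> W.
Hypothesis X1 : forall b c s t, linear (fun a => X a b c s t).
Hypothesis X2 : forall a c s t, linear (fun b => X a b c s t).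
Hypothesis X3 : forall a b s t, linear (fun c => X a b c s t).
Hypothesis X4 : forall a b c t, linear (fun s => X a b c s t).
Hypothesis X5 : forall a b c s, linear (fun t => X a b c s t).

(** With [sw5_out], this brings the two nestings of five legs that arise in [coadj_conv] to a common
    form. *)
Lemma sw5_mid h :
  \sw_(a, w <- h) \sw_(y, t <- w) \sw_(b, v <- y) \sw_(c, s <- v) X a b c s t =
  \sw_(a, u <- h) \sw_(b, v <- u) \sw_(c, w <- v) \sw_(s, t <- w) X a b c s t.
Proof.
apply: eq_sw => a w.
rewrite (sw_assoc hH (f := fun b v t => \sw_(c, s <- v) X a b c s t)); try by lin.
apply: eq_sw => b w'.
by rewrite (sw_assoc hH (f := fun c s t => X a b c s t)); lin.
Qed.

Lemma sw5_out h :
  \sw_(y, w <- h) \sw_(c, v <- w) \sw_(s, t <- v) \sw_(a, b <- y) X a b c s t =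
  \sw_(a, u <- h) \sw_(b, v <- u) \sw_(c, w <- v) \sw_(s, t <- w) X a b c s t.
Proof.
under eq_sw => y w.
  under eq_sw => c v do rewrite sw_exch.
  rewrite sw_exch; over.
by rewrite (sw_assoc hH (f := fun a b w => \sw_(c, v <- w) \sw_(s, t <- v) X a b c s t));
  lin.
Qed.

End Nested.

(** * The module axioms over the double *)

Section DoubleModule.
Variables (F : fieldType) (H K : hopfData F).
Hypothesis hH : is_hopf H.
Hypothesis hK : is_hopf K.
Local Notation Kd := (dual_hopf K).
Variable sigma : 'Hom(tensor Kd H, F^o).
Local Notation r := (sigma_r sigma).
Hypothesis hr : is_hopf_map r.
Local Notation S := (hantipode K).
Hypothesis SK : forall x : K, S (S x) = x.
Implicit Types (h g : H) (x y z : K) (k l : dual K).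
Local Notation D := (quantum_double sigma).

Definition regular_module : lmodule H := LModule (regular_is_rep hH).
Local Notation reg := regular_module.
Local Notation co V := (@coadj F H K sigma V).

Lemma sw_map (W : vectType F) (f : K -> K -> W) h :
  (forall y, linear (fun x => f x y)) -> (forall x, linear (fun y => f x y)) ->
  \sw_(x, y <- r h) f x y = \sw_(x, y <- h) f (r x) (r y).
Proof. by move=> f1 f2; rewrite sweedler2E (hmap_comul hr) tlift_sw. Qed.

(** Compatibility of [coadj] with convolution. Expanding Δ(S(r(h_(3))) u r(h_(1))), where r
    preserves and S reverses coproducts, gives on both sides the same sum over five legs of h. *)
Lemma coadj_conv (V : lmodule H) (G : K -> V) (E : K -> reg) h u :
  linear G -> linear E ->
  \sw_(y, x <- u) co V G (co reg E h y) x =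
  co V (fun y => \sw_(z1, z2 <- y) co V G (E z1) z2) h u.
Proof.
move=> lG lE.
have lco1 := lin_coadj1 sigma G; have lco2 := lin_coadj2 sigma lG.
have coM h' g x := coadjM hH hK hr h' g x lG.
(* The five letters are the consecutive legs of h: a and b multiply on the right, c acts on V, s and
   t multiply on the left through S. *)
pose X u1 u2 a b c s t : V :=
  mod_rep V c (co V G (E (S (r t) ∙ u1 ∙ r a)) (S (r s) ∙ u2 ∙ r b)).
transitivity (\sw_(u1, u2 <- u) \sw_(a, w <- h) \sw_(y, t <- w)
   \sw_(b, v <- y) \sw_(c, s <- v) X u1 u2 a b c s t).
  apply: eq_sw => u1 u2; rewrite {2}/coadj.
  rewrite (sw_push (g := fun h => co V G h u2)) //; apply: eq_sw => a w.
  rewrite (sw_push (g := fun h => co V G h u2)) //; apply: eq_sw => y t.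
  by rewrite regular_repE coM.
transitivity (\sw_(u1, u2 <- u) \sw_(y, w <- h) \sw_(c, v <- w)
   \sw_(s, t <- v) \sw_(a, b <- y) X u1 u2 a b c s t).
  apply: eq_sw => u1 u2.
  have X1 b c s t : linear (fun a => X u1 u2 a b c s t) by rewrite /X; lin.
  have X2 a c s t : linear (fun b => X u1 u2 a b c s t) by rewrite /X; lin.
  have X3 a b s t : linear (fun c => X u1 u2 a b c s t) by rewrite /X; lin.
  have X4 a b c t : linear (fun s => X u1 u2 a b c s t) by rewrite /X; lin.
  have X5 a b c s : linear (fun t => X u1 u2 a b c s t) by rewrite /X; lin.
  pose Y := X u1 u2; rewrite -/Y in X1 X2 X3 X4 X5 *.
  transitivity (\sw_(a, p <- h) \sw_(b, v <- p) \sw_(c, w <- v) \sw_(s, t <- w) Y a b c s t).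
    exact: (@sw5_mid _ _ _ hH Y X2 X3 X4 X5 h).
  exact: esym (@sw5_out _ _ _ hH Y X1 X2 h).
rewrite sw_exch [RHS]/coadj; apply: eq_sw => y w.
rewrite sw_exch; apply: eq_sw => c v.
rewrite sw_prod //; try by lin.
rewrite sw_prod //; try by lin.
rewrite sw_antipode //; try by lin.
rewrite sw_map; try by lin.
rewrite sw_exch sw_lfun; apply: eq_sw => s t.
rewrite sw_lfun; apply: eq_sw => u1 u2.
rewrite sw_map; try by lin.
by rewrite sw_lfun.
Qed.

(** One lemma serves two purposes: combined with [double_prodE] it is the module axiom for V, and
    for V = [reg] it is the associativity of the double. *)
Lemma double_repM (V : lmodule H) (d e : tensor Kd H) (m : tensor Kd V) :
  double_rep sigma V (double_rep sigma reg d e) m =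
  double_rep sigma V d (double_rep sigma V e m).
Proof.
have repE V' := @double_rep_ev F H K hH sigma SK V'.
apply: ev_sep => x; rewrite !repE.
have lG : linear (fun y => ev V y m) by exact: lin_ev.
have lE : linear (fun y => ev reg y e) by exact: lin_ev.
have lco1 V' G x' := @lin_coadj1 F H K sigma V' G x'.
have regE y : ev H y (double_rep sigma reg d e) =
    \sw_(y1, y2 <- y) co reg (fun y => ev reg y e) (ev H y1 d) y2.
  exact: (@double_rep_ev F H K hH sigma SK reg d e y).
under eq_sw => x1 x2.
  rewrite regE (sw_push (g := fun h => co V _ h x2)) //; over.
rewrite (sw_assoc hK (f := fun y1 y2 x2 =>
  co V (fun y => ev V y m) (co reg (fun y => ev reg y e) (ev H y1 d) y2) x2)).
  apply: eq_sw => y1 u; rewrite coadj_conv //.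
  by congr (co V _ _ _); apply/funext => y; rewrite repE.
all: rewrite /coadj; by lin.
Qed.

Lemma double_prodE (d e : D) : d ∙ e = double_rep sigma reg d e.
Proof.
move: d; apply: tensor_ind_lin; [exact: (hprod_linearl (A := D)) | by lin|].
move=> k h; move: e; apply: tensor_ind_lin; [exact: (hprod_linearr (A := D)) | by lin|].
move=> l g; rewrite double_repE; apply: etrans (double_mulE _ _ _ _ _) _.
apply: eq_sweedler3 => l1 l2 l3; apply: eq_sweedler3 => h1 h2 h3.
by rewrite -[mod_rep _ _ _]/(regular_rep H h2 g) regular_repE.
Qed.

Lemma double_is_rep (V : lmodule H) : is_rep (double_rep sigma V).
Proof.
split; last by move=> d e; apply/lfunP => m; rewrite comp_lfunE double_prodE double_repM.
apply/lfunP => m; rewrite id_lfunE; apply: ev_sep => x.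
apply: etrans (double_rep_ev hH sigma SK _ _ _) _.
have lG : linear (fun y => ev V y m) by exact: lin_ev.
under eq_sw => x1 x2.
  rewrite ev_tens (linearZP (lin_coadj1 sigma _ x2)) coadj1 //; over.
by rewrite (sw_counitl hK (f := fun y => ev V y m)).
Qed.

Lemma double_prod_ev (d e : D) x :
  ev H x (d ∙ e) = \sw_(x1, x2 <- x) co reg (fun y => ev H y e) (ev H x1 d) x2.
Proof.
rewrite double_prodE; exact: (@double_rep_ev F H K hH sigma SK reg d e x).
Qed.

End DoubleModule.

(** * The Hopf algebra axioms of the double *)

Section DoubleHopf.
Variables (F : fieldType) (H K : hopfData F).
Hypothesis hH : is_hopf H.
Hypothesis hK : is_hopf K.
Local Notation Kd := (dual_hopf K).
Variable sigma : 'Hom(tensor Kd H, F^o).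
Local Notation r := (sigma_r sigma).
Hypothesis hr : is_hopf_map r.
Local Notation S := (hantipode K).
Hypothesis SK : forall x : K, S (S x) = x.
Implicit Types (h g : H) (x y z : K) (k l : dual K).
Local Notation D := (quantum_double sigma).
Local Notation reg := (regular_module hH).
Local Notation co := (@coadj F H K sigma reg).
Let hKd := dual_hopfP hK.
Let prod_ev := @double_prod_ev F H K hH sigma SK.

Lemma sw_double (W : vectType F) (f : D -> D -> W) k h :
  (forall e : D, linear (fun d : D => f d e)) ->
  (forall d : D, linear (fun e : D => f d e)) ->
  sweedler2 f (k ⊗ h : D) =
  \swd_(k1, k2 <- k) \sw_(h1, h2 <- h) f (k2 ⊗ h1 : D) (k1 ⊗ h2 : D).
Proof.
move=> f1 f2; rewrite sweedler2E [hcomul _]tlift_tens; try by move=> u; lin.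
rewrite sw_cop; try by lin.
rewrite sw_lfun; apply: eq_sw => k1 k2; rewrite sw_lfun; apply: eq_sw => h1 h2.
by rewrite tlift_tens.
Qed.

Definition ev2 x y : 'Hom(tensor D D, tensor H H) :=
  tlift (fun d e : D => ev H x d ⊗ ev H y e).

Lemma ev2_tens x y (d e : D) : ev2 x y (d ⊗ e) = ev H x d ⊗ ev H y e.
Proof. by rewrite /ev2 tlift_tens; lin. Qed.

Lemma dual_tensor_sum (U V : vectType F) (phi : dual (tensor (dual U) V)) t :
  phi t = \sum_(p : 'I_(dim (dual U)) * 'I_(dim V))
    phi (ebasis p.1 ⊗ ebasis p.2) *
      dual_ebasis p.2 (contract V (dual_ebasis p.1) t).
Proof.
rewrite [in LHS](tensor_sum t) linear_sum; apply: eq_bigr => p _.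
rewrite linearZ /= mulrC; congr (_ * _).
move: t; apply: (@tensor_ind_lin _ _ _ F^o); try by lin.
  by move=> c s t; rewrite !mxE.
move=> u v; rewrite contract_tens linearZ /= !dual_ebasisE /tens !mxE.
by rewrite big_ord1 !mxE.
Qed.

Lemma ev2_sep (t t' : tensor D D) : (forall x y, ev2 x y t = ev2 x y t') -> t = t'.
Proof.
move=> e; apply: contract_sep => phi; apply: ev_sep => y.
(* These functionals are a point evaluation followed by a coordinate of H. They span the dual of D,
   so every [phi] reduces to evaluations. *)
pose psi p : dual D := (dual_ebasis p.2 \o contract H (dual_ebasis p.1))%VF.
have phiE : phi = \sum_p phi (ebasis p.1 ⊗ ebasis p.2) *: psi p.
  apply/lfunP => d; rewrite sum_lfunE dual_tensor_sum; apply: eq_bigr => p _.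
  by rewrite scale_lfunE comp_lfunE.
have cE s : ev H y (contract D phi s) =
    \sum_p phi (ebasis p.1 ⊗ ebasis p.2) *: ev H y (contract D (psi p) s).
  move: s; apply: tensor_ind_lin; try by lin.
  move=> d f; rewrite contract_tens linearZ /= [in LHS]phiE sum_lfunE scaler_suml.
  by apply: eq_bigr => p _; rewrite contract_tens linearZ /= scale_lfunE scalerA.
rewrite !cE; apply: eq_bigr => p _; congr (_ *: _).
have [x xE] := dual_ev (dual_ebasis p.1).
have cx d : contract H (dual_ebasis p.1) d = ev H x d.
  move: d; apply: tensor_ind_lin; try by lin.
  by move=> k h; rewrite contract_tens ev_tens xE.
have pE s : ev H y (contract D (psi p) s) = contract H (dual_ebasis p.2) (ev2 x y s).
  move: s; apply: tensor_ind_lin; try by lin.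
  move=> d f; rewrite contract_tens ev2_tens contract_tens linearZ /= comp_lfunE.
  by rewrite cx.
by rewrite !pE e.
Qed.

(** The arguments appear in the order y, x because K^* carries the co-opposite coproduct. *)
Lemma double_comul_ev x y (d : D) : ev2 x y (hcomul d) = hcomul (ev H (y ∙ x) d).
Proof.
move: d; apply: tensor_ind_lin; try by lin.
move=> k h; rewrite -sw_tens sw_double; try by lin.
rewrite sw_lfun; under eq_sw => k1 k2.
  rewrite sw_lfun; under eq_sw => h1 h2.
    rewrite ev2_tens !ev_tens (linearZP (tens_linearr _)).
    rewrite (linearZP (tens_linearl _)) scalerA.
  over.
  rewrite -swZr sw_tens; over.
by rewrite -swZl sw_dual ev_tens linearZ.
Qed.

Lemma sw_double_ev (W : vectType F) (f : H -> H -> W) x y (d : D) :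
  (forall h, linear (fun g => f g h)) -> (forall h, linear (fun g => f h g)) ->
  sweedler2 (fun d1 d2 : D => f (ev H x d1) (ev H y d2)) d =
  \sw_(p, q <- ev H (y ∙ x) d) f p q.
Proof.
move=> f1 f2; rewrite [RHS]sweedler2E -double_comul_ev -sw_tens !sw_lfun.
by apply: eq_sw => d1 d2; rewrite ev2_tens tlift_tens.
Qed.

Section Telescope.
Variables (W : vectType F) (Z : H -> H -> K -> H -> H -> W).
Hypothesis Z1 : forall b c s t, linear (fun a => Z a b c s t).
Hypothesis Z2 : forall a c s t, linear (fun b => Z a b c s t).
Hypothesis Z3 : forall a b s t, linear (fun c => Z a b c s t).
Hypothesis Z4 : forall a b c t, linear (fun s => Z a b c s t).
Hypothesis Z5 : forall a b c s, linear (fun t => Z a b c s t).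

(** As S^2 = 1, the middle factor is S(r(p3 S(q1))). Since p3 and q1 are adjacent legs of h, the
    antipode axiom collapses it to 1. *)
Lemma sw_telescope h :
  \sw_(p, q <- h) \sw_(p1, u <- p) \sw_(p2, p3 <- u) \sw_(q1, v <- q)
    \sw_(q2, q3 <- v) Z p1 p2 (r q1 ∙ S (r p3)) q2 q3 =
  \sw_(h1, u <- h) \sw_(y, h3 <- u) \sw_(p2, q2 <- y) Z h1 p2 (hone K) q2 h3.
Proof.
rewrite (sw_assoc hH (f := fun p1 u q => \sw_(p2, p3 <- u) \sw_(q1, v <- q)
    \sw_(q2, q3 <- v) Z p1 p2 (r q1 ∙ S (r p3)) q2 q3)); try by lin.
apply: eq_sw => p1 w.
rewrite (sw_assoc hH (f := fun p2 p3 q => \sw_(q1, v <- q)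
    \sw_(q2, q3 <- v) Z p1 p2 (r q1 ∙ S (r p3)) q2 q3)); try by lin.
rewrite (sw_assoc hH (f := fun p2 q2 h3 => Z p1 p2 (hone K) q2 h3)); try by lin.
apply: eq_sw => p2 w2.
rewrite -(sw_assoc hH (f := fun p3 q1 v =>
    \sw_(q2, q3 <- v) Z p1 p2 (r q1 ∙ S (r p3)) q2 q3)); try by lin.
under eq_sw => m v.
  under eq_sw => p3 q1.
    rewrite (_ : r q1 ∙ S (r p3) = S (r (p3 ∙ hantipode H q1))); last first.
      by rewrite (hmap_prod hr) antipodeM // (hmap_antipode hr) SK.
  over.
  rewrite (sw_antipr hH (f := fun a => \sw_(q2, q3 <- v) Z p1 p2 (S (r a)) q2 q3));
    last by lin.
  rewrite (hmap_one hr) antipode1 //; over.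
by rewrite (sw_counitl hH (f := fun v => \sw_(q2, q3 <- v) Z p1 p2 (hone K) q2 q3)); lin.
Qed.

End Telescope.

(** Evaluated at x and y, the right-hand side has two coadjoint actions, which leave r(q1) S(r(p3))
    between y_(2) and x_(2). [sw_telescope] removes this factor, and one coadjoint action at y_(2)
    x_(2) remains. *)
Lemma double_comulM (d e : D) :
  hcomul (d ∙ e) = sweedler2 (fun d1 d2 : D =>
    sweedler2 (fun e1 e2 : D => (d1 ∙ e1) ⊗ (d2 ∙ e2)) e) d.
Proof.
apply: ev2_sep => x y; rewrite double_comul_ev prod_ev.
pose E (f : D) z : reg := ev H z f.
have lE f : linear (E f) by exact: lin_ev.
have lco1 f z := @lin_coadj1 F H K sigma reg (E f) z.
have lco2 f h := lin_coadj2 sigma (lE f) h.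
rewrite sw_prod //; last by move=> z; rewrite -/(E e); lin.
  2: by move=> z; rewrite -/(E e); lin.
rewrite 2!sw_lfun.
transitivity (\sw_(y1, y2 <- y) \sw_(x1, x2 <- x) sweedler2 (fun d1 d2 : D =>
   sweedler2 (fun e1 e2 : D =>
     co (E e1) (ev H x1 d1) x2 ⊗ co (E e2) (ev H y1 d2) y2) e) d).
  apply: eq_sw => y1 y2; rewrite sw_lfun; apply: eq_sw => x1 x2.
  rewrite (sw_double_ev (f := fun p q => sweedler2 (fun e1 e2 : D =>
     co (E e1) p x2 ⊗ co (E e2) q y2) e)); try by lin.
  set h := ev H (y1 ∙ x1) d.
  pose Z p1 p2 m q2 q3 : tensor H H :=
    \sw_(g1, g2 <- E e ((S (r q3) ∙ y2) ∙ m ∙ (x2 ∙ r p1))) ((p2 ∙ g1) ⊗ (q2 ∙ g2)).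
  transitivity (\sw_(p, q <- h) \sw_(p1, u <- p) \sw_(p2, p3 <- u) \sw_(q1, v <- q)
    \sw_(q2, q3 <- v) Z p1 p2 (r q1 ∙ S (r p3)) q2 q3).
    rewrite sw_telescope /Z; try by lin.
    rewrite [X in hcomul X]/coadj sw_lfun; apply: eq_sw => h1 u.
    rewrite sw_lfun; apply: eq_sw => w h3.
    by rewrite regular_repE hcomulM // hprod1r // !hprodA.
  apply: eq_sw => p q.
  under [RHS]eq_sw => e1 e2.
    rewrite (sw_push (g := fun a => a ⊗ co (E e2) q y2)); last by lin.
    under eq_sw => p1 u.
      rewrite (sw_push (g := fun a => a ⊗ co (E e2) q y2)); last by lin.
      under eq_sw => p2 p3.
        rewrite (sw_push (g := fun b => _ ⊗ b)); last by lin.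
        under eq_sw => q1 v.
          rewrite (sw_push (g := fun b => _ ⊗ b)); last by lin.
          over.
        over.
      over.
    over.
  rewrite [RHS]sw_exch; apply: eq_sw => p1 u; rewrite [RHS]sw_exch; apply: eq_sw => p2 p3.
  rewrite [RHS]sw_exch; apply: eq_sw => q1 v; rewrite [RHS]sw_exch; apply: eq_sw => q2 q3.
  rewrite /E (sw_double_ev (f := fun a b : H => mod_rep reg p2 a ⊗ mod_rep reg q2 b));
    try by lin.
  rewrite /Z !hprodA //.
  by apply: eq_sw => g1 g2; rewrite !regular_repE.
under [RHS]eq_sw => d1 d2.
  rewrite sw_lfun; under eq_sw => e1 e2.
    rewrite ev2_tens !prod_ev.
    rewrite (sw_push (g := fun a => _ ⊗ a)); last by lin.
    under eq_sw => y1 y2.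
      rewrite (sw_push (g := fun a => a ⊗ _)); last by lin.
      over.
    over.
  rewrite sw_exch; under eq_sw do rewrite sw_exch.
  over.
rewrite [RHS]sw_exch; apply: eq_sw => y1 y2.
by rewrite [RHS]sw_exch.
Qed.

Lemma double_ev_l k (d : D) x :
  ev H x ((k ⊗ hone H : D) ∙ d) = \sw_(x1, x2 <- x) (k x1 : F) *: ev H x2 d.
Proof.
rewrite prod_ev; apply: eq_sw => x1 x2.
have lE : linear (fun y => ev H y d : reg) by exact: lin_ev.
rewrite ev_tens (linearZP (lin_coadj1 sigma _ x2)); congr (_ *: _).
exact: (coadj1 hH hK hr lE).
Qed.

Lemma double_kk k l : (k ⊗ hone H : D) ∙ (l ⊗ hone H) = ((k : Kd) ∙ l) ⊗ hone H.
Proof.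
apply: ev_sep => x; rewrite double_ev_l ev_tens dual_prodE swZl.
by apply: eq_sw => x1 x2; rewrite ev_tens scalerA.
Qed.

Lemma double_kh k h : (k ⊗ hone H : D) ∙ (hone Kd ⊗ h) = k ⊗ h.
Proof.
apply: ev_sep => x; rewrite double_ev_l.
under eq_sw do rewrite ev_tens scalerA mulrC -scalerA.
rewrite ev_tens (sw_counitr hK (f := fun x => (k x : F) *: h)) //.
by lin.
Qed.

Lemma coadj_counit (V : lmodule H) (v : V) h x :
  coadj sigma (fun y => (hcounit K y : F) *: v) h x =
  (hcounit K x : F) *: mod_rep V h v.
Proof.
transitivity (\sw_(h1, u <- h) \sw_(h2, h3 <- u)
   (hcounit H h1 : F) *: ((hcounit H h3 : F) *: ((hcounit K x : F) *: mod_rep V h2 v))).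
  apply: eq_sw => h1 u; apply: eq_sw => h2 h3.
  rewrite linearZ /= !hcounitM // counit_antipode // !(hmap_counit hr).
  by rewrite !scalerA; congr (_ *: _); ring.
under eq_sw => h1 u.
  rewrite -swZr.
  rewrite (sw_counitr hH (f := fun h2 => (hcounit K x : F) *: mod_rep V h2 v)); last by lin.
  over.
by rewrite (sw_counitl hH (f := fun h2 => (hcounit K x : F) *: mod_rep V h2 v)) //; lin.
Qed.

Lemma coadj_one h g x : co (fun y => (hcounit K y : F) *: (g : reg)) h x =
  (hcounit K x : F) *: (h ∙ g).
Proof. by rewrite (@coadj_counit reg g h x) regular_repE. Qed.

Lemma double_hh h g : (hone Kd ⊗ h : D) ∙ (hone Kd ⊗ g) = hone Kd ⊗ (h ∙ g).
Proof.
apply: ev_sep => x; rewrite prod_ev ev_tens.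
under eq_sw => x1 x2.
  rewrite ev_tens (linearZP (lin_coadj1 sigma _ x2)).
  have -> : (fun y => ev H y ((hone Kd : dual K) ⊗ g)) =
            (fun y => (hcounit K y : F) *: (g : reg)).
    by apply/funext => y; rewrite ev_tens.
  rewrite coadj_one; over.
by rewrite (sw_counitl hK (f := fun x => (hcounit K x : F) *: (h ∙ g))) //; lin.
Qed.

Lemma double_prodA (a b c : D) : a ∙ (b ∙ c) = (a ∙ b) ∙ c.
Proof.
rewrite !(double_prodE hH); apply: esym.
exact: (@double_repM F H K hH hK sigma hr SK reg a b c).
Qed.

Lemma double_counitE (d : D) : hcounit D d = hcounit H (ev H (hone K) d).
Proof.
move: d; apply: (@tensor_ind_lin _ _ _ F^o); [by lin|by lin|move=> k h].
rewrite ev_tens linearZ /= /double_counit tlift_tens; try by move=> u; lin.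
by rewrite dual_counitE.
Qed.

Lemma double_counitM (d e : D) : hcounit D (d ∙ e) = hcounit D d * hcounit D e.
Proof.
rewrite !double_counitE prod_ev sw_one //; last 2 first.
- by move=> y; apply: lin_app (lin_coadj1 sigma _ y) _; lin.
- by move=> y; apply: lin_coadj2; exact: lin_ev.
rewrite /coadj.
rewrite (sw_push (g := fun h => hcounit H h)); last by lin.
transitivity (\sw_(h1, u <- ev H (hone K) d) \sw_(h2, h3 <- u)
  ((hcounit H h2 : F) *: (hcounit H (ev H (S (r h3) ∙ r h1) e) : F^o))).
  apply: eq_sw => h1 u; rewrite (sw_push (g := fun h => hcounit H h)); last by lin.
  by apply: eq_sw => h2 h3; rewrite regular_repE hcounitM // hprod1r.
under eq_sw => h1 u.
  rewrite (sw_counitl hH (f := fun h3 => hcounit H (ev H (S (r h3) ∙ r h1) e))); last by lin.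
  (* Written with S^2 = 1, the argument is S(r(S(h_(1)) h_(2))), to which the antipode axiom of H
     applies. *)
  rewrite -[r h1]SK -antipodeM // -(hmap_antipode hr) -(hmap_prod hr); over.
rewrite (sw_antipl hH (f := fun h => hcounit H (ev H (S (r h)) e))); last by lin.
by rewrite (hmap_one hr) antipode1.
Qed.

Lemma double_counit_tens k h : hcounit D (k ⊗ h : D) = k (hone K) * hcounit H h.
Proof. by rewrite double_counitE ev_tens linearZ. Qed.

Lemma double_antipode_tens k h :
  hantipode D (k ⊗ h : D) =
  (hone Kd ⊗ hantipode H h : D) ∙ (hantipode Kd k ⊗ hone H).
Proof.
rewrite [LHS]tlift_tens; try by move=> u; lin.
by rewrite antipode_invE //; exact: (dual_invol SK).
Qed.

Lemma double_coassoc (d : D) :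
  sweedler2 (fun x d3 : D => sweedler2 (fun d1 d2 : D => d1 ⊗ d2 ⊗ d3) x) d =
  sweedler2 (fun d1 x : D => sweedler2 (fun d2 d3 : D => d1 ⊗ d2 ⊗ d3) x) d.
Proof.
move: d; apply: tensor_ind_lin; [by lin|by lin|move=> k h].
rewrite !sw_double; try by lin.
under eq_sw do under eq_sw do [rewrite sw_double; try by lin].
under [RHS]eq_sw do under eq_sw do [rewrite sw_double; try by lin].
under eq_sw do rewrite sw_exch; under [RHS]eq_sw do rewrite sw_exch.
rewrite (sw_assoc hKd (f := fun j1 j2 k2 : dual K => \sw_(h1, u <- h) \sw_(g1, g2 <- u)
  ((k2 ⊗ h1 : D) ⊗ (j2 ⊗ g1 : D) ⊗ (j1 ⊗ g2 : D)))); try by lin.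
apply: eq_sw => k1 u; apply: eq_sw => j1 j2.
by rewrite (sw_assoc hH (f := fun g1 g2 h2 =>
  ((j2 ⊗ g1 : D) ⊗ (j1 ⊗ g2 : D) ⊗ (k1 ⊗ h2 : D)))); lin.
Qed.

Lemma double_hopf : is_hopf D.
Proof.
have eK k : hcounit Kd k = k (hone K) := dual_counitE k.
split.
- exact: double_prodA.
- move=> d; have [rep1 _] := double_is_rep hH hK hr SK reg.
  rewrite (double_prodE hH); have := congr1 (fun f : 'End(D) => f d) rep1.
  by rewrite id_lfunE.
- move=> d; apply: ev_sep => x; rewrite prod_ev.
  under eq_sw => x1 x2.
    have -> : (fun y => ev H y (hone D)) = (fun y => (hcounit K y : F) *: (hone H : reg)).
      by apply/funext => y; rewrite ev_tens.
    rewrite coadj_one hprod1r //; over.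
  by rewrite (sw_counitr hK (f := fun x => ev H x d)) //; lin.
- exact: double_coassoc.
- move=> d; move: d; apply: tensor_ind_lin; [by lin|by lin|move=> k h].
  rewrite sw_double; try by lin.
  under eq_sw => k1 k2.
    under eq_sw => h1 h2 do rewrite double_counit_tens -scalerA -eK.
    rewrite -swZr (sw_counitl hH (f := fun g => k1 ⊗ g)); last by lin.
  over.
  by rewrite (sw_counitr hKd (f := fun l => l ⊗ h)) //; lin.
- move=> d; move: d; apply: tensor_ind_lin; [by lin|by lin|move=> k h].
  rewrite sw_double; try by lin.
  under eq_sw => k1 k2.
    under eq_sw => h1 h2 do rewrite double_counit_tens -scalerA -eK.
    rewrite -swZr (sw_counitr hH (f := fun g => k2 ⊗ g)); last by lin.
  over.
  by rewrite (sw_counitl hKd (f := fun l => l ⊗ h)) //; lin.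
- exact: double_comulM.
- rewrite -sw_tens sw_double; try by lin.
  rewrite (sw_one hKd); try by lin.
  by rewrite (sw_one hH) //; lin.
- exact: double_counitM.
- by rewrite double_counit_tens /= !hcounit1 // mulr1.
- move=> d; move: d; apply: tensor_ind_lin; [by lin|by lin|move=> k h].
  rewrite sw_double; try by lin.
  (* The factor k1 ⋈ h2 is split as (k1 ⋈ 1)(ε ⋈ h2). Then S(k2) k1 = S(S(k1) k2) collapses first,
     and S(h1) h2 after it. *)
  transitivity (\sw_(h1, h2 <- h) \swd_(k1, k2 <- k) (hone Kd ⊗ hantipode H h1 : D)
     ∙ ((hantipode Kd (hantipode Kd (k1 : Kd) ∙ (k2 : Kd)) ⊗ hone H : D) ∙ (hone Kd ⊗ h2))).
    rewrite sw_exch; apply: eq_sw => h1 h2; apply: eq_sw => k1 k2.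
    rewrite double_antipode_tens -(double_kh k1 h2) (antipodeM hKd) (dual_invol SK).
    by rewrite -double_kk !double_prodA.
  under eq_sw => h1 h2.
    rewrite (sw_antipl hKd (f := fun l : dual K => (hone Kd ⊗ hantipode H h1 : D)
     ∙ ((hantipode Kd l ⊗ hone H : D) ∙ (hone Kd ⊗ h2)))); last by lin.
    rewrite (antipode1 hKd) double_kh double_hh; over.
  rewrite -swZr (sw_antipl hH (f := fun g => hone Kd ⊗ g : D)); last by lin.
  by rewrite double_counit_tens scalerA eK.
- move=> d; move: d; apply: tensor_ind_lin; [by lin|by lin|move=> k h].
  rewrite sw_double; try by lin.
  transitivity (\swd_(k1, k2 <- k) \sw_(h1, h2 <- h) (k2 ⊗ hone H : D)
     ∙ ((hone Kd ⊗ (h1 ∙ hantipode H h2) : D) ∙ (hantipode Kd k1 ⊗ hone H))).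
    apply: eq_sw => k1 k2; apply: eq_sw => h1 h2.
    by rewrite double_antipode_tens -(double_kh k2 h1) -double_hh !double_prodA.
  under eq_sw => k1 k2.
    rewrite (sw_antipr hH (f := fun g => (k2 ⊗ hone H : D)
     ∙ ((hone Kd ⊗ g : D) ∙ (hantipode Kd k1 ⊗ hone H)))); last by lin.
    rewrite double_prodA double_kh double_kk.
    rewrite -[X in X ∙ _](dual_invol SK) -(antipodeM hKd); over.
  rewrite -swZr (sw_antipr hKd (f := fun l => hantipode Kd l ⊗ hone H)); last by lin.
  by rewrite (antipode1 hKd) double_counit_tens scalerA eK mulrC.
Qed.

End DoubleHopf.

(** * Sweedler powers in the quantum double *)

Lemma integral_unique (F : fieldType) (A : hopfData F) (L : A) :
  is_normalized_integral L -> integral A = L.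
Proof.
move=> nL; rewrite /integral; apply: xget_unique => // L' nL'.
case: nL nL' => l r e [l' r' e'].
by have := l L'; rewrite r' e e' !scale1r.
Qed.

Section SplitPower.
Variables (F : fieldType) (H : hopfData F).
Hypothesis hH : is_hopf H.
Local Notation PH n := (sweedler_prod H n.+1).

(* Σ f(h_(1) h_(3) ... h_(2n+1), h_(2) h_(4) ... h_(2n)): the second leg has one
   factor less, which [sw_split_prod] adds. *)
Fixpoint sw_split (W : vectType F) n (f : H -> H -> W) (h : H) : W :=
  if n is n.+1 then \sw_(h1, u <- h) \sw_(h2, h3 <- u)
    sw_split n (fun b c => f (h1 ∙ b) (h2 ∙ c)) h3
  else f h (hone H).

Lemma eq_sw_split (W : vectType F) n (f g : H -> H -> W) h :
  (forall b c, f b c = g b c) -> sw_split n f h = sw_split n g h.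
Proof.
by move=> e; have -> : f = g by apply/funext => b; apply/funext => c.
Qed.

Lemma lin_sw_split (U W : vectType F) n (f : U -> H -> H -> W) h :
  (forall b c, linear (fun p => f p b c)) -> linear (fun p => sw_split n (f p) h).
Proof.
elim: n f h => [|n IH] f h lf /=; first exact: lf.
by apply: lin_sw => h1 u; apply: lin_sw => h2 h3; apply: IH => b c; apply: lf.
Qed.

Lemma lin_sw_split_arg (W : vectType F) n (f : H -> H -> W) :
  (forall c, linear (fun b => f b c)) -> linear (sw_split n f).
Proof. by case: n => [|n] lf /=; [exact: lf | lin]. Qed.

Lemma sw_split_push (W W' : vectType F) n (g : W -> W') (f : H -> H -> W) h :
  linear g -> g (sw_split n f h) = sw_split n (fun b c => g (f b c)) h.
Proof.
move=> lg; elim: n f h => [//|n IH] f h /=.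
rewrite (sw_push _ _ lg); apply: eq_sw => h1 u.
by rewrite (sw_push _ _ lg); apply: eq_sw => h2 h3; rewrite IH.
Qed.

Lemma sw_split_sw (B : hopfData F) (W : vectType F) n (f : B -> B -> H -> H -> W) (x : B) h :
  \sw_(x1, x2 <- x) sw_split n (f x1 x2) h =
  sw_split n (fun b c => \sw_(x1, x2 <- x) f x1 x2 b c) h.
Proof.
elim: n f h => [//|n IH] f h /=.
rewrite sw_exch; apply: eq_sw => h1 u; rewrite sw_exch; apply: eq_sw => h2 h3.
exact: IH.
Qed.

(** Since Δ is multiplicative, the odd-numbered legs multiply in the first tensor factor and the
    even-numbered ones in the second. *)
Lemma sw_split_prod (W : vectType F) n (f : H -> H -> W) h :
  (forall c, linear (fun b => f b c)) -> (forall b, linear (fun c => f b c)) ->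
  \sw_(u, a <- h) sw_split n (fun b c => f b (c ∙ a)) u =
  \sw_(b, c <- PH n h) f b c.
Proof.
elim: n f h => [|n IH] f h f1 f2 /=.
  by rewrite sweedler_prod1; apply: eq_sw => u a; rewrite hprod1l.
rewrite (sw_assoc hH (f := fun h1 v a => \sw_(h2, h3 <- v)
  sw_split n (fun b c => f (h1 ∙ b) (h2 ∙ c ∙ a)) h3)); first last.
- move=> h1 v; apply: lin_sw => h2 h3; apply: lin_sw_split => b c; lin.
- by move=> h1 a; lin.
- move=> v a; apply: lin_sw => h2 h3; apply: lin_sw_split => b c; lin.
rewrite sweedler_prodSl // (sw_push (g := fun p => \sw_(b, c <- p) f b c)); last by lin.
under [RHS]eq_sw => y w do [rewrite sw_prod //; try by lin].
rewrite (sw_assoc hH (f := fun h1 h2 w => \sw_(b, c <- PH n w) f (h1 ∙ b) (h2 ∙ c)));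
  try by lin.
apply: eq_sw => h1 v.
rewrite (sw_assoc hH (f := fun h2 h3 a =>
  sw_split n (fun b c => f (h1 ∙ b) (h2 ∙ c ∙ a)) h3)); first last.
- move=> h2 h3; apply: lin_sw_split => b c; lin.
- by move=> h2 a; apply: lin_sw_split_arg => c; lin.
- move=> h3 a; apply: lin_sw_split => b c; lin.
apply: eq_sw => h2 w.
under eq_sw => h3 a.
  rewrite (@eq_sw_split _ _ _ (fun b c => f (h1 ∙ b) (h2 ∙ (c ∙ a)))); last first.
    by move=> b c; rewrite -hprodA.
over.
by rewrite (IH (fun b c => f (h1 ∙ b) (h2 ∙ c))) //; lin.
Qed.

End SplitPower.

(** * Twisted products in K *)

Section DoublePower.
Variables (F : fieldType) (H K : hopfData F).
Hypothesis hH : is_hopf H.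
Hypothesis hK : is_hopf K.
Local Notation Kd := (dual_hopf K).
Variable sigma : 'Hom(tensor Kd H, F^o).
Local Notation r := (sigma_r sigma).
Hypothesis hr : is_hopf_map r.
Local Notation S := (hantipode K).
Hypothesis SK : forall x : K, S (S x) = x.
Implicit Types (h g : H) (x y : K).

(** In the Sweedler indices of K this is x_(n+1) ... x_(2) x_(1). *)
Definition cop_prod n : 'End(K) := sweedler_prod (cop K) n.+1.
Local Notation p n := (cop_prod n).

Lemma cop_prod1 x : p 0%N x = x.
Proof. exact: sweedler_prod1. Qed.

Lemma cop_prodS n x : p n.+1 x = \sw_(x1, x2 <- x) (p n x2 ∙ x1).
Proof.
have e : p n.+1 x = sweedler2 (A := cop K) (fun x y : K => p n x ∙ y) x by [].
by rewrite e sw_cop //; lin.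
Qed.

(* Σ x_(n+1) r(h_(n)) x_(n) ... x_(2) r(h_(1)) x_(1) *)
Definition twisted_prod n h x : K :=
  if n is n.+1 then \sw_(x1, x2 <- x) (p n (x2 ∙ r h) ∙ x1)
  else (hcounit H h : F) *: x.

Lemma lin_twisted_prod1 n x : linear (fun h => twisted_prod n h x).
Proof. by case: n => [|n] /=; lin. Qed.

Lemma lin_twisted_prod2 n h : linear (twisted_prod n h).
Proof. by case: n => [|n] /=; lin. Qed.

Lemma twisted_prodS n h x : twisted_prod n.+1 h x =
  \sw_(h1, h2 <- h) \sw_(x1, x2 <- x) (twisted_prod n h2 x2 ∙ (r h1 ∙ x1)).
Proof.
case: n => [|n].
  rewrite sw_exch; apply: eq_sw => x1 x2; rewrite cop_prod1 -hprodA //.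
  rewrite -[in LHS](sw_counitr hH (f := fun h => x2 ∙ (r h ∙ x1))); last by lin.
  by apply: eq_sw => h1 h2; rewrite /twisted_prod hprodZl.
rewrite /twisted_prod sw_exch; apply: eq_sw => x1 x2.
rewrite cop_prodS sw_prod //; try by lin.
transitivity (\sw_(y1, y2 <- x2) \sw_(h1, h2 <- h)
    (p n (y2 ∙ r h2) ∙ (y1 ∙ r h1) ∙ x1)).
  rewrite sw_prodl; apply: eq_sw => y1 y2.
  by rewrite (sw_map hr) ?sw_prodl //; lin.
rewrite sw_exch; apply: eq_sw => h1 h2; rewrite sw_prodl.
by apply: eq_sw => y1 y2; rewrite !hprodA.
Qed.

(** Expanded, the left side is S(r(t_(1))) y_(n+1) r(a_(n)) S(r(t_(2))) y_(n) ... r(a_(1))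
    S(r(t_(n+1))) y_(1). The adjacent legs t_(n+1) and a_(1) of h cancel, then t_(n) and a_(2), and
    so on, until only S(r(h)) is left. *)
Lemma twisted_prod_telescope n (h : H) y :
  \sw_(t, a <- h) twisted_prod n a (S (r t) ∙ y) = S (r h) ∙ p n y.
Proof.
have lm1 m x := lin_twisted_prod1 m x; have lm2 m g := lin_twisted_prod2 m g.
elim: n h y => [|n IH] h y.
  rewrite cop_prod1 /twisted_prod.
  by rewrite (sw_counitr hH (f := fun t => S (r t) ∙ y)); lin.
pose X t1 m a2 := \sw_(y1, y2 <- y) (twisted_prod n a2 (S (r t1) ∙ y2) ∙ (m ∙ y1)).
transitivity (\sw_(t, a <- h) \sw_(t1, t2 <- t) \sw_(a1, a2 <- a)
    X t1 (r a1 ∙ S (r t2)) a2).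
  apply: eq_sw => t a; rewrite twisted_prodS [RHS]sw_exch; apply: eq_sw => a1 a2.
  rewrite sw_prod //; try by lin.
  rewrite sw_antipode //; try by lin.
  rewrite (sw_map hr); try by lin.
  apply: eq_sw => t1 t2; apply: eq_sw => y1 y2.
  by rewrite !hprodA.
have X1 m a : linear (fun t => X t m a) by rewrite /X; lin.
have X2 t a : linear (fun m => X t m a) by rewrite /X; lin.
have X3 t m : linear (fun a => X t m a).
  by apply: lin_sw => y1 y2; apply: lin_hprodl; exact: lm1.
have XE t m a : X t m a =
    \sw_(y1, y2 <- y) (twisted_prod n a (S (r t) ∙ y2) ∙ (m ∙ y1)) by [].
clearbody X.
rewrite (sw_assoc hH (f := fun t1 t2 a => \sw_(a1, a2 <- a) X t1 (r a1 ∙ S (r t2)) a2));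
  try by lin.
under eq_sw => t1 w.
  rewrite -(sw_assoc hH (f := fun t2 a1 a2 => X t1 (r a1 ∙ S (r t2)) a2)); try by lin.
  under eq_sw => m a2.
    under eq_sw => t2 a1.
      rewrite (_ : r a1 ∙ S (r t2) = S (r (t2 ∙ hantipode H a1))); last first.
        by rewrite (hmap_prod hr) antipodeM // (hmap_antipode hr) SK.
    over.
    rewrite (sw_antipr hH (f := fun g => X t1 (S (r g)) a2)); last by lin.
    rewrite (hmap_one hr) antipode1 //; over.
  rewrite (sw_counitl hH (f := fun a2 => X t1 (hone K) a2)); last by lin.
  over.
under eq_sw do rewrite XE.
rewrite sw_exch cop_prodS sw_prodr; apply: eq_sw => y1 y2.
rewrite hprodA // -IH sw_prodl; apply: eq_sw => t a.
by rewrite hprod1l.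
Qed.

End DoublePower.

Section DoublePowerFormula.
Variables (F : fieldType) (H K : hopfData F).
Hypothesis hH : is_hopf H.
Hypothesis hK : is_hopf K.
Local Notation Kd := (dual_hopf K).
Variable sigma : 'Hom(tensor Kd H, F^o).
Local Notation r := (sigma_r sigma).
Hypothesis hr : is_hopf_map r.
Local Notation S := (hantipode K).
Hypothesis SK : forall x : K, S (S x) = x.
Implicit Types (h g : H) (x y : K) (k : dual K).
Local Notation D := (quantum_double sigma).
Local Notation p n := (@cop_prod F K n).
Local Notation PD n := (sweedler_prod D n.+1).
Local Notation twisted_prod := (@twisted_prod F H K sigma).
Let hD := double_hopf hH hK hr SK.

(** Induction on the number of factors, splitting off the first one. Its coadjoint action puts
    S(r(t)) and r(a) around x_(2). The telescope turns S(r(t)) into a new leg of c, and r(a) becomes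
    the parameter of the longer twisted product. *)
Lemma double_power_ev n k h x :
  ev H x (PD n (k ⊗ h : D)) =
  \sw_(a, u <- h) sw_split n (fun b c => (k (S (r c) ∙ twisted_prod n a x) : F) *: b) u.
Proof.
have lm1 m y := @lin_twisted_prod1 F H K sigma m y.
have lm2 m g := @lin_twisted_prod2 F H K sigma m g.
elim: n k h x => [|n IH] k h x.
  rewrite sweedler_prod1 ev_tens /=.
  under eq_sw => a u do rewrite (hmap_one hr) antipode1 // hprod1l // linearZ -scalerA.
  by rewrite (sw_counitl hH (f := fun u => (k x : F) *: u)) //; lin.
rewrite sweedler_prodSl // sw_double // ; try by lin.
transitivity (\swd_(k1, k2 <- k) \sw_(h1, h2 <- h) \sw_(x1, x2 <- x) \sw_(a, v <- h1)
   \sw_(b, t <- v) \sw_(a', u <- h2) sw_split n (fun b' c =>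
     ((k1 (S (r c) ∙ twisted_prod n a' (S (r t) ∙ x2 ∙ r a)) * k2 x1 : F^o) : F) *: (b ∙ b')) u).
  rewrite sw_lfun; apply: eq_sw => k1 k2; rewrite sw_lfun; apply: eq_sw => h1 h2.
  rewrite double_prod_ev //; apply: eq_sw => x1 x2.
  rewrite ev_tens (linearZP (lin_coadj1 sigma _ x2)) /coadj.
  rewrite swZr; apply: eq_sw => a v; rewrite swZr; apply: eq_sw => b t.
  rewrite regular_repE [ev _ _ _]IH sw_prodr swZr; apply: eq_sw => a' u.
  rewrite (@sw_split_push F H H H n (fun e : H => (k2 x1 : F) *: (b ∙ e))); last by lin.
  apply: eq_sw_split => b' c; rewrite hprodZr scalerA; congr (_ *: _).
  by rewrite mulrC.
transitivity (\sw_(h1, h2 <- h) \sw_(x1, x2 <- x) \sw_(a, v <- h1)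
   \sw_(b, t <- v) \sw_(a', u <- h2) sw_split n (fun b' c =>
     (k (S (r c) ∙ twisted_prod n a' (S (r t) ∙ x2 ∙ r a) ∙ x1) : F) *: (b ∙ b')) u).
  rewrite [LHS]sw_exch; apply: eq_sw => h1 h2; rewrite [LHS]sw_exch; apply: eq_sw => x1 x2.
  rewrite [LHS]sw_exch; apply: eq_sw => a v; rewrite [LHS]sw_exch; apply: eq_sw => b t.
  rewrite [LHS]sw_exch; apply: eq_sw => a' u.
  rewrite (@sw_split_sw _ _ Kd); apply: eq_sw_split => b' c.
  by rewrite -swZl sw_dual.
pose Y x1 x2 a b t a' u : H := sw_split n (fun b' c =>
     (k (S (r c) ∙ twisted_prod n a' (S (r t) ∙ x2 ∙ r a) ∙ x1) : F) *: (b ∙ b')) u.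
have Y1 x1 x2 b t a' u : linear (fun a => Y x1 x2 a b t a' u).
  by apply: lin_sw_split => b' c; lin.
have Y2 x1 x2 a t a' u : linear (fun b => Y x1 x2 a b t a' u).
  by apply: lin_sw_split => b' c; lin.
have Y3 x1 x2 a b a' u : linear (fun t => Y x1 x2 a b t a' u).
  by apply: lin_sw_split => b' c; lin.
have Y4 x1 x2 a b t u : linear (fun a' => Y x1 x2 a b t a' u).
  by apply: lin_sw_split => b' c; apply: lin_scalel; apply: lin_lfun;
    apply: lin_hprodl; apply: lin_hprodr; apply: lm1.
have Y5 x1 x2 a b t a' : linear (Y x1 x2 a b t a').
  by apply: lin_sw_split_arg => c; lin.
have YE x1 x2 a b t a' u : Y x1 x2 a b t a' u = sw_split n (fun b' c =>
     (k (S (r c) ∙ twisted_prod n a' (S (r t) ∙ x2 ∙ r a) ∙ x1) : F) *: (b ∙ b')) u by [].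
transitivity (\sw_(x1, x2 <- x) \sw_(h1, h2 <- h) \sw_(a, v <- h1)
   \sw_(b, t <- v) \sw_(a', u <- h2) Y x1 x2 a b t a' u); first by rewrite [RHS]sw_exch.
clearbody Y.
transitivity (\sw_(x1, x2 <- x) \sw_(a, w <- h) \sw_(b, y <- w) \sw_(m, u <- y)
  \sw_(t, a' <- m) Y x1 x2 a b t a' u).
  apply: eq_sw => x1 x2.
  rewrite (sw_assoc hH (f := fun a v w => \sw_(b, t <- v) \sw_(a', u <- w) Y x1 x2 a b t a' u));
    try by lin.
  apply: eq_sw => a w.
  rewrite (sw_assoc hH (f := fun b t w => \sw_(a', u <- w) Y x1 x2 a b t a' u)); try by lin.
  apply: eq_sw => b y.
  by rewrite (sw_assoc hH (f := fun t a' u => Y x1 x2 a b t a' u)); lin.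
rewrite [LHS]sw_exch; apply: eq_sw => a w; rewrite [RHS]/=.
rewrite [LHS]sw_exch; apply: eq_sw => b y; rewrite [LHS]sw_exch; apply: eq_sw => m u.
under eq_sw => x1 x2.
  under eq_sw => t a' do rewrite YE.
  rewrite sw_split_sw.
  rewrite (@eq_sw_split _ _ _ _ _ (fun b' c =>
    (k (S (r (m ∙ c)) ∙ (p n (x2 ∙ r a) ∙ x1)) : F) *: (b ∙ b'))); last first.
    move=> b' c; rewrite -swZl.
    rewrite -(sw_push (g := fun e => k (S (r c) ∙ e ∙ x1))); last by lin.
    under eq_sw do rewrite -hprodA //.
    rewrite (twisted_prod_telescope hH hK hr SK) (hmap_prod hr) antipodeM //.
    by rewrite !hprodA.
  over.
rewrite sw_split_sw; apply: eq_sw_split => b' c.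
by rewrite -swZl sw_prodr sw_lfun.
Qed.

End DoublePowerFormula.

(** * Indicators *)

Section InducedTrace.
Variables (F : fieldType) (H K : hopfData F).
Hypothesis hH : is_hopf H.
Hypothesis hK : is_hopf K.
Local Notation Kd := (dual_hopf K).
Variable sigma : 'Hom(tensor Kd H, F^o).
Local Notation r := (sigma_r sigma).
Hypothesis hr : is_hopf_map r.
Local Notation S := (hantipode K).
Hypothesis SK : forall x : K, S (S x) = x.
Implicit Types (h g : H) (x y z : K) (k l : dual K).
Local Notation D := (quantum_double sigma).
Variable V : lmodule H.
Local Notation rho := (double_rep sigma V).

Lemma double_rep_counit (t : D) (v : V) x :
  ev V x (rho t ((hone Kd : dual K) ⊗ v)) = mod_rep V (ev H x t) v.
Proof.
rewrite double_rep_ev //.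
under eq_sw => x1 x2.
  have -> : (fun y => ev V y ((hone Kd : dual K) ⊗ v)) = (fun y => (hcounit K y : F) *: v).
    by apply/funext => y; rewrite ev_tens.
  rewrite coadj_counit //; over.
by rewrite (sw_counitr hK (f := fun x => mod_rep V (ev H x t) v)) //; lin.
Qed.

Lemma double_rep_l l (m : tensor Kd V) x :
  ev V x (rho (l ⊗ hone H : D) m) = \sw_(x1, x2 <- x) (l x1 : F) *: ev V x2 m.
Proof.
rewrite double_rep_ev //; apply: eq_sw => x1 x2.
have lE : linear (fun y => ev V y m) by exact: lin_ev.
rewrite ev_tens (linearZP (lin_coadj1 sigma _ x2)); congr (_ *: _).
exact: (coadj1 hH hK hr lE).
Qed.

Lemma double_rep_gen l (v : V) : rho (l ⊗ hone H : D) ((hone Kd : dual K) ⊗ v) = l ⊗ v.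
Proof.
apply: ev_sep => x; rewrite double_rep_l ev_tens.
under eq_sw do rewrite ev_tens scalerA mulrC -scalerA.
by rewrite (sw_counitr hK (f := fun x => (l x : F) *: v)) //; lin.
Qed.

(* K^* ⋈ V is generated over K^* by the ε ⋈ v, so that a central element is
   determined by its action on these. *)
Lemma double_rep_central (z : D) l (v : V) x : (forall d : D, d ∙ z = z ∙ d) ->
  ev V x (rho z (l ⊗ v)) =
  \sw_(x1, x2 <- x) (l x1 : F) *: mod_rep V (ev H x2 z) v.
Proof.
move=> cz; have [_ rhoM] := double_is_rep hH hK hr SK V.
rewrite -double_rep_gen -comp_lfunE -rhoM -cz rhoM comp_lfunE double_rep_l.
by apply: eq_sw => x1 x2; rewrite double_rep_counit.
Qed.

(** In the basis e_i^* ⊗ e_j, whose coordinates are evaluation at e_i followed by e_j^*, summing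
    over j first takes the trace over V. *)
Lemma lftrace_double (z : D) (T : 'End(K)) : (forall d : D, d ∙ z = z ∙ d) ->
  (forall x, T x = \sw_(x1, x2 <- x) (lftrace (mod_rep V (ev H x2 z)) : F) *: x1) ->
  lftrace (rho z) = lftrace T.
Proof.
move=> cz TE.
rewrite (lftrace_family (J := ('I_(dim K) * 'I_(dim V))%type)
  (phi := fun q t => dual_ebasis q.2 (ev V (ebasis q.1) t))
  (e := fun q => dual_ebasis q.1 ⊗ ebasis q.2)); last 2 first.
- by move=> q; lin.
- move=> t; apply: ev_sep => x; rewrite linear_sum.
  rewrite [LHS](linear_ebasis (f := fun x => ev V x t)); last by exact: lin_ev.
  rewrite -(pair_bigA _ (fun i j => ev V x ((dual_ebasis j (ev V (ebasis i) t) : F) *: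
    (dual_ebasis i ⊗ ebasis j)))); apply: eq_bigr => i _.
  rewrite [ev V (ebasis i) t in LHS]ebasis_sum scaler_sumr; apply: eq_bigr => j _.
  by rewrite [RHS]linearZ /= ev_tens !dual_ebasisE !scalerA mulrC.
rewrite lftraceE -(pair_bigA _ (fun i j => dual_ebasis j (ev V (ebasis i)
    (rho z (dual_ebasis i ⊗ ebasis j))))) /=; apply: eq_bigr => i _.
rewrite TE sw_lfun.
under eq_bigr => j _ do rewrite double_rep_central // sw_lfun sw_sumE.
rewrite exchange_big /= sw_sumE; apply: eq_bigr => q _.
rewrite -scaler_sumr; apply: (congr1 (fun u : F^o => _ *: u)).
rewrite linearZ /= lftraceE scaler_suml.
by apply: eq_bigr => j _; rewrite linearZ /GRing.scale /= mulrC.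
Qed.

End InducedTrace.

Lemma semisimple_normalized_integral (F : fieldType) (A : hopfData F) :
  is_hopf A -> semisimple A -> exists L : A, is_normalized_integral L.
Proof.
move=> hA ssA; have [L [l e]] := semisimple_integral hA ssA.
by exists L; split=> //; exact: integral_right.
Qed.

(** * Evaluation of both sides of the formula *)

Section Indicators.
Variables (F : numClosedFieldType) (H K : hopfData F).
Hypothesis hH : is_hopf H.
Hypothesis hK : is_hopf K.
Hypothesis ssH : semisimple H.
Hypothesis ssK : semisimple K.
Local Notation Kd := (dual_hopf K).
Variable sigma : 'Hom(tensor Kd H, F^o).
Local Notation r := (sigma_r sigma).
Hypothesis hr : is_hopf_map r.
Local Notation S := (hantipode K).
Implicit Types (h g : H) (x y z : K) (k l : dual K).
Local Notation D := (quantum_double sigma).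
Local Notation p n := (@cop_prod F K n).
Local Notation PD n := (sweedler_prod D n.+1).
Local Notation PH n := (sweedler_prod H n.+1).
Local Notation twisted_prod := (@twisted_prod F H K sigma).

Variables (L : H) (E : K).
Hypothesis nL : is_normalized_integral L.
Hypothesis nE : is_normalized_integral E.

Let hLl : forall a, a ∙ L = (hcounit H a : F) *: L. Proof. by case: nL. Qed.
Let hL1 : hcounit H L = 1. Proof. by case: nL. Qed.
Let hEl : forall a, a ∙ E = (hcounit K a : F) *: E. Proof. by case: nE. Qed.
Let hE1 : hcounit K E = 1. Proof. by case: nE. Qed.
Let SK x : S (S x) = x. Proof. by rewrite (antipode_invol hK hEl hE1 ssK). Qed.
Let hD := double_hopf hH hK hr SK.
Let hKc := cop_hopf hK SK.
Local Notation lam := (fint E).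

Let lam1 : lam (hone K) != 0.
Proof. by rewrite gt_eqF // (fint1_gt0 hK hEl hE1). Qed.

Definition cointegral : dual K := (lam (hone K) : F)^-1 *: lam.

Lemma cointegralE x : cointegral x = (lam (hone K))^-1 * lam x.
Proof. by rewrite scale_lfunE. Qed.

Lemma cointegralC x y : cointegral (x ∙ y) = cointegral (y ∙ x).
Proof. by rewrite !cointegralE (fintC hK hEl hE1 ssK). Qed.

Lemma cointegralS x : cointegral (S x) = cointegral x.
Proof. by rewrite !cointegralE (fintS hK hEl hE1 ssK). Qed.

Lemma cointegral_left x :
  \sw_(x1, x2 <- x) (cointegral x2 : F) *: x1 = (cointegral x : F) *: hone K.
Proof.
under eq_sw do rewrite cointegralE -scalerA.
by rewrite -swZr (fint_left1 hK hEl hE1 ssK) scalerA -cointegralE.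
Qed.

(** L absorbs the middle leg of h. As [cointegral] is a trace, the conjugation S(r(h_(3))) x
    r(h_(1)) then collapses under it, and left invariance of [cointegral] does the rest. *)
Lemma double_integral : is_normalized_integral (cointegral ⊗ L : D).
Proof.
have e1 : hcounit D (cointegral ⊗ L : D) = 1.
  by rewrite double_counit_tens // hL1 mulr1 cointegralE mulVf.
have le (d : D) : d ∙ (cointegral ⊗ L) = (hcounit D d : F) *: (cointegral ⊗ L : D).
  apply: ev_sep => x; rewrite double_prod_ev // linearZ /= ev_tens.
  transitivity (\sw_(x1, x2 <- x) ((hcounit H (ev H x1 d) : F) *: ((cointegral x2 : F) *: L))).
    apply: eq_sw => x1 x2; set h := ev H x1 d.
    transitivity (\sw_(h1, u <- h) \sw_(h2, h3 <- u)
      (hcounit H h2 : F) *: ((cointegral (x2 ∙ (r h1 ∙ S (r h3))) : F) *: L)).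
      apply: eq_sw => h1 u; apply: eq_sw => h2 h3.
      rewrite ev_tens linearZ /= regular_repE hLl -hprodA // cointegralC hprodA //.
      by rewrite !scalerA mulrC.
    under eq_sw => h1 u.
      rewrite (sw_counitl hH (f := fun h3 => (cointegral (x2 ∙ (r h1 ∙ S (r h3))) : F) *: L));
        last by lin.
      rewrite -(hmap_antipode hr) -(hmap_prod hr); over.
    rewrite (sw_antipr hH (f := fun h => (cointegral (x2 ∙ r h) : F) *: L)); last by lin.
    by rewrite (hmap_one hr) hprod1r.
  under eq_sw do rewrite scalerA mulrC -scalerA.
  pose G y := (hcounit H (ev H y d) : F) *: L.
  have lG : linear G by rewrite /G; lin.
  transitivity (G (\sw_(x1, x2 <- x) (cointegral x2 : F) *: x1)).
    by rewrite (sw_push _ _ lG); apply: eq_sw => x1 x2; rewrite (linearZP lG).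
  by rewrite cointegral_left (linearZP lG) /G -double_counitE // !scalerA mulrC.
split=> // d; apply: (integral_right hD) => //.
Qed.

Section Value.
Variables (V : lmodule H) (n : nat).
Local Notation chi h := (lftrace (mod_rep V h)).
Local Notation q := (p n E).

Lemma cop_prod_central a : a ∙ q = q ∙ a.
Proof. exact: (@sweedler_prod_central F (cop K) hKc E hEl hE1 n a). Qed.

Lemma cop_prod_antipode : S q = q.
Proof.
have := @sweedler_prod_antipode F (cop K) hKc n E.
rewrite -[sweedler_prod (cop K) n.+1]/(p n : 'End(K)).
rewrite -[hantipode (cop K)]/(S^-1%VF : 'End(K)) !(antipode_invE SK).
by rewrite (antipode_integral hK hEl hE1).
Qed.

(** The Casimir identity of E moves r(a) from the second leg to the first, where it leaves the
    product as S(r(a)). *)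
Lemma twisted_prod_integral m (a : H) : twisted_prod m a E = p m E ∙ S (r a).
Proof.
case: m => [|m].
  rewrite cop_prod1 /twisted_prod (integral_right hK hEl hE1) counit_antipode //.
  by rewrite (hmap_counit hr).
rewrite /twisted_prod cop_prodS sw_prodl -[r a]SK.
rewrite -(casimir_r hK (f := fun x1 x2 => p m x2 ∙ x1)); try by lin.
  by rewrite SK; apply: eq_sw => x1 x2; rewrite hprodA.
exact: integral_right.
Qed.

Lemma lin_chi : linear (fun h => chi h : F^o).
Proof. by apply: (lin_app (@lftrace_lin F V)); lin. Qed.

Lemma nu_double : nu D n.+1 (double_rep sigma V) =
  \sw_(b, c <- PH n L) (chi b * lam (r c ∙ q) : F^o).
Proof.
have lchi := lin_chi.
rewrite /nu (integral_unique double_integral) /character.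
have [dl dr d1] := double_integral.
have cz := sweedler_prod_central hD dl d1 n.
set z := PD n _ in cz *.
pose k : dual K := linfun (fun x => chi (ev H x z) : F^o).
have kE x : k x = chi (ev H x z).
  by rewrite linfunE_linear //; apply: (lin_app lchi); exact: lin_ev.
pose T : 'End(K) := linfun (fun x => \sw_(x1, x2 <- x) (k x2 : F) *: x1).
have TE x : T x = \sw_(x1, x2 <- x) (k x2 : F) *: x1 by rewrite linfunE_linear //; lin.
rewrite (lftrace_double hH hK hr SK (T := T)) //; last first.
  by move=> x; rewrite TE; apply: eq_sw => x1 x2; rewrite kE.
(* The trace of convolution by k is lam(1) k(E), so the power of the integral has to be evaluated at
   E only. *)
rewrite (lftrace_conv hK hEl hE1 ssK TE) kE /z double_power_ev //.
rewrite (sw_push (g := fun h => chi h : F^o)) //.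
under eq_sw => a u.
  rewrite (@sw_split_push F H H F^o n (fun h => chi h : F^o)) //.
  rewrite (@eq_sw_split _ _ _ _ _ (fun b c => (cointegral (S (r (c ∙ a)) ∙ q) * chi b : F^o)));
    last first.
    move=> b c; rewrite (linearZP lchi) twisted_prod_integral hprodA // cointegralC hprodA //.
    by rewrite -antipodeM // -(hmap_prod hr).
  over.
(* Cocommutativity of L makes a the last leg, where [sw_split_prod] needs it to complete the
   coproduct. *)
rewrite (integral_cocomm hH hLl hL1 ssH (f := fun a u =>
   sw_split n (fun b c => (cointegral (S (r (c ∙ a)) ∙ q) * chi b : F^o)) u)); first last.
- by move=> a; apply: lin_sw_split_arg => c; lin.
- by move=> u; apply: lin_sw_split => b c; lin.
rewrite (sw_split_prod hH n (f := fun b c => (cointegral (S (r c) ∙ q) * chi b : F^o)));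
  try by lin.
rewrite sw_mulr; apply: (@eq_sw _ _ F^o) => b c.
(* Both [cointegral] and q are fixed by S, which removes the antipode from r(c); lam(1) cancels
   against the normalization of [cointegral]. *)
rewrite -[S (r c) ∙ q]SK antipodeM // SK cointegralS cop_prod_antipode cointegralC cointegralE.
by rewrite mulrA mulVKf // mulrC.
Qed.

Lemma lftrace_tensor_rep (W : lmodule K) h : lftrace (tensor_rep sigma V W h) =
  \sw_(b, c <- h) (chi b * lftrace (mod_rep W (r c)) : F^o).
Proof.
rewrite /tensor_rep (sw_push _ _ (@lftrace_lin F _)); apply: (@eq_sw _ _ F^o) => b c.
by apply: lftrace_tensor => v w; rewrite tlift_tens; lin.
Qed.

Lemma nu_tensor_cop (W : lmodule K) :
  nu H n.+1 (tensor_rep sigma V W) * nu (cop K) n.+1 (cop_rep W) =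
  \sw_(b, c <- PH n L) (chi b * (lftrace (mod_rep W (r c)) * lftrace (mod_rep W q)) : F^o).
Proof.
rewrite /nu /character (integral_unique nL) (@integral_unique _ (cop K) E nE).
rewrite lftrace_tensor_rep sw_mull; apply: (@eq_sw _ _ F^o) => b c.
by rewrite mulrA.
Qed.

Lemma sum_nu_tensor_cop :
  \sum_(c \in Irr K) nu H n.+1 (tensor_rep sigma V (class_repr c))
                     * nu (cop K) n.+1 (cop_rep (class_repr c)) =
  \sw_(b, c <- PH n L) (chi b * lam (r c ∙ q) : F^o).
Proof.
have [s us sE] := Irr_list hK hEl hE1.
rewrite sE -fsbig_seq //; under eq_bigr do rewrite nu_tensor_cop sw_sumE.
rewrite exchange_big /= sw_sumE; apply: eq_bigr => ij _.
rewrite /GRing.scale /= -!mulr_sumr; congr (_ * (_ * _)).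
set a := r _.
rewrite -(lftrace_lmul hK hEl hE1 ssK) (lftrace_regular hK hEl hE1 ssK (a := a) (b := q)).
  by rewrite sE -fsbig_seq.
by move=> x; rewrite lmulE -!hprodA // cop_prod_central.
Qed.
End Value.

End Indicators.

Lemma nu_double_tensor (F : numClosedFieldType) (H K : hopfData F) :
  is_hopf H -> is_hopf K -> semisimple H -> semisimple K ->
  forall sigma : 'Hom(tensor (dual_hopf K) H, F^o), is_hopf_map (sigma_r sigma) ->
  forall (V : lmodule H) (n : nat),
  nu (quantum_double sigma) n.+1 (double_rep sigma V) =
  \sum_(c \in Irr K)
    nu H n.+1 (tensor_rep sigma V (class_repr c))
    * nu (cop K) n.+1 (cop_rep (class_repr c)).
Proof.
move=> hH hK ssH ssK sigma hr V n.
have [L nL] := semisimple_normalized_integral hH ssH.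
have [E nE] := semisimple_normalized_integral hK ssK.
by rewrite (nu_double hH hK ssH ssK hr nL nE) (sum_nu_tensor_cop hK ssK sigma nL nE).
Qed.

Theorem proposition1p4 (R : realType) (H K : hopfAlgebra R[i])
    (semisimple_H : semisimple H) (semisimple_K : semisimple K)
    (sigma : 'Hom(tensor (dual_hopf K) H, R[i]^o))
    (pairing_sigma : is_hopf_pairing sigma)
    (V : lmodule H) (n : nat) (n_ge1 : (1 <= n)%N) :
  nu (quantum_double sigma) n (double_rep sigma V) =
  \sum_(c \in Irr K)
    nu H n (tensor_rep sigma V (class_repr c))
    * nu (cop K) n (cop_rep (class_repr c)).
Proof.
case: n n_ge1 => // n _.
exact: (@nu_double_tensor (R[i] : numClosedFieldType) H K (hopfP H) (hopfP K)
  semisimple_H semisimple_K sigma pairing_sigma.2).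
Qed.
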